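(* Assume that $\{x_j: j\in\mathbb{N}\}$ is a sequence of i.i.d. random variables that are uniformly distributed over the cube $C_R=[-R/2,R/2]^d$ and $0<\mu<1-\delta$. Then there exist $A,B>0$ such that the sampling inequality $$\frac{r}{R^d}(1-\delta-\mu)\|f\|_2^2\le\sum_{j=1}^r|f(x_j)|^2\le\frac{r}{R^d}(1+\mu)\|f\|_2^2\qquad\text{for all } f\in\widetilde{\mathcal{B}}(R,\delta)$$ holds with probability at least $$1-2A\exp\Big(-B\,\frac{r}{R^d}\,\frac{\mu^2}{41+\mu}\Big).$$ The constant $B$ can be taken to be $B=\frac{\sqrt2}{36}$. For large $R$ and sufficiently large sampling size $r$ the constant $A$ can be chosen of order $A=\exp(CR^d)$ with $C$ depending on the dimension $d$.
   Context: The space of bandlimited functions is $\mathcal{B}=\{f\in L^2(\mathbb{R}^d): \operatorname{supp}\hat f\subseteq[-1/2,1/2]^d\}$, where $\hat f(\xi)=\int_{\mathbb{R}^d}f(x)e^{-2\pi i x\cdot\xi}\,dx$, and $\|\cdot\|_2$ is the norm of $L^2(\mathbb{R}^d)$; functions in $\mathcal{B}$ are continuous, so the point values $f(x_j)$ make sense. A large number $R>0$ and a small $\delta\in(0,1)$ are fixed, and $C_R=[-R/2,R/2]^d$. Set $$\widetilde{\mathcal{B}}(R,\delta)=\Big\{f\in\mathcal{B}:\int_{C_R}|f(x)|^2\,dx\ge(1-\delta)\|f\|_2^2\Big\},$$ $$\mathcal{B}(R,\delta)=\Big\{f\in\mathcal{B}:\|f\|_2^2=1\ \text{and}\ \int_{C_R}|f(x)|^2\,dx\ge1-\delta\Big\}.$$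 It is assumed that $\mathcal{B}(R,\delta)$ is non-empty. The integer $r$ denotes the sampling size, i.e. the number of random samples $x_1,\dots,x_r$ used. *)

(* Defs.v *)
From HB Require Import structures.
From mathcomp Require Import all_boot all_order all_algebra finmap.
From mathcomp Require Import complex.
From mathcomp Require Import all_classical all_reals all_analysis.

Set Implicit Arguments.
Unset Strict Implicit.
Unset Printing Implicit Defensive.
Import Order.TTheory GRing.Theory Num.Theory.
Import numFieldNormedType.Exports.
Local Open Scope classical_set_scope.
Local Open Scope ring_scope.

(* R^n; [measurableTypeR R] is R with the Borel sets on which [lebesgue_measure]
   is defined, so that products with [lebesgue_measure] typecheck. *)
Notation Rvec R n := (n.-tuple (measurableTypeR R)).

Definition vcons (R : realType) (n : nat) (z : measurableTypeR R * Rvec R n) :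
  Rvec R n.+1 := [tuple of z.1 :: z.2].

Section leb_step.
Context (R : realType) (n : nat).
Variable m : {sigma_finite_measure set (Rvec R n) -> \bar R}.
Local Notation R1 := (measurableTypeR R).

Lemma measurable_vcons :
  measurable_fun [set: R1 * Rvec R n] (@vcons R n : _ -> Rvec R n.+1).
Proof. exact: measurable_cons. Qed.

Definition leb_step : set (Rvec R n.+1) -> \bar R :=
  pushforward (lebesgue_measure \x m)%E (@vcons R n).

Let mvcons_preimage (A : set (Rvec R n.+1)) :
  measurable A -> measurable (@vcons R n @^-1` A).
Proof. by move=> mA; rewrite -[X in measurable X]setTI; exact: measurable_vcons. Qed.

Let leb_step0 : leb_step set0 = 0%E.
Proof. by rewrite /leb_step /pushforward preimage_set0 measure0. Qed.

Let leb_step_ge0 A : (0 <= leb_step A)%E.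
Proof. by rewrite /leb_step /pushforward measure_ge0. Qed.

Let leb_step_sigma_additive : semi_sigma_additive leb_step.
Proof.
move=> F mF tF mUF; rewrite /leb_step /pushforward preimage_bigcup.
apply: measure_semi_sigma_additive.
- by move=> k; exact: mvcons_preimage.
- apply/trivIsetP => /= i j _ _ ij; rewrite -preimage_setI.
  by move/trivIsetP : tF => /(_ _ _ _ _ ij) ->//; rewrite preimage_set0.
- by rewrite -preimage_bigcup; exact: mvcons_preimage.
Qed.

HB.instance Definition _ := isMeasure.Build _ _ _ leb_step
  leb_step0 leb_step_ge0 leb_step_sigma_additive.

Let leb_step_sigma_finite : sigma_finite setT leb_step.
Proof.
have /sigma_finiteP[F [TF ndF Foo]] := sigma_finiteT (@lebesgue_measure R).
have /sigma_finiteP[G [TG ndG Goo]] := sigma_finiteT m.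
pose h (x : Rvec R n.+1) : R1 * Rvec R n := (thead x, [tuple of behead x]).
have vconsK : cancel (@vcons R n) h.
  move=> [a t]; rewrite /h /vcons/= theadE; congr pair; exact/val_inj.
have mh : measurable_fun setT h.
  apply/measurable_fun_pairP; split.
    exact: measurable_tnth.
  exact: measurable_behead.
exists (fun k => h @^-1` (F k `*` G k)).
  rewrite -preimage_bigcup; apply/seteqP; split => // x _.
  have [i _ Fi] : (\bigcup_k F k) (h x).1 by rewrite -TF.
  have [j _ Gj] : (\bigcup_k G k) (h x).2 by rewrite -TG.
  exists (maxn i j) => //; split.
    by move: Fi; exact/subsetPset/ndF/leq_maxl.
  by move: Gj; exact/subsetPset/ndG/leq_maxr.
move=> k; have [mFk Fkoo] := Foo k; have [mGk Gkoo] := Goo k.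
have mFG : measurable (F k `*` G k) by exact: measurableX.
split; first by rewrite -[X in measurable X]setTI; exact: mh.
rewrite /leb_step /pushforward.
have -> : @vcons R n @^-1` (h @^-1` (F k `*` G k)) = F k `*` G k.
  by apply/seteqP; split => z; rewrite /preimage /mkset vconsK.
by rewrite product_measure1E// lte_mul_pinfty// ge0_fin_numE.
Qed.

HB.instance Definition _ := Measure_isSigmaFinite.Build _ _ _ leb_step
  leb_step_sigma_finite.

End leb_step.

(* Lebesgue measure on R^d, as an iterated product of [lebesgue_measure]; the
   step is a push-forward along (t, x) |-> t :: x. *)
Fixpoint leb (R : realType) (d : nat) :
    {sigma_finite_measure set (Rvec R d) -> \bar R} :=
  match d with
  | 0 => [the {sigma_finite_measure set (Rvec R 0) -> \bar R} of \d_([tuple])]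
  | n.+1 => [the {sigma_finite_measure set (Rvec R n.+1) -> \bar R}
               of leb_step (leb R n)]
  end.

Section bandlimited_functions.
Context (R : realType) (d : nat).
Implicit Types (f g : Rvec R d -> R[i]) (x xi : Rvec R d) (D : set (Rvec R d)).

Definition cube (L : R) : set (Rvec R d) :=
  [set x | forall i, - (L / 2) <= (tnth x i : R) <= L / 2].

Definition dotv x xi : R := \sum_(i < d) (tnth x i : R) * (tnth xi i : R).

Definition cabs (z : R[i]) : R := ComplexField.Normc.normc z.

Definition L2norm f : \bar R := 'N[leb R d]_(2%:E)[EFin \o (cabs \o f)].

Definition inL2 f : Prop :=
  [/\ measurable_fun setT (@complex.Re R \o f),
      measurable_fun setT (@complex.Im R \o f)
    & (L2norm f < +oo)%E].

Definition complex_integral D f : R[i] :=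
  Complex (\int[leb R d]_(x in D) complex.Re (f x))
          (\int[leb R d]_(x in D) complex.Im (f x)).

Definition cexpi (t : R) : R[i] := Complex (cos t) (sin t).

Definition fourier_integral D f xi : R[i] :=
  complex_integral D (fun x => f x * cexpi (- (2 * pi * dotv x xi))).

(* The integral over R^d need not converge absolutely for f in L^2, so the
   Fourier transform is Plancherel's: the L^2-limit of the integrals over
   growing cubes, determined by f up to null sets. *)
Definition is_fourier_transform f g : Prop :=
  inL2 g /\
  L2norm (fun xi => fourier_integral (cube n%:R) f xi - g xi) @[n --> \oo]
    --> 0%E.

(* Neither [n.-tuple] nor [R[i]] carries a topology in the library, hence the
   detour through row vectors and through real and imaginary parts. *)
Definition continuous_Rvec f : Prop :=
  let F (v : 'rV[R]_d) := f [tuple v ord0 i | i < d] in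
  continuous (@complex.Re R \o F) /\ continuous (@complex.Im R \o F).

(* Each class in the L^2 space B is represented by its continuous member. The
   Fourier transform is an L^2 class, whose support lies in a closed set iff it
   vanishes almost everywhere outside of it. *)
Definition bandlimited f : Prop :=
  [/\ continuous_Rvec f, inL2 f &
      exists2 g, is_fourier_transform f g &
        {ae leb R d, forall xi, ~ cube 1 xi -> g xi = 0}].

Definition cube_energy (L : R) f : \bar R :=
  (\int[leb R d]_(x in cube L) ((cabs (f x) ^+ 2)%:E))%E.

Definition Btilde (L delta : R) : set (Rvec R d -> R[i]) :=
  [set f | bandlimited f /\
           ((1 - delta)%:E * L2norm f ^+ 2 <= cube_energy L f)%E].

Definition Bunit (L delta : R) : set (Rvec R d -> R[i]) :=
  [set f | [/\ bandlimited f, (L2norm f ^+ 2 = 1)%E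
             & ((1 - delta)%:E <= cube_energy L f)%E]].

Definition sampling_inequality (L delta mu : R) (r : nat)
    (x : nat -> Rvec R d) f : Prop :=
  ((r%:R / L ^+ d * (1 - delta - mu))%:E * L2norm f ^+ 2
     <= (\sum_(j < r) cabs (f (x j)) ^+ 2)%:E
     <= (r%:R / L ^+ d * (1 + mu))%:E * L2norm f ^+ 2)%E.

End bandlimited_functions.

Section random_samples.
Context (R : realType) (dO : measure_display) (Omega : measurableType dO).
Variable P : probability Omega R.

Definition mutually_independent (dT : measure_display) (T : measurableType dT)
    (X : nat -> {RV P >-> T}) : Prop :=
  forall (J : {fset nat}) (A : nat -> set T),
    (forall j, measurable (A j)) ->
    P (\bigcap_(j in [set` J]) (X j @^-1` A j)) =
    (\prod_(j <- J) P (X j @^-1` A j))%E.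

Definition uniformly_distributed (d : nat) (K : set (Rvec R d))
    (X : {RV P >-> Rvec R d}) : Prop :=
  forall A : set (Rvec R d), measurable A ->
    P (X @^-1` A) = (leb R d (A `&` K) / leb R d K)%E.

(* The samples x_1, ..., x_r are X 0, ..., X r.-1. *)
Definition sampling_event (d : nat) (L delta mu : R) (r : nat)
    (X : nat -> {RV P >-> Rvec R d}) : set Omega :=
  [set w | forall f, Btilde L delta f ->
             sampling_inequality L delta mu r (fun j => X j w) f].

End random_samples.

Definition sampling_holds_with_constants (R : realType) (d : nat)
    (L delta mu : R) (r : nat) (A B : R) : Prop :=
  forall (dO : measure_display) (Omega : measurableType dO)
    (P : probability Omega R) (X : nat -> {RV P >-> Rvec R d}),
    mutually_independent X ->
    (forall j, uniformly_distributed (cube L) (X j)) ->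
    measurable (sampling_event L delta mu r X) /\
    ((1 - 2 * A * expR (- (B * (r%:R / L ^+ d) * (mu ^+ 2 / (41 + mu)))))%:E
       <= P (sampling_event L delta mu r X))%E.

(* Main.v *)
Require Import Defs.
From HB Require Import structures.
From mathcomp Require Import all_boot all_order all_algebra finmap.
From mathcomp Require Import complex.
From mathcomp Require Import all_classical all_reals all_analysis.
From mathcomp Require Import measurable_realfun simple_functions.
From mathcomp Require Import ring lra zify.
Import Order.TTheory GRing.Theory Num.Theory.
Import numFieldNormedType.Exports.
Local Open Scope classical_set_scope.
Local Open Scope ring_scope.
Set Implicit Arguments.
Unset Strict Implicit.
Unset Printing Implicit Defensive.

(** Divide f by its norm and let D(f) be the sum of |f(x_j)|^2 over the samples,
    minus its mean (r / L^d) int_cube |f|^2. For f in Btilde the integral lies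
    between 1 - delta and 1, so the sampling inequality holds for all f at once
    as soon as |D(f)| <= mu r / L^d on the whole unit ball of bandlimited
    functions. This uniform bound is proved by chaining over finite nets.

    Analysis. A bandlimited f of norm at most 1 is the inverse transform of a
    spectrum g that vanishes off the unit cube and has L^1 norm at most 1; in
    particular |f| <= 1. The transform is an L^2 limit of the transforms F_n of f
    cut off to cubes, so inversion is obtained by duality: F_n is paired with the
    transform of a box, which is square integrable but not integrable, and the
    pairing is computed by Fubini after damping it with exp(-e|xi|); letting e
    tend to 0 and n to infinity, f and the inverse transform of g have the same
    integral over every box, and both are continuous (lemmas fourier_box,
    box_pairing, fourier_inversion). Pairing F_n with g instead gives the
    inequality between the norms (bessel, bandlimited_unit_band).

    Entropy. For x in a cell of side 1/32 with corner c and xi in the unit cube,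
    exp(2 pi i (x - c).xi) differs from a product of Taylor polynomials of degree
    less than N by at most a constant times 8^-N. So f is determined on the cell,
    up to a small error, by finitely many moments of g(xi) exp(2 pi i c.xi).
    Rounding the moments of all the cells gives a finite code: two functions with
    the same code at level k differ by at most 4^-k / 2 on the cube, and there are
    at most exp(C (L+1)^d 2^k) codes (code_close_level, card_code_level).

    Probability. If |f - g| <= e on the cube, then |f|^2 - |g|^2 is bounded by 2e
    there and, the energies being at most 1, its mean square over the cube is at
    most 4 e^2 / L^d. The exponential Markov inequality then bounds the
    probability that D(f) - D(g) exceeds a given multiple of mu r / L^d by an
    exponential in s = r mu^2 / L^d (pair_dev). At level k, where e = 4^-k, the
    probability of exceeding 2^-(k+1) mu r / L^d is at most 2 exp(-s 2^k / 128).
    This beats the number exp(3 C (L+1)^d 2^k) of pairs of codes of consecutive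
    levels, with exp(-s / 900) to spare, once s >= 900 (3 C (L+1)^d + 1)
    (badP, exceptionalP); off this exceptional event the increments of D along
    the chain of approximations of f add up to at most mu r / L^d (chaining). For
    smaller s the claimed probability is negative when A is
    exp(3 C (L+1)^d + 1), because (sqrt 2 / 36) / (41 + mu) <= 1 / 900
    (sampling_holds).

    The sampling event quantifies over uncountably many functions. It is
    measurable because the codes of all levels, on cubes of all integral sides,
    select a countable family that approximates every normalized member of Btilde
    at the samples (sampling_event_countable). *)

(** * Complex-valued functions: modulus, measurability, integrals *)

Section cabs_theory.
Context (R : realType).
Implicit Types z w : R[i].
Local Notation Re := (@complex.Re R).
Local Notation Im := (@complex.Im R).

Lemma cabsE z : cabs z = Num.sqrt (Re z ^+ 2 + Im z ^+ 2).
Proof. by case: z. Qed.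

Lemma sqr_cabs z : cabs z ^+ 2 = Re z ^+ 2 + Im z ^+ 2.
Proof. by rewrite cabsE sqr_sqrtr// addr_ge0 ?sqr_ge0. Qed.

Lemma cabs_ge0 z : 0 <= cabs z.
Proof. by rewrite cabsE sqrtr_ge0. Qed.

Lemma cabs_real (r : R) : 0 <= r -> cabs (Complex r 0) = r.
Proof. by move=> r0; rewrite cabsE/= expr0n/= addr0 sqrtr_sqr ger0_norm. Qed.

Lemma cabs0 : cabs (0 : R[i]) = 0.
Proof. exact: ComplexField.Normc.normc0. Qed.

Lemma cabs1 : cabs (1 : R[i]) = 1.
Proof. exact: ComplexField.Normc.normc1. Qed.

Lemma cabsM z w : cabs (z * w) = cabs z * cabs w.
Proof. exact: ComplexField.Normc.normcM. Qed.

Lemma cabs0_eq0 z : cabs z = 0 -> z = 0.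
Proof. exact: ComplexField.Normc.eq0_normc. Qed.

Lemma cabsD z w : cabs (z + w) <= cabs z + cabs w.
Proof.
have := ler_normD z w.
by rewrite -lecR rmorphD.
Qed.

Lemma cabsN z : cabs (- z) = cabs z.
Proof. by case: z => a b; rewrite !cabsE /= !sqrrN. Qed.

Lemma cabsB z w : cabs (z - w) <= cabs z + cabs w.
Proof. by rewrite -(cabsN w); exact: cabsD. Qed.

Lemma cabs_distC z w : cabs (z - w) = cabs (w - z).
Proof. by rewrite -cabsN opprB. Qed.

Lemma ler_dist_cabs z w : `|cabs z - cabs w| <= cabs (z - w).
Proof.
have := cabsD (z - w) w; rewrite subrK; have := cabsD (w - z) z.
by rewrite subrK cabs_distC ler_norml => h1 h2; apply/andP; split; lra.
Qed.

Lemma cabs_sum (I : Type) (s : seq I) (P : pred I) (F : I -> R[i]) :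
  cabs (\sum_(i <- s | P i) F i) <= \sum_(i <- s | P i) cabs (F i).
Proof.
elim/big_rec2: _ => [|i y1 y2 _ h]; first by rewrite cabs0.
by rewrite (le_trans (cabsD _ _))// lerD2l.
Qed.

Lemma cabs_prod (I : Type) (s : seq I) (P : pred I) (F : I -> R[i]) :
  cabs (\prod_(i <- s | P i) F i) = \prod_(i <- s | P i) cabs (F i).
Proof. by apply: (big_morph _ cabsM cabs1). Qed.

Lemma cabs_conj z : cabs z^*%C = cabs z.
Proof. by case: z => a b; rewrite !cabsE /= sqrrN. Qed.

Lemma normr_Re_le z : `|Re z| <= cabs z.
Proof.
by rewrite -(ger0_norm (cabs_ge0 z)) -ler_sqr ?nnegrE// !real_normK ?num_real//
  sqr_cabs lerDl sqr_ge0.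
Qed.

Lemma normr_Im_le z : `|Im z| <= cabs z.
Proof.
by rewrite -(ger0_norm (cabs_ge0 z)) -ler_sqr ?nnegrE// !real_normK ?num_real//
  sqr_cabs lerDr sqr_ge0.
Qed.

Lemma cabs_le_ReIm z : cabs z <= `|Re z| + `|Im z|.
Proof.
rewrite -ler_sqr ?nnegrE ?addr_ge0 ?cabs_ge0// sqr_cabs.
rewrite sqrrD !real_normK ?num_real// lerD2r lerDl.
by rewrite mulrn_wge0// mulr_ge0.
Qed.

Lemma cReD z w : Re (z + w) = Re z + Re w.  Proof. by case: z; case: w. Qed.
Lemma cImD z w : Im (z + w) = Im z + Im w.  Proof. by case: z; case: w. Qed.
Lemma cReN z : Re (- z) = - Re z.  Proof. by case: z. Qed.
Lemma cImN z : Im (- z) = - Im z.  Proof. by case: z. Qed.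
Lemma cReM z w : Re (z * w) = Re z * Re w - Im z * Im w.
Proof. by case: z; case: w. Qed.
Lemma cImM z w : Im (z * w) = Re z * Im w + Im z * Re w.
Proof. by case: z; case: w. Qed.
Lemma complex_eta z : Complex (Re z) (Im z) = z. Proof. by case: z. Qed.

Lemma mulc_conj z : z * z^*%C = Complex (cabs z ^+ 2) 0.
Proof.
rewrite sqr_cabs; case: z => a b /=; simpc.
by congr Complex; rewrite ?expr2// [b * a]mulrC addNr.
Qed.

Lemma cexpiD (s t : R) : cexpi (s + t) = cexpi s * cexpi t.
Proof.
rewrite /cexpi cosD sinD; simpc; congr Complex.
by rewrite addrC mulrC [X in _ + X]mulrC.
Qed.

Lemma cexpi0 : cexpi (0 : R) = 1.
Proof. by rewrite /cexpi cos0 sin0. Qed.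

Lemma cabs_cexpi (t : R) : cabs (cexpi t) = 1.
Proof. by rewrite cabsE /= cos2Dsin2 sqrtr1. Qed.

Lemma conj_cexpi (t : R) : (cexpi t)^*%C = cexpi (- t).
Proof. by rewrite /cexpi cosN sinN. Qed.

Lemma cexpi_sum (I : Type) (s : seq I) (P : pred I) (F : I -> R) :
  cexpi (\sum_(i <- s | P i) F i) = \prod_(i <- s | P i) cexpi (F i).
Proof. exact: (big_morph _ cexpiD cexpi0). Qed.

End cabs_theory.
#[global] Hint Extern 0 (is_true (0 <= cabs _)) => solve [apply: cabs_ge0] : core.

Section cint_theory.
Context (R : realType) (dT : measure_display) (T : measurableType dT).
Implicit Types (F G : T -> R[i]) (D : set T) (h : T -> R).
Local Notation Re := (@complex.Re R).
Local Notation Im := (@complex.Im R).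

(** Measurability through real and imaginary parts, the form in which it enters
    the definition of L^2. *)
Definition cmeas F := measurable_fun setT (Re \o F) /\ measurable_fun setT (Im \o F).

Lemma cmeas_ext F G : F =1 G -> cmeas F -> cmeas G.
Proof. by move=> /funext ->. Qed.

Lemma cmeas_cst (c : R[i]) : cmeas (fun=> c).
Proof. by split; exact: measurable_cst. Qed.

Lemma cmeas_real h : measurable_fun setT h -> cmeas (fun x => Complex (h x) 0).
Proof. by move=> mh; split => //=; exact: measurable_cst. Qed.

Lemma cmeasD F G : cmeas F -> cmeas G -> cmeas (fun x => F x + G x).
Proof.
move=> [F1 F2] [G1 G2]; split.
  by apply: eq_measurable_fun (measurable_funD F1 G1) => x _ /=; rewrite cReD.
by apply: eq_measurable_fun (measurable_funD F2 G2) => x _ /=; rewrite cImD.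
Qed.

Lemma cmeasN F : cmeas F -> cmeas (fun x => - F x).
Proof.
move=> [F1 F2]; split.
  have := measurableT_comp (@oppr_measurable R setT) F1.
  by apply: eq_measurable_fun => x _ /=; rewrite cReN.
have := measurableT_comp (@oppr_measurable R setT) F2.
by apply: eq_measurable_fun => x _ /=; rewrite cImN.
Qed.

Lemma cmeasB F G : cmeas F -> cmeas G -> cmeas (fun x => F x - G x).
Proof. by move=> mF mG; apply: cmeasD => //; exact: cmeasN. Qed.

Lemma cmeasM F G : cmeas F -> cmeas G -> cmeas (fun x => F x * G x).
Proof.
move=> [F1 F2] [G1 G2]; split.
  have := measurable_funB (measurable_funM F1 G1) (measurable_funM F2 G2).
  by apply: eq_measurable_fun => x _ /=; rewrite cReM.
have := measurable_funD (measurable_funM F1 G2) (measurable_funM F2 G1).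
by apply: eq_measurable_fun => x _ /=; rewrite cImM.
Qed.

Lemma cmeas_prod (I : Type) (s : seq I) (F : I -> T -> R[i]) :
  (forall i, cmeas (F i)) -> cmeas (fun x => \prod_(i <- s) F i x).
Proof.
move=> mF; elim: s => [|i s IH].
  by apply: cmeas_ext (cmeas_cst 1) => x; rewrite big_nil.
by apply: cmeas_ext (cmeasM (mF i) IH) => x; rewrite big_cons.
Qed.

Lemma cmeas_conj F : cmeas F -> cmeas (fun x => (F x)^*%C).
Proof.
move=> [F1 F2]; split.
  by apply: eq_measurable_fun F1 => x _ /=; case: (F x).
have := measurableT_comp (@oppr_measurable R setT) F2.
by apply: eq_measurable_fun => x _ /=; case: (F x).
Qed.

Lemma measurable_cabs F : cmeas F -> measurable_fun setT (@cabs R \o F).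
Proof.
move=> [F1 F2].
have := measurableT_comp (continuous_measurable_fun (@sqrt_continuous R)) (measurable_funD
  (measurable_funX 2 F1) (measurable_funX 2 F2)).
by apply: eq_measurable_fun => x _ /=; rewrite cabsE.
Qed.

Lemma cmeas_cexpi h : measurable_fun setT h -> cmeas (fun x => cexpi (h x)).
Proof.
move=> mh; split => /=.
  apply: measurableT_comp => //; apply: continuous_measurable_fun.
  exact: continuous_cos.
apply: measurableT_comp => //; apply: continuous_measurable_fun.
exact: continuous_sin.
Qed.

Lemma cmeas_comp (d2 : measure_display) (T2 : measurableType d2)
    (F : T -> R[i]) (u : T2 -> T) : cmeas F -> measurable_fun setT u ->
  measurable_fun setT (Re \o (F \o u)) /\ measurable_fun setT (Im \o (F \o u)).
Proof.
by move=> [F1 F2] mu; split; [exact: (measurableT_comp F1)|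
  exact: (measurableT_comp F2)].
Qed.

Section measure.
Variable mu : {measure set T -> \bar R}.

Definition cint D F : R[i] :=
  Complex (\int[mu]_(x in D) Re (F x)) (\int[mu]_(x in D) Im (F x)).

Definition cintegrable D F := cmeas F /\ mu.-integrable D (EFin \o (@cabs R \o F)).

Lemma eq_cint D F G : (forall x, D x -> F x = G x) -> cint D F = cint D G.
Proof.
by move=> FG; rewrite /cint; congr Complex; apply: eq_Rintegral => x /set_mem Dx;
  rewrite FG.
Qed.

Lemma cintegrable_le D F h : measurable D -> cmeas F ->
  mu.-integrable D (EFin \o h) -> (forall x, D x -> cabs (F x) <= h x) ->
  cintegrable D F.
Proof.
move=> mD mF ih Fh; split => //.
apply: (le_integrable mD _ _ ih).
  by apply/measurable_EFinP; apply: measurable_funTS; exact: measurable_cabs.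
move=> x Dx /=; rewrite lee_fin ger0_norm//.
by rewrite (le_trans (Fh x Dx))// ler_norm.
Qed.

Section int.
Context (D : set T) (mD : measurable D).

Lemma cintegrable_Re F : cintegrable D F -> mu.-integrable D (EFin \o (Re \o F)).
Proof.
move=> [[F1 F2] iF]; apply: (le_integrable mD _ _ iF).
  by apply/measurable_EFinP; apply: measurable_funTS.
by move=> x Dx /=; rewrite lee_fin [leRHS]ger0_norm// normr_Re_le.
Qed.

Lemma cintegrable_Im F : cintegrable D F -> mu.-integrable D (EFin \o (Im \o F)).
Proof.
move=> [[F1 F2] iF]; apply: (le_integrable mD _ _ iF).
  by apply/measurable_EFinP; apply: measurable_funTS.
by move=> x Dx /=; rewrite lee_fin [leRHS]ger0_norm// normr_Im_le.
Qed.

Lemma cintegrableD F G : cintegrable D F -> cintegrable D G ->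
  cintegrable D (fun x => F x + G x).
Proof.
move=> [mF iF] [mG iG].
apply: (cintegrable_le mD (cmeasD mF mG) (integrableD mD iF iG)) => x Dx.
exact: cabsD.
Qed.

Lemma cintegrableN F : cintegrable D F -> cintegrable D (fun x => - F x).
Proof.
move=> [mF iF].
by apply: (cintegrable_le mD (cmeasN mF) iF) => x Dx /=; rewrite cabsN.
Qed.

Lemma cintegrableB F G : cintegrable D F -> cintegrable D G ->
  cintegrable D (fun x => F x - G x).
Proof. by move=> iF iG; apply: cintegrableD => //; exact: cintegrableN. Qed.

Lemma cintegrableZ F c : cintegrable D F -> cintegrable D (fun x => c * F x).
Proof.
move=> [mF iF].
apply: (cintegrable_le mD (cmeasM (cmeas_cst c) mF) (integrableZl mD (cabs c) iF)).
by move=> x Dx /=; rewrite cabsM.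
Qed.

Lemma cintegrableMb F G (K : R) : cmeas G -> (forall x, D x -> cabs (G x) <= K) ->
  cintegrable D F -> cintegrable D (fun x => F x * G x).
Proof.
move=> mG GK [mF iF].
apply: (cintegrable_le mD (cmeasM mF mG) (integrableZl mD K iF)).
by move=> x Dx /=; rewrite cabsM mulrC ler_wpM2r// GK.
Qed.

Lemma cintD F G : cintegrable D F -> cintegrable D G ->
  cint D (fun x => F x + G x) = cint D F + cint D G.
Proof.
move=> iF iG; rewrite /cint -[RHS]complex_eta cReD cImD /=; congr Complex.
  rewrite -RintegralD//; [|exact: cintegrable_Re|exact: cintegrable_Re].
  by apply: eq_Rintegral => x _; rewrite cReD.
rewrite -RintegralD//; [|exact: cintegrable_Im|exact: cintegrable_Im].
by apply: eq_Rintegral => x _; rewrite cImD.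
Qed.

Lemma cintZ F c : cintegrable D F -> cint D (fun x => c * F x) = c * cint D F.
Proof.
move=> iF; have i1 := cintegrable_Re iF; have i2 := cintegrable_Im iF.
rewrite /cint -[RHS]complex_eta cReM cImM /=; congr Complex.
  rewrite -!RintegralZl// -RintegralB//; last 2 first.
  - exact: (integrableZl mD _ i1).
  - exact: (integrableZl mD _ i2).
  by apply: eq_Rintegral => x _; rewrite cReM.
rewrite -!RintegralZl// -RintegralD//; last 2 first.
- exact: (integrableZl mD _ i2).
- exact: (integrableZl mD _ i1).
by apply: eq_Rintegral => x _; rewrite cImM.
Qed.

Lemma cintN F : cintegrable D F -> cint D (fun x => - F x) = - cint D F.
Proof.
move=> iF; rewrite -mulN1r -cintZ//.
by apply: eq_cint => x _; rewrite mulN1r.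
Qed.

Lemma cintB F G : cintegrable D F -> cintegrable D G ->
  cint D (fun x => F x - G x) = cint D F - cint D G.
Proof.
by move=> iF iG; rewrite cintD ?cintN//; exact: cintegrableN.
Qed.

Lemma cint_conj F : cintegrable D F -> cint D (fun x => (F x)^*%C) = (cint D F)^*%C.
Proof.
move=> iF; rewrite /cint /=; congr Complex.
  by apply: eq_Rintegral => x _; case: (F x).
rewrite -mulN1r -RintegralZl//; last exact: cintegrable_Im.
by apply: eq_Rintegral => x _; case: (F x) => a b /=; rewrite mulN1r.
Qed.

(** Multiplication by the conjugate of the integral makes the integral real and
    nonnegative, so only real parts are compared. *)
Lemma cabs_cint F : cintegrable D F ->
  cabs (cint D F) <= \int[mu]_(x in D) cabs (F x).
Proof.
move=> iF; set z := cint D F; have zE : z = cint D F by []; clearbody z.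
have [z0|z0] := eqVneq (cabs z) 0.
  by rewrite z0; apply: Rintegral_ge0.
have zp : 0 < cabs z by rewrite lt_def z0 cabs_ge0.
rewrite -(ler_pM2l zp) -expr2.
have -> : cabs z ^+ 2 = Re (z^*%C * z) by rewrite mulrC mulc_conj.
rewrite {2}zE -cintZ// /cint [X in X <= _]/= -RintegralZl//; last by case: iF.
apply: le_Rintegral => //.
- exact: (cintegrable_Re (cintegrableZ _ iF)).
- by case: iF => _ iF; exact: (integrableZl mD _ iF).
move=> x Dx; rewrite (le_trans (ler_norm _))// (le_trans (normr_Re_le _))//.
by rewrite cabsM cabs_conj.
Qed.

End int.

Lemma cint_mkcond D F : cint D F = cint setT (fun x => (\1_D x : R)%:C%C * F x).
Proof.
rewrite /cint; congr Complex; rewrite Rintegral_mkcond; apply: eq_Rintegral => x _.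
  rewrite cReM/= mul0r subr0 indicE patchE.
  by case: ifPn => xD; rewrite ?mul1r ?mul0r.
rewrite cImM/= mul0r addr0 indicE patchE.
by case: ifPn => xD; rewrite ?mul1r ?mul0r.
Qed.

Lemma cmeas_indic D : measurable D -> cmeas (fun x => (\1_D x : R)%:C%C).
Proof. by move=> mD; apply: cmeas_real; exact: measurable_indic. Qed.

Lemma cintegrable_mkcond D F : measurable D -> cmeas F ->
  cintegrable D F <-> cintegrable setT (fun x => (\1_D x : R)%:C%C * F x).
Proof.
move=> mD mF.
have e : (EFin \o (@cabs R \o (fun x => (\1_D x : R)%:C%C * F x))) =
    ((EFin \o (@cabs R \o F)) \_ D).
  apply/funext => x; rewrite /= patchE indicE cabsM.
  by case: ifPn => xD; rewrite cabs_real ?mul1r ?mul0r.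
split=> -[m i]; split=> //.
- by apply: cmeasM => //; exact: cmeas_indic.
- by rewrite e -integrable_mkcond.
- by move: i; rewrite e -integrable_mkcond.
Qed.

End measure.
End cint_theory.

(** * Fubini, and Lebesgue measure on R^d as an iterated product *)

Section Rfubini.
Context (R : realType) (d1 d2 : measure_display)
  (T1 : measurableType d1) (T2 : measurableType d2).
Variables (m1 : {sigma_finite_measure set T1 -> \bar R})
  (m2 : {sigma_finite_measure set T2 -> \bar R}).
Implicit Types (f : T1 * T2 -> R) (F : T1 * T2 -> R[i]).

(** An integrable function is finite almost everywhere, so passing to real values
    does not change its integral. *)
Lemma integral_fine (dT : measure_display) (T : measurableType dT)
    (mu : {measure set T -> \bar R}) (g : T -> \bar R) :
  mu.-integrable setT g -> (\int[mu]_x (fine (g x))%:E = \int[mu]_x g x)%E.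
Proof.
move=> ig; have mg := measurable_int mu ig.
apply: ae_eq_integral => //.
  by apply/measurable_EFinP; apply: measurableT_comp.
have := integrable_ae measurableT ig.
by apply: filterS => x /(_ I) gx _; rewrite fineK.
Qed.

Lemma Rfubini1 f : (m1 \x m2)%E.-integrable setT (EFin \o f) ->
  \int[m1]_x \int[m2]_y f (x, y) = \int[(m1 \x m2)%E]_z f z.
Proof.
move=> fi; rewrite /Rintegral.
rewrite (_ : (fun x => _) = (fun x => (fine (fubini_F m2 (EFin \o f) x))%:E))//.
rewrite integral_fine; last exact: integrable_fubini_F.
by rewrite -integral12_prod_meas1.
Qed.

(** Tonelli applied to the absolute value bounds the marginal. *)
Lemma integrable_fubini_G (f : T1 * T2 -> \bar R) :
  (m1 \x m2)%E.-integrable setT f -> m2.-integrable setT (fubini_G m1 f).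
Proof.
move=> fi; have mf := measurable_int _ fi; apply/integrableP; split.
  exact: (measurable_fubini_G fi).
have fi2 := (@integrable21ltyP _ _ _ _ _ m1 m2 _ mf).1 fi; apply: le_lt_trans fi2.
have m2f : measurable_fun setT (fun y => \int[m1]_x `|f (x, y)|)%E.
  apply: (measurable_fun_fubini_tonelli_G (abse \o f)) => //=.
  exact: measurableT_comp.
apply: ge0_le_integral => //.
- by apply: measurableT_comp => //; exact: (measurable_fubini_G fi).
- by move=> y _; apply: le_abse_integral => //; exact: measurableT_comp.
Qed.

Lemma Rfubini2 f : (m1 \x m2)%E.-integrable setT (EFin \o f) ->
  \int[m2]_y \int[m1]_x f (x, y) = \int[(m1 \x m2)%E]_z f z.
Proof.
move=> fi; rewrite /Rintegral.
rewrite (_ : (fun x => _) = (fun x => (fine (fubini_G m1 (EFin \o f) x))%:E))//.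
rewrite integral_fine; last exact: integrable_fubini_G.
by rewrite -integral21_prod_meas1.
Qed.

Lemma cint_fubini1 F : cintegrable (m1 \x m2)%E setT F ->
  cint m1 setT (fun x => cint m2 setT (fun y => F (x, y))) = cint (m1 \x m2)%E setT F.
Proof.
move=> iF; rewrite /cint /=; congr Complex.
  by rewrite (Rfubini1 (cintegrable_Re measurableT iF)).
by rewrite (Rfubini1 (cintegrable_Im measurableT iF)).
Qed.

Lemma cint_fubini2 F : cintegrable (m1 \x m2)%E setT F ->
  cint m2 setT (fun y => cint m1 setT (fun x => F (x, y))) = cint (m1 \x m2)%E setT F.
Proof.
move=> iF; rewrite /cint /=; congr Complex.
  by rewrite (Rfubini2 (cintegrable_Re measurableT iF)).
by rewrite (Rfubini2 (cintegrable_Im measurableT iF)).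
Qed.

(** Domination by a product of integrable functions of one variable, the form in
    which every kernel below satisfies the hypothesis of Fubini. *)
Lemma cintegrable_prod F (g : T1 -> R) (h : T2 -> R) :
  cmeas F -> m1.-integrable setT (EFin \o g) -> m2.-integrable setT (EFin \o h) ->
  (forall x, 0 <= g x) -> (forall y, 0 <= h y) ->
  (forall x y, cabs (F (x, y)) <= g x * h y) -> cintegrable (m1 \x m2)%E setT F.
Proof.
move=> mF ig ih g0 h0 Fgh; split=> //.
have mg := measurable_int _ ig; have mh := measurable_int _ ih.
have mF' : measurable_fun setT (EFin \o (@cabs R \o F)).
  by apply/measurable_EFinP; exact: measurable_cabs.
apply/(@integrable12ltyP _ _ _ _ _ m1 m2 (EFin \o (@cabs R \o F)) mF').
apply: (@le_lt_trans _ _ (\int[m1]_x \int[m2]_y ((g x)%:E * (h y)%:E))%E).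
  have mgh : measurable_fun setT (fun z : T1 * T2 => (g z.1)%:E * (h z.2)%:E)%E.
    apply: emeasurable_funM.
      exact: (measurableT_comp mg measurable_fst).
    exact: (measurableT_comp mh measurable_snd).
  have mF2 : measurable_fun setT (abse \o (EFin \o (@cabs R \o F))).
    exact: (measurableT_comp (@abse_measurable R setT) mF').
  have gh0 : forall z : T1 * T2, (0 <= (g z.1)%:E * (h z.2)%:E)%E.
    by move=> z; rewrite mule_ge0// lee_fin.
  apply: ge0_le_integral => //.
  - by move=> x _; exact: integral_ge0.
  - apply: (measurable_fun_fubini_tonelli_F (abse \o (EFin \o (@cabs R \o F)))) => //.
    by move=> z; exact: abse_ge0.
  - exact: (measurable_fun_fubini_tonelli_F (fun z : T1 * T2 => (g z.1)%:E * (h z.2)%:E)%E).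
  - move=> x _; apply: ge0_le_integral => //.
    + exact: (measurableT_comp mF2 (pair1_measurable x)).
    + apply: emeasurable_funM => //; exact: measurable_cst.
    + by move=> y _; rewrite /= ger0_norm// -EFinM lee_fin.
rewrite (_ : (fun x => _) = (fun x => (\int[m2]_y (h y)%:E) * (g x)%:E)%E); last first.
  apply/funext => x; rewrite ge0_integralZl_EFin// 1?muleC//.
  by move=> y _; rewrite lee_fin.
rewrite ge0_integralZl//.
- apply: lte_mul_pinfty.
  + by apply: integral_ge0 => y _; rewrite lee_fin.
  + exact: (integrable_fin_num measurableT ih).
  + exact: (integrable_lty measurableT ig).
- by move=> x _; rewrite lee_fin.
- by apply: integral_ge0 => y _; rewrite lee_fin.
Qed.

(** The form of Fubini used for transforms: the kernel couples the two variables
    and has modulus at most 1. *)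
Lemma cint_exchange (v : T1 -> R[i]) (u : T2 -> R[i]) (k : T2 * T1 -> R[i]) :
  cintegrable m1 setT v -> cintegrable m2 setT u ->
  cmeas k -> (forall z, cabs (k z) <= 1) ->
  cint m1 setT (fun xi => v xi * cint m2 setT (fun x => u x * k (x, xi))) =
  cint m2 setT (fun x => u x * cint m1 setT (fun xi => v xi * k (x, xi))).
Proof.
move=> iv iu mk k1.
have mswap : measurable_fun setT (fun z : T1 * T2 => (z.2, z.1)).
  by apply/measurable_fun_pairP; split; [exact: measurable_snd|exact: measurable_fst].
pose F (z : T1 * T2) := v z.1 * (u z.2 * k (z.2, z.1)).
have iF : cintegrable (m1 \x m2)%E setT F.
  apply: (cintegrable_prod _ iv.2 iu.2) => [|x|x|x y]; rewrite /comp ?cabs_ge0//.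
    apply: cmeasM; first exact: (cmeas_comp iv.1 measurable_fst).
    apply: cmeasM; first exact: (cmeas_comp iu.1 measurable_snd).
    exact: (cmeas_comp mk mswap).
  by rewrite /F !cabsM ler_wpM2l// ler_piMr.
transitivity (cint m1 setT (fun xi => cint m2 setT (fun x => F (xi, x)))).
  apply: eq_cint => xi _; rewrite -cintZ//.
  apply: (@cintegrableMb _ _ _ _ _ measurableT _ _ 1) => //.
  exact: (cmeas_comp mk (pair2_measurable xi)).
rewrite cint_fubini1// -cint_fubini2//; apply: eq_cint => x _.
rewrite -cintZ//; first by apply: eq_cint => xi _; rewrite /F /= mulrCA.
apply: (@cintegrableMb _ _ _ _ _ measurableT _ _ 1) => //.
exact: (cmeas_comp mk (pair1_measurable x)).
Qed.

End Rfubini.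

Section leb_product.
Context (R : realType).
Local Notation R1 := (measurableTypeR R).
Local Notation mu := (@lebesgue_measure R).

(** The measure on R^(n+1) is the push-forward of a product, so that the first
    coordinate can be integrated separately. *)
Lemma ge0_integral_leb_cons n (f : Rvec R n.+1 -> \bar R) :
  measurable_fun setT f -> (forall x, (0 <= f x)%E) ->
  (\int[leb R n.+1]_x f x = \int[mu]_t \int[leb R n]_x f (vcons (t, x)))%E.
Proof.
move=> mf f0.
have -> : (\int[leb R n.+1]_x f x = \int[(mu \x leb R n)%E]_z f (vcons z))%E.
  exact: (@ge0_integral_pushforward _ _ _ _ R (@vcons R n) (@measurable_vcons R n)
    (mu \x leb R n)%E setT f measurableT).
rewrite (@fubini_tonelli1 _ _ _ _ _ mu (leb R n) (f \o @vcons R n))//.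
- exact: (measurableT_comp mf (@measurable_vcons R n)).
- by move=> z; exact: f0.
Qed.

Lemma cintegrable_vcons n (F : Rvec R n.+1 -> R[i]) :
  cintegrable (leb R n.+1) setT F -> cintegrable (mu \x leb R n)%E setT (F \o @vcons R n).
Proof.
move=> [mF iF]; split.
  by have := cmeas_comp mF (@measurable_vcons R n).
have mc := measurable_cabs mF.
apply/integrableP; split.
  apply/measurable_EFinP.
  exact: (measurableT_comp mc (@measurable_vcons R n)).
move/integrableP : iF => [_]; apply: le_lt_trans.
rewrite le_eqVlt; apply/orP; left; apply/eqP/esym.
apply: (@ge0_integral_pushforward _ _ _ _ R (@vcons R n) (@measurable_vcons R n)
    (mu \x leb R n)%E setT (fun x => `|(cabs (F x))%:E|%E) measurableT) => //.
by apply: measurableT_comp => //; apply/measurable_EFinP.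
Qed.

Lemma cint_leb_cons n (F : Rvec R n.+1 -> R[i]) :
  cintegrable (leb R n.+1) setT F ->
  cint (leb R n.+1) setT F =
  cint mu setT (fun t => cint (leb R n) setT (fun x => F (vcons (t, x)))).
Proof.
move=> iF; have iF' := cintegrable_vcons iF.
rewrite (@cint_fubini1 R _ _ _ _ mu (leb R n) (F \o @vcons R n))//.
rewrite /cint; congr Complex; rewrite /Rintegral; congr fine.
  exact: (@integral_pushforward _ _ _ _ R (@vcons R n) (@measurable_vcons R n)
    (mu \x leb R n)%E setT _ (measurableT_comp (@EFin_measurable R setT) iF.1.1) (cintegrable_Re measurableT iF') measurableT).
exact: (@integral_pushforward _ _ _ _ R (@vcons R n) (@measurable_vcons R n)
    (mu \x leb R n)%E setT _ (measurableT_comp (@EFin_measurable R setT) iF.1.2) (cintegrable_Im measurableT iF') measurableT).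
Qed.

Lemma tnth_vconsS n (t : R1) (x : Rvec R n) i :
  tnth (vcons (t, x)) (lift ord0 i) = tnth x i.
Proof. by rewrite tnthS. Qed.

Lemma measurable_tnth_comp (d2 : measure_display) (T2 : measurableType d2) n i (u : R1 -> T2) :
  measurable_fun setT u -> measurable_fun setT (fun x : Rvec R n => u (tnth x i)).
Proof. by move=> mu'; exact: (measurableT_comp mu' (measurable_tnth i)). Qed.

Lemma ge0_integral_leb_prod n (f : 'I_n -> R1 -> R) :
  (forall i, measurable_fun setT (f i)) -> (forall i t, 0 <= f i t) ->
  (\int[leb R n]_x (\prod_(i < n) f i (tnth x i))%:E =
   \prod_(i < n) \int[mu]_t (f i t)%:E)%E.
Proof.
elim: n f => [|n IH] f mf f0.
  rewrite big_ord0 (_ : (fun x => _) = cst 1%E); last first.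
    by apply/funext => x; rewrite big_ord0.
  by rewrite integral_cst// mul1e /= diracT.
rewrite ge0_integral_leb_cons; last 2 first.
- apply/measurable_EFinP; apply: measurable_prod => i _.
  exact: measurable_tnth_comp.
- by move=> x; rewrite lee_fin prodr_ge0.
rewrite big_ord_recl -IH//.
rewrite -ge0_integralZr//; last 3 first.
- by apply/measurable_EFinP; exact: mf.
- by move=> x _; rewrite lee_fin.
- by apply: integral_ge0 => x _; rewrite lee_fin prodr_ge0.
apply: eq_integral => t _.
rewrite -ge0_integralZl_EFin//; last 2 first.
- by move=> x _; rewrite lee_fin prodr_ge0.
- apply/measurable_EFinP; apply: measurable_prod => i _.
  by apply: measurable_tnth_comp.
apply: eq_integral => x _; rewrite -EFinM big_ord_recl.
by congr (_ * _)%:E; apply: eq_bigr => i _; rewrite tnth_vconsS.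
Qed.

Lemma cmeas_tnth n i (u : R1 -> R[i]) :
  cmeas u -> cmeas (fun x : Rvec R n => u (tnth x i)).
Proof. by move=> mu'; have := cmeas_comp mu' (@measurable_tnth _ _ n i). Qed.

Lemma cintegrable_leb_prod n (F : 'I_n -> R1 -> R[i]) :
  (forall i, cintegrable mu setT (F i)) ->
  cintegrable (leb R n) setT (fun x => \prod_(i < n) F i (tnth x i)).
Proof.
move=> iF; split.
  apply: cmeas_prod => i; apply: cmeas_tnth; by case: (iF i).
apply/integrableP; split.
  apply/measurable_EFinP; apply: measurable_cabs.
  apply: cmeas_prod => i; apply: cmeas_tnth; by case: (iF i).
under eq_integral => x _ do rewrite /= ger0_norm// cabs_prod.
rewrite (ge0_integral_leb_prod (f := fun i => @cabs R \o F i)); last 2 first.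
- by move=> i; apply: measurable_cabs; case: (iF i).
- by move=> i t /=.
rewrite ltey_eq; apply/orP; left.
apply: prode_fin_num => i _.
by case: (iF i) => _ /(integrable_fin_num measurableT).
Qed.

Lemma cint_leb_prod n (F : 'I_n -> R1 -> R[i]) :
  (forall i, cintegrable mu setT (F i)) ->
  cint (leb R n) setT (fun x => \prod_(i < n) F i (tnth x i)) =
  \prod_(i < n) cint mu setT (F i).
Proof.
elim: n F => [|n IH] F iF.
  rewrite big_ord0 (@eq_cint _ _ _ _ _ _ (fun=> 1)); last first.
    by move=> x _; rewrite big_ord0.
  rewrite /cint [X in Complex X _]Rintegral_cst// [X in Complex _ X]Rintegral_cst//.
  by rewrite mul0r mul1r; congr Complex; rewrite /= indicT.
rewrite cint_leb_cons; last exact: cintegrable_leb_prod.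
rewrite big_ord_recl -IH// mulrC -cintZ//.
apply: eq_cint => t _; rewrite mulrC.
rewrite -(cintZ measurableT _ (cintegrable_leb_prod (fun i => iF (lift ord0 i)))).
apply: eq_cint => x _; rewrite big_ord_recl.
by congr (_ * _); apply: eq_bigr => i _; rewrite tnth_vconsS.
Qed.

End leb_product.

(** * Integrals of damped cosines *)

Section poisson.
Context (R : realType).
Local Notation mu := (@lebesgue_measure R).

(** The factor that makes transforms of boxes absolutely integrable; it is removed
    by letting e tend to 0. *)
Definition damp (e x : R) : R := expR (- (e * `|x|)).

Lemma damp_ge0 e x : 0 <= damp e x. Proof. exact: expR_ge0. Qed.

Lemma damp_le1 e x : 0 <= e -> damp e x <= 1.
Proof. by move=> e0; rewrite /damp -expR0 ler_expR oppr_le0 mulr_ge0. Qed.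

Lemma continuous_damp e : continuous (damp e).
Proof.
move=> x; rewrite /damp; apply: continuous_comp; last exact: continuous_expR.
apply: continuousN; apply: continuousM; first exact: cst_continuous.
exact: norm_continuous.
Qed.

Lemma is_derive_continuous (F dF : R -> R) :
  (forall x : R, is_derive x 1 F (dF x)) -> continuous F.
Proof.
move=> dFx x; apply: differentiable_continuous; apply/derivable1_diffP.
exact: (@ex_derive _ _ _ _ _ _ _ (dFx x)).
Qed.

Lemma Rintegral_is_derive (F f : R -> R) (a b : R) : a < b ->
  (forall x : R, is_derive x 1 F (f x)) -> continuous f ->
  \int[mu]_(x in `[a, b]) f x = F b - F a.
Proof.
move=> ab dF cf; have cF := is_derive_continuous dF.
rewrite /Rintegral (@continuous_FTC2 R f F a b ab)//.
- exact: continuous_subspaceT.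
- split => //; first by apply: cvg_at_right_filter; exact: cF.
  by apply: cvg_at_left_filter; exact: cF.
- by move=> y _; rewrite derive1E; exact: (@derive_val _ _ _ _ _ _ _ (dF y)).
Qed.

Lemma integral_halfline_is_derive (F f : R -> R) :
  (forall x : R, is_derive x 1 F (f x)) -> continuous f -> (forall x, 0 <= f x) ->
  F x @[x --> +oo] --> 0 ->
  (\int[mu]_(x in `[0%R, +oo[) (f x)%:E = (- F 0)%:E)%E.
Proof.
move=> dF cf f0 F0; have cF := is_derive_continuous dF.
rewrite (@ge0_continuous_FTC2y R f F 0 0)//.
- by rewrite -EFinB sub0r.
- exact: continuous_subspaceT.
- by apply: cvg_at_right_filter; exact: cF.
- by move=> x _; rewrite derive1E; exact: (@derive_val _ _ _ _ _ _ _ (dF x)).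
Qed.

Lemma is_derive_scale (c x : R) : is_derive x 1 (fun t : R => c * t) c.
Proof.
have := is_deriveM (is_derive_cst c x 1) (is_derive_id x 1).
by rewrite scaler0 addr0 => h; apply: is_derive_eq; rewrite /GRing.scale/= mulr1.
Qed.

Lemma is_derive_expscale (e x : R) :
  is_derive x 1 (fun t : R => expR (- (e * t))) (- e * expR (- (e * x))).
Proof.
have h := @is_derive1_comp R expR (fun t => - e * t) x _ _ (is_derive_expR _)
  (is_derive_scale (- e) x).
have -> : (fun t : R => expR (- (e * t))) = expR \o (fun t => - e * t).
  by apply/funext => t /=; rewrite mulNr.
by apply: is_derive_eq; rewrite mulNr mulrC.
Qed.

Lemma is_derive_cosscale (w x : R) :
  is_derive x 1 (fun t : R => cos (w * t)) (- w * sin (w * x)).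
Proof.
have h := @is_derive1_comp R (@cos R) (fun t => w * t) x _ _ (is_derive_cos _)
  (is_derive_scale w x).
by apply: is_derive_eq; rewrite mulrC mulrN mulNr.
Qed.

Lemma is_derive_sinscale (w x : R) :
  is_derive x 1 (fun t : R => sin (w * t)) (w * cos (w * x)).
Proof.
have h := @is_derive1_comp R (@sin R) (fun t => w * t) x _ _ (is_derive_sin _)
  (is_derive_scale w x).
by apply: is_derive_eq; rewrite mulrC.
Qed.

(** The primitive is the real part of exp((-e + iw)t) / (-e + iw). *)
Lemma is_derive_dampcos (e w x : R) : 0 < e ->
  is_derive x 1 (fun t : R => expR (- (e * t)) *
      ((w * sin (w * t) - e * cos (w * t)) / (e ^+ 2 + w ^+ 2)))
    (expR (- (e * x)) * cos (w * x)).
Proof.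
move=> e0.
have D0 : e ^+ 2 + w ^+ 2 != 0 by rewrite gt_eqF// ltr_wpDr ?sqr_ge0 ?exprn_gt0.
have h1 := is_derive_expscale e x.
have h2 := is_derive_cosscale w x.
have h3 := is_derive_sinscale w x.
have h := is_deriveM h1 (is_deriveM (is_deriveB (is_deriveM (is_derive_cst w x 1) h3)
  (is_deriveM (is_derive_cst e x 1) h2)) (is_derive_cst ((e ^+ 2 + w ^+ 2)^-1) x 1)).
apply: is_derive_eq.
rewrite /GRing.scale /= /cst !fctE.
by field; rewrite ?expr2 in D0 *.
Qed.

Lemma dampcos_prim_bound (e w t : R) : 0 < e ->
  `|(w * sin (w * t) - e * cos (w * t)) / (e ^+ 2 + w ^+ 2)|
  <= (`|w| + e) / (e ^+ 2 + w ^+ 2).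
Proof.
move=> e0.
have D0 : 0 < e ^+ 2 + w ^+ 2 by rewrite ltr_wpDr ?sqr_ge0 ?exprn_gt0.
have D1 : 0 <= (e ^+ 2 + w ^+ 2)^-1 by rewrite invr_ge0 ltW.
rewrite normrM (ger0_norm D1) ler_wpM2r//.
rewrite (le_trans (ler_normB _ _))// !normrM (ger0_norm (ltW e0)) lerD//.
  by rewrite ler_piMr// sin_max.
by rewrite ler_piMr ?cos_max// ltW.
Qed.

Lemma cvg_dampcos_prim (e w : R) : 0 < e ->
  (fun t : R => expR (- (e * t)) *
      ((w * sin (w * t) - e * cos (w * t)) / (e ^+ 2 + w ^+ 2))) x @[x --> +oo] --> 0.
Proof.
move=> e0.
pose M := (`|w| + e) / (e ^+ 2 + w ^+ 2).
have eM : (fun t : R => expR (- (e * t)) * M) x @[x --> +oo] --> 0.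
  rewrite -[X in _ --> X](mul0r M); apply: cvgM; last exact: cvg_cst.
  apply: (@cvg_comp _ _ _ (fun t : R => e * t) (fun y => expR (- y)) _ +oo).
    by apply: gt0_cvgMry => //; exact: cvg_id.
  exact: cvgr_expR.
apply: (squeeze_cvgr (f := fun t => - (expR (- (e * t)) * M)) _ _ eM); last first.
  by rewrite -oppr0; exact: cvgN.
near=> t.
rewrite -ler_norml normrM (ger0_norm (expR_ge0 _)) ler_wpM2l ?expR_ge0//.
exact: dampcos_prim_bound.
Unshelve. all: by end_near. Qed.

Lemma cvg_exp_prim (e : R) : 0 < e ->
  (fun t : R => - expR (- (e * t)) / e) x @[x --> +oo] --> 0.
Proof.
move=> e0.
rewrite -[X in _ --> X](mul0r e^-1) -[X in X * _]oppr0; apply: cvgM; last exact: cvg_cst.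
apply: cvgN.
apply: (@cvg_comp _ _ _ (fun t : R => e * t) (fun y => expR (- y)) _ +oo).
  by apply: gt0_cvgMry => //; exact: cvg_id.
exact: cvgr_expR.
Qed.

Lemma integral_damp_halfline (e : R) : 0 < e ->
  (\int[mu]_(t in `[0%R, +oo[) (expR (- (e * t)))%:E = (e^-1)%:E)%E.
Proof.
move=> e0; have en0 : e != 0 by rewrite gt_eqF.
pose F (t : R) : R := - expR (- (e * t)) / e.
have dF (x : R) : is_derive x 1 F (expR (- (e * x))).
  have h := is_derive_expscale e x.
  have h' := is_deriveM (is_deriveN h) (is_derive_cst (e^-1) x 1).
  rewrite /F; apply: is_derive_eq; rewrite /GRing.scale /= /cst ?fctE.
  by field.
rewrite (integral_halfline_is_derive dF).
- by rewrite /F mulr0 oppr0 expR0 mulN1r opprK.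
- exact: (is_derive_continuous (is_derive_expscale e)).
- by move=> x; exact: expR_ge0.
- exact: cvg_exp_prim.
Qed.

(** The factor 1 - cos, instead of cos, keeps the integrand nonnegative, as the
    fundamental theorem on a half-line requires. *)
Lemma integral_damp_cos_halfline (e w : R) : 0 < e ->
  (\int[mu]_(t in `[0%R, +oo[) (expR (- (e * t)) * (1 - cos (w * t)))%:E
     = (e^-1 - e / (e ^+ 2 + w ^+ 2))%:E)%E.
Proof.
move=> e0; have en0 : e != 0 by rewrite gt_eqF.
have D0 : e ^+ 2 + w ^+ 2 != 0 by rewrite gt_eqF// ltr_wpDr ?sqr_ge0 ?exprn_gt0.
pose F (t : R) : R := - expR (- (e * t)) / e - expR (- (e * t)) *
      ((w * sin (w * t) - e * cos (w * t)) / (e ^+ 2 + w ^+ 2)).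
have dF (x : R) : is_derive x 1 F (expR (- (e * x)) * (1 - cos (w * x))).
  have h := is_derive_expscale e x.
  have h' := is_deriveM (is_deriveN h) (is_derive_cst (e^-1) x 1).
  have h2 := is_deriveB h' (is_derive_dampcos w x e0).
  rewrite /F; apply: is_derive_eq; rewrite /GRing.scale /= /cst ?fctE.
  by field.
rewrite (integral_halfline_is_derive dF).
- rewrite /F !mulr0 oppr0 expR0 sin0 cos0; congr EFin.
  by field; rewrite ?expr2 in D0 *; apply/andP.
- move=> x; apply: cvgM; first exact: (is_derive_continuous (is_derive_expscale e)).
  apply: cvgB; first exact: cvg_cst.
  exact: (is_derive_continuous (is_derive_cosscale w)).
- by move=> x; rewrite mulr_ge0 ?expR_ge0// subr_ge0 (le_trans (ler_norm _))// cos_max.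
- rewrite -[X in _ --> X]subr0; apply: cvgB; [exact: cvg_exp_prim|exact: cvg_dampcos_prim].
Qed.

End poisson.

(** * The transform of the damping factor *)

Section damp_transform.
Context (R : realType).
Local Notation mu := (@lebesgue_measure R).
Local Notation R1 := (measurableTypeR R).

Lemma measurable_damp (e : R) : measurable_fun [set: R1] (damp e).
Proof. exact: (continuous_measurable_fun (@continuous_damp R e)). Qed.

Lemma integral_damp (e : R) : 0 < e ->
  (\int[mu]_t (damp e t)%:E = (2 / e)%:E)%E.
Proof.
move=> e0; rewrite ge0_symfun_integralT; last 3 first.
- by move=> x; exact: damp_ge0.
- exact: continuous_damp.
- by move=> x /=; rewrite /damp normrN.
rewrite -set_itvcy EFinM -integral_damp_halfline//; congr (_ * _)%E.
apply: eq_integral => x; rewrite inE/= in_itv/= andbT => x0.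
by rewrite /damp ger0_norm.
Qed.

Lemma integrable_damp (e : R) : 0 < e -> mu.-integrable setT (EFin \o damp e).
Proof.
move=> e0; apply/integrableP; split.
  by apply/measurable_EFinP; exact: measurable_damp.
under eq_integral => x _ do rewrite /= ger0_norm ?damp_ge0//.
by rewrite integral_damp// ltry.
Qed.

Lemma Rintegral_opp (f : R1 -> R) : measurable_fun setT f ->
  mu.-integrable setT (EFin \o f) ->
  \int[mu]_x f (- x) = \int[mu]_x f x.
Proof.
move=> mf intf; rewrite /Rintegral; congr fine.
have mopp : measurable_fun [set: R1] (-%R : R1 -> R1) by exact: oppr_measurable.
have pE (h : R1 -> \bar R) : (\int[mu]_x h x = \int[pushforward mu (-%R : R1 -> R1)]_x h x)%E.
  by apply: eq_measure_integral => A mA _; apply/esym; exact: lebesgue_measureN.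
rewrite [RHS]pE integral_pushforward//.
- exact/measurable_EFinP.
- apply/integrableP; split.
    by apply/measurable_EFinP; exact: measurableT_comp.
  move/integrableP : intf => [_]; rewrite pE ge0_integral_pushforward//.
  by apply: measurableT_comp => //; exact/measurable_EFinP.
Qed.

Lemma cintegrable_damp (e : R) (F : R1 -> R[i]) (K : R) : 0 < e -> cmeas F ->
  (forall x, cabs (F x) <= K) -> cintegrable mu setT (fun x => F x * (damp e x)%:C%C).
Proof.
move=> e0 mF FK.
apply: (cintegrable_le measurableT _ (integrableZl measurableT K (integrable_damp e0))).
  by apply: cmeasM => //; apply: cmeas_real; exact: measurable_damp.
by move=> x _ /=; rewrite cabsM cabs_real ?damp_ge0// ler_wpM2r ?damp_ge0.
Qed.

Lemma measurable_scale (w : R) : measurable_fun [set: R1] (fun x : R1 => w * x).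
Proof. by apply: measurable_funM => //; exact: measurable_cst. Qed.

(** The Poisson kernel. Symmetry reduces the real part to the two half-line
    integrals, and the imaginary part is the integral of an odd function. *)
Lemma cint_damp (e w : R) : 0 < e ->
  cint mu setT (fun x : R1 => cexpi (w * x) * (damp e x)%:C%C) =
  Complex (2 * e / (e ^+ 2 + w ^+ 2)) 0.
Proof.
move=> e0; have en0 : e != 0 by rewrite gt_eqF.
have iF : cintegrable mu setT (fun x : R1 => cexpi (w * x) * (damp e x)%:C%C).
  apply: (@cintegrable_damp _ _ 1) => //.
    by apply: cmeas_cexpi; exact: measurable_scale.
  by move=> x; rewrite cabs_cexpi.
have D0 : e ^+ 2 + w ^+ 2 != 0 by rewrite gt_eqF// ltr_wpDr ?sqr_ge0 ?exprn_gt0.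
have i1 := cintegrable_Re measurableT iF; have i2 := cintegrable_Im measurableT iF.
rewrite /cint; congr Complex.
  have ccos := is_derive_continuous (is_derive_cosscale w).
  have E1 : (\int[mu]_x (damp e x * (1 - cos (w * x)))%:E =
      (2 * (e^-1 - e / (e ^+ 2 + w ^+ 2)))%:E)%E.
    rewrite ge0_symfun_integralT; last 3 first.
    - by move=> x; rewrite mulr_ge0 ?damp_ge0// subr_ge0 (le_trans (ler_norm _))// cos_max.
    - move=> x; apply: continuousM; first exact: continuous_damp.
      by apply: continuousB; [exact: cst_continuous|exact: ccos].
    - by move=> x /=; rewrite /damp normrN mulrN cosN.
    rewrite -set_itvcy EFinM -integral_damp_cos_halfline//; congr (_ * _)%E.
    apply: eq_integral => x; rewrite inE/= in_itv/= andbT => x0.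
    by rewrite /damp ger0_norm.
  have -> : (fun x : R1 => complex.Re (cexpi (w * x) * (damp e x)%:C%C)) =
      (fun x => damp e x - damp e x * (1 - cos (w * x))).
    by apply/funext => x; rewrite cReM /= mulr0 subr0; ring.
  rewrite RintegralB//.
  - rewrite /Rintegral E1 integral_damp//=.
    by field; rewrite ?expr2 in D0 *; apply/andP.
  - exact: integrable_damp.
  - have := integrableB measurableT (integrable_damp e0) i1.
    apply: eq_integrable => // x _ /=; rewrite -EFinB; congr EFin.
    by rewrite mulr0 subr0; ring.
have mI := iF.1.2.
have := Rintegral_opp mI i2.
set I := (X in _ = X -> _).
have -> : \int[mu]_x (complex.Im (R:=R) \o (fun x : R1 => cexpi (w * x) * (damp e x)%:C%C)) (- x) = - I.
  rewrite -mulN1r -RintegralZl//; apply: eq_Rintegral => x _ /=.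
  by rewrite !mulr0 !add0r mulrN sinN /damp normrN; ring.
by rewrite /I /= => h; lra.
Qed.

End damp_transform.

(** * The transform of the indicator of an interval *)

Section param.
Context (R : realType) (d1 d2 : measure_display)
  (T1 : measurableType d1) (T2 : measurableType d2)
  (m2 : {sigma_finite_measure set T2 -> \bar R}).

(** Adding the dominating function makes the integrand nonnegative, and then the
    measurability part of Tonelli applies. *)
Lemma measurable_param (F : T1 * T2 -> R) (h : T2 -> R) :
  measurable_fun setT F -> m2.-integrable setT (EFin \o h) ->
  (forall x y, `|F (x, y)| <= h y) ->
  measurable_fun setT (fun x => \int[m2]_y F (x, y)).
Proof.
move=> mF ih Fh.
have mh : measurable_fun setT h by apply/measurable_EFinP; exact: measurable_int ih.
have iF x : m2.-integrable setT (EFin \o (fun y => F (x, y))).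
  apply: (le_integrable measurableT _ _ ih).
    by apply/measurable_EFinP; exact: (measurableT_comp mF (pair1_measurable x)).
  by move=> y _ /=; rewrite lee_fin (le_trans (Fh x y))// ler_norm.
have -> : (fun x => \int[m2]_y F (x, y)) =
    (fun x => fine (\int[m2]_y (F (x, y) + h y)%:E)%E - \int[m2]_y h y).
  by apply/funext => x; rewrite -[X in X - _]/(\int[m2]_y (F (x, y) + h y)) RintegralD// addrK.
apply: measurable_funB; last exact: measurable_cst.
apply: (measurableT_comp (@fine_measurable R setT measurableT)).
apply: (@measurable_fun_fubini_tonelli_F _ _ T1 T2 R m2 (fun z => (F z + h z.2)%:E)).
  apply/measurable_EFinP; apply: measurable_funD => //.
  exact: (measurableT_comp mh measurable_snd).
move=> [x y]; rewrite lee_fin /= -lerBlDr sub0r.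
by rewrite (le_trans _ (lerNnormlW (Fh x y))).
Qed.

Lemma cmeas_param (F : T1 * T2 -> R[i]) (h : T2 -> R) :
  cmeas F -> m2.-integrable setT (EFin \o h) ->
  (forall x y, cabs (F (x, y)) <= h y) ->
  cmeas (fun x => cint m2 setT (fun y => F (x, y))).
Proof.
move=> [F1 F2] ih Fh; split.
  apply: (measurable_param (h := h) F1) => // x y /=.
  by rewrite (le_trans (normr_Re_le _)).
apply: (measurable_param (h := h) F2) => // x y /=.
by rewrite (le_trans (normr_Im_le _)).
Qed.
End param.

Section box1.
Context (R : realType).
Local Notation mu := (@lebesgue_measure R).
Local Notation R1 := (measurableTypeR R).

Definition wave (y x : R) : R[i] := cexpi (2 * pi * (y * x)).

Lemma cabs_wave y x : cabs (wave y x) = 1. Proof. exact: cabs_cexpi. Qed.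

Lemma cmeas_wave2 : cmeas (fun z : R1 * R1 => wave z.2 z.1).
Proof.
apply: cmeas_cexpi; apply: measurable_funM; first exact: measurable_cst.
exact: (measurable_funM measurable_snd measurable_fst).
Qed.

Lemma cmeas_wave y : cmeas (fun x : R1 => wave y x).
Proof. by have := cmeas_comp cmeas_wave2 (pair2_measurable (y : R1)). Qed.

Lemma cmeas_wavel x : cmeas (fun y : R1 => wave y x).
Proof. by have := cmeas_comp cmeas_wave2 (pair1_measurable (x : R1)). Qed.

(** The inverse transform of the indicator of [a, b]. It decays like 1/|x|: square
    integrable, but not integrable. *)
Definition boxft1 (a b : R) (x : R1) : R[i] :=
  cint mu setT (fun y : R1 => (\1_(`[a, b]%classic : set R1) y)%:C%C * wave y x).

Section ab.
Context (a b : R).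
Local Notation I := (`[a, b]%classic : set R1).
Hypothesis ab : a < b.

Lemma integrable_indic_I : mu.-integrable setT (EFin \o (\1_I : R1 -> R)).
Proof.
exact: (integrable_indic_itv a b true false).
Qed.

Lemma cabs_indic_wave x y : cabs ((\1_I y)%:C%C * wave y x) = \1_I y.
Proof. by rewrite cabsM cabs_wave mulr1 cabs_real. Qed.

Lemma cintegrable_indic_wave (x : R1) :
  cintegrable mu setT (fun y : R1 => (\1_I y)%:C%C * wave y x).
Proof.
apply: (cintegrable_le measurableT _ integrable_indic_I).
  apply: cmeasM; last exact: cmeas_wavel.
  by apply: cmeas_indic; exact: measurable_itv.
by move=> y _; rewrite cabs_indic_wave.
Qed.

Lemma cmeas_boxft1 : cmeas (boxft1 a b).
Proof.
apply: (@cmeas_param _ _ _ R1 R1 mu (fun z : R1 * R1 => (\1_I z.2)%:C%C * wave z.2 z.1)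
  (\1_I)).
- apply: cmeasM; last exact: cmeas_wave2.
  have h : cmeas (fun y : R1 => (\1_I y : R)%:C%C) by apply: cmeas_indic; exact: measurable_itv.
  exact: (cmeas_comp h (@measurable_snd _ _ R1 R1)).
- exact: integrable_indic_I.
- by move=> x y; rewrite cabs_indic_wave.
Qed.

Lemma Rintegral_indic_I : \int[mu]_y (\1_I y) = b - a.
Proof.
rewrite /Rintegral integral_indic// setIT /= lebesgue_measure_itv/= lte_fin ab.
by rewrite -EFinB.
Qed.

Lemma cabs_boxft1_le x : cabs (boxft1 a b x) <= b - a.
Proof.
apply: (le_trans (cabs_cint measurableT (cintegrable_indic_wave x))).
by under eq_Rintegral => y _ do rewrite cabs_indic_wave; rewrite Rintegral_indic_I.
Qed.

Lemma boxft1E x : boxft1 a b x = cint mu I (fun y => wave y x).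
Proof. by rewrite cint_mkcond. Qed.

(** Integrating the character over [a, b] gives a difference of two values of
    modulus 1 divided by 2 pi x. *)
Lemma boxft1_decay x : cabs (boxft1 a b x) * `|x| <= 1.
Proof.
have [->|x0] := eqVneq x 0; first by rewrite normr0 mulr0.
have pi0 : 0 < pi :> R by exact: pi_gt0.
have w0 : 2 * pi * x != 0 by rewrite !mulf_neq0// gt_eqF.
set w := 2 * pi * x.
have wy y : 2 * pi * (y * x) = w * y by rewrite /w; ring.
have ReE : complex.Re (boxft1 a b x) = (sin (w * b) - sin (w * a)) / w.
  rewrite boxft1E /cint /= /Rintegral.
  under eq_integral => y _ do rewrite wy.
  have dF (y : R) : is_derive y 1 (fun y => sin (w * y) / w) (cos (w * y)).
    have h := is_derive_sinscale w y.
    have h' := is_deriveM h (is_derive_cst (w^-1) y 1).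
    by apply: is_derive_eq; rewrite /GRing.scale /= /cst ?fctE; field.
  rewrite -/(Rintegral mu `[a, b] (fun y => cos (w * y))) (Rintegral_is_derive ab dF).
    by rewrite mulrBl.
  exact: (is_derive_continuous (is_derive_cosscale w)).
have ImE : complex.Im (boxft1 a b x) = (cos (w * a) - cos (w * b)) / w.
  rewrite boxft1E /cint /= /Rintegral.
  under eq_integral => y _ do rewrite wy.
  have dF (y : R) : is_derive y 1 (fun y => - cos (w * y) / w) (sin (w * y)).
    have h := is_derive_cosscale w y.
    have h' := is_deriveM (is_deriveN h) (is_derive_cst (w^-1) y 1).
    by apply: is_derive_eq; rewrite /GRing.scale /= /cst ?fctE; field.
  rewrite -/(Rintegral mu `[a, b] (fun y => sin (w * y))) (Rintegral_is_derive ab dF).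
    by rewrite mulrBl !mulNr opprK addrC.
  exact: (is_derive_continuous (is_derive_sinscale w)).
rewrite (le_trans (ler_wpM2r (normr_ge0 x) (cabs_le_ReIm _)))// ReE ImE.
have wE : `|w| = 2 * pi * `|x| by rewrite /w normrM gtr0_norm// mulr_gt0.
have s1 : `|(sin (w * b) - sin (w * a)) / w| <= 2 / `|w|.
  rewrite normrM normfV ler_wpM2r ?invr_ge0// (le_trans (ler_normB _ _))//.
  by rewrite -[X in _ <= X]/(1 + 1) lerD// sin_max.
have s2 : `|(cos (w * a) - cos (w * b)) / w| <= 2 / `|w|.
  rewrite normrM normfV ler_wpM2r ?invr_ge0// (le_trans (ler_normB _ _))//.
  by rewrite -[X in _ <= X]/(1 + 1) lerD// cos_max.
rewrite (le_trans (ler_wpM2r (normr_ge0 x) (lerD s1 s2)))// wE.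
have xp : 0 < `|x| by rewrite normr_gt0.
have key (p z : R) : p != 0 -> z != 0 -> (2 / (2 * p * z) + 2 / (2 * p * z)) * z = 2 / p.
  by move=> p0 z0; field; rewrite p0 z0.
rewrite key ?gt_eqF//.
rewrite ler_pdivrMr// mul1r; exact: pi_ge2.
Qed.

Lemma boxft1_sqr_le x : cabs (boxft1 a b x) ^+ 2 <= ((b - a) ^+ 2 + 1) / (1 + x ^+ 2).
Proof.
rewrite ler_pdivlMr ?ltr_wpDr ?sqr_ge0// mulrDr mulr1 lerD//.
  by rewrite lerXn2r ?nnegrE ?cabs_boxft1_le// subr_ge0 ltW.
by rewrite -(real_normK (num_real x)) -exprMn exprn_ile1 ?boxft1_decay// mulr_ge0.
Qed.

Lemma integrable_oneDsqrV :
  mu.-integrable setT (EFin \o (fun x : R1 => (1 + x ^+ 2)^-1)).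
Proof.
have p0 (x : R) : 0 <= (1 + x ^+ 2)^-1 by rewrite invr_ge0 addr_ge0// sqr_ge0.
have cc : continuous (fun x : R => (1 + x ^+ 2)^-1) by exact: continuous_oneDsqrV.
apply/integrableP; split.
  by apply/measurable_EFinP; exact: continuous_measurable_fun.
under eq_integral => x _ do rewrite /= ger0_norm ?p0//.
rewrite ge0_symfun_integralT//; last by move=> x /=; rewrite sqrrN.
rewrite -set_itvcy; have := integral0y_oneDsqr R; rewrite /oneDsqr => ->.
by rewrite -EFinM ltry.
Qed.

Lemma cintegrable_boxft1_sqr :
  mu.-integrable setT (EFin \o (fun x => cabs (boxft1 a b x) ^+ 2)).
Proof.
apply: (le_integrable measurableT _ _
  (integrableZl measurableT ((b - a) ^+ 2 + 1) integrable_oneDsqrV)).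
  by apply/measurable_EFinP; apply: measurable_funX; exact: (measurable_cabs cmeas_boxft1).
move=> x _ /=; rewrite lee_fin !ger0_norm ?sqr_ge0 ?boxft1_sqr_le//.
by rewrite mulr_ge0 ?invr_ge0 ?addr_ge0 ?sqr_ge0.
Qed.

End ab.
End box1.

(** * Poisson smoothing of the indicator of an interval *)

Section poisson_indic.
Context (R : realType).
Local Notation mu := (@lebesgue_measure R).
Local Notation R1 := (measurableTypeR R).

(** The indicator of [a, b] convolved with the Poisson kernel of the half-plane at
    height e / (2 pi). *)
Definition poisson_indic (e a b x : R) : R :=
  (atan (2 * pi * (b - x) / e) - atan (2 * pi * (a - x) / e)) / pi.

Lemma is_derive_atan_affine (c x y : R) :
  is_derive y 1 (fun y : R => atan (c * (y - x))) (c / (1 + (c * (y - x)) ^+ 2)).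
Proof.
have h1 : is_derive y 1 (fun y : R => c * (y - x)) c.
  have h := is_deriveM (is_derive_cst c y 1)
    (is_deriveB (is_derive_id y 1) (is_derive_cst x y 1)).
  by apply: is_derive_eq; rewrite /GRing.scale /= /cst ?fctE; ring.
have h2 : is_derive (c * (y - x)) 1 (@atan R) (1 + (c * (y - x)) ^+ 2)^-1.
  apply: DeriveDef; first exact: derivable_atan.
  by rewrite -derive1E derive1_atan.
have h := @is_derive1_comp R (@atan R) (fun y => c * (y - x)) y _ _ h2 h1.
by apply: is_derive_eq; rewrite mulrC.
Qed.

Lemma integral_poisson (e a b x : R) : 0 < e -> a < b ->
  \int[mu]_(y in `[a, b]) (2 * e / (e ^+ 2 + (2 * pi * (y - x)) ^+ 2)) =
  poisson_indic e a b x.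
Proof.
move=> e0 ab; have en0 : e != 0 by rewrite gt_eqF.
have pin0 : (pi : R) != 0 by rewrite gt_eqF// pi_gt0.
have key (p t : R) : p != 0 ->
    2 * p / e / (1 + (2 * p / e * t) ^+ 2) / p = 2 * e / (e ^+ 2 + (2 * p * t) ^+ 2).
  move=> p0.
  have D0 : e ^+ 2 + (2 * p * t) ^+ 2 != 0.
    by rewrite gt_eqF// ltr_wpDr ?sqr_ge0 ?exprn_gt0.
  have -> : 1 + (2 * p / e * t) ^+ 2 = (e ^+ 2 + (2 * p * t) ^+ 2) / e ^+ 2 by field.
  by move: (_ + _) D0 => D D0; field; rewrite p0 D0 en0.
pose F (y : R) : R := atan (2 * pi / e * (y - x)) / pi.
have dF (y : R) : is_derive y 1 F (2 * e / (e ^+ 2 + (2 * pi * (y - x)) ^+ 2)).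
  have h := is_derive_atan_affine (2 * pi / e) x y.
  have h' := is_deriveM h (is_derive_cst (pi^-1) y 1).
  rewrite -key//; rewrite /F; apply: is_derive_eq; rewrite /GRing.scale /= /cst ?fctE.
  by rewrite mulr0 add0r mulrC.
have cf : continuous (fun y : R => 2 * e / (e ^+ 2 + (2 * pi * (y - x)) ^+ 2)).
  move=> y.
  have D0 : e ^+ 2 + (2 * pi * (y - x)) ^+ 2 != 0.
    by rewrite gt_eqF// ltr_wpDr ?sqr_ge0 ?exprn_gt0.
  apply: cvgM; first exact: cvg_cst.
  apply: cvgV => //.
  apply: cvgD; first exact: cvg_cst.
  have h : (2 * pi * (z - x)) @[z --> y] --> 2 * pi * (y - x).
    apply: cvgM; first exact: cvg_cst.
    by apply: cvgB; [exact: cvg_id|exact: cvg_cst].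
  exact: (cvgM h h).
rewrite (Rintegral_is_derive ab dF cf) /F /poisson_indic mulrBl.
by congr (atan _ / _ - atan _ / _); rewrite mulrAC.
Qed.

Lemma waveD (y z x : R) : wave (y + z) x = wave y x * wave z x.
Proof. by rewrite /wave -cexpiD; congr cexpi; ring. Qed.

Lemma cintegrable_boxft1_damp (e a b x : R) : 0 < e -> a < b ->
  cintegrable mu setT (fun t : R1 => wave (- x) t * boxft1 a b t * (damp e t)%:C%C).
Proof.
move=> e0 ab; apply: (@cintegrable_damp _ _ _ (b - a)) => //.
  by apply: cmeasM; [exact: cmeas_wave|exact: cmeas_boxft1].
by move=> t; rewrite cabsM cabs_wave mul1r cabs_boxft1_le.
Qed.

(** Exchanging the integrals turns the damping factor into a Poisson kernel, which
    remains to be integrated over [a, b]. *)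
Lemma cint_boxft1_damp (e a b x : R) : 0 < e -> a < b ->
  cint mu setT (fun t : R1 => wave (- x) t * boxft1 a b t * (damp e t)%:C%C) =
  Complex (poisson_indic e a b x) 0.
Proof.
move=> e0 ab.
have iv : cintegrable mu setT (fun t : R1 => wave (- x) t * (damp e t)%:C%C).
  apply: (@cintegrable_damp _ _ _ 1) => //; first exact: cmeas_wave.
  by move=> t; rewrite cabs_wave.
have iu : cintegrable mu setT (fun y : R1 => (\1_`[a, b] y)%:C%C).
  split; first by apply: cmeas_indic; exact: measurable_itv.
  by apply: eq_integrable (integrable_indic_I a b) => // y _; rewrite /comp cabs_real.
transitivity (cint mu setT (fun t : R1 => wave (- x) t * (damp e t)%:C%C *
    cint mu setT (fun y : R1 => (\1_`[a, b] y)%:C%C * wave y t))).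
  by apply: eq_cint => t _; rewrite mulrAC.
rewrite (cint_exchange (k := fun z : R1 * R1 => wave z.1 z.2) iv iu); last 2 first.
- by apply: cmeas_cexpi; apply: measurable_funM; [exact: measurable_cst|
    exact: (measurable_funM measurable_fst measurable_snd)].
- by move=> z; rewrite cabs_wave.
rewrite (@eq_cint _ _ _ _ _ _ (fun y : R1 => Complex
  ((2 * e / (e ^+ 2 + (2 * pi * (y - x)) ^+ 2)) * (\1_`[a, b] y)) 0)); last first.
  move=> y _.
  rewrite (@eq_cint _ _ _ _ _ _ (fun t : R1 => cexpi (2 * pi * (y - x) * t) * (damp e t)%:C%C)).
    by rewrite cint_damp// mulrC; simpc.
  by move=> t _; rewrite mulrAC -waveD /wave mulrA [- x + y]addrC.
rewrite /cint /=; congr Complex.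
  rewrite -integral_poisson// [RHS]Rintegral_mkcond; apply: eq_Rintegral => y _.
  by rewrite patchE indicE; case: ifPn => _; rewrite ?mulr1 ?mulr0.
by rewrite Rintegral_cst// mul0r.
Qed.

Lemma poisson_indic_norm (e a b x : R) : `|poisson_indic e a b x| <= 1.
Proof.
rewrite /poisson_indic; have p0 := pi_gt0 R.
set u := 2 * pi * (b - x) / e; set v := 2 * pi * (a - x) / e.
rewrite normrM normfV (ger0_norm (ltW p0)) ler_pdivrMr// mul1r.
have := atan_gtNpi2 u; have := atan_ltpi2 u.
have := atan_gtNpi2 v; have := atan_ltpi2 v.
move: (atan u) (atan v) p0 => {u v} s t; move: (pi : R) => p p0 h1 h2 h3 h4.
by rewrite ler_norml; apply/andP; split; lra.
Qed.

Lemma cvg_atan_scale (c : R) : 0 < c ->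
  (fun m : nat => atan (c / m.+1%:R^-1)) @ \oo --> (pi / 2 : R).
Proof.
move=> c0.
have h : (fun m : nat => c / m.+1%:R^-1) @ \oo --> +oo.
  apply/cvgryPge => A; near=> m; rewrite invrK mulrC -ler_pdivrMr//.
  rewrite (@le_trans _ _ m%:R)// ?ler_nat//.
  near: m; exact: nbhs_infty_ger.
exact: (cvg_comp _ _ h (@cvgy_atan R)).
Unshelve. all: by end_near. Qed.

(** Off the end points, each arctangent tends to pi / 2 or to - pi / 2. *)
Lemma cvg_poisson_indic (a b x : R) : a < b -> x != a -> x != b ->
  (fun m : nat => poisson_indic m.+1%:R^-1 a b x) @ \oo --> (\1_`[a, b] x : R).
Proof.
move=> ab xa xb; have p0 := pi_gt0 R.
have lim (c : R) : c != 0 ->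
    (fun m : nat => atan (2 * pi * c / m.+1%:R^-1)) @ \oo -->
    (if 0 < c then pi / 2 else - (pi / 2) : R).
  move=> c0; case: ifPn => [cp|].
    by apply: cvg_atan_scale; rewrite !mulr_gt0.
  rewrite -leNgt le_eqVlt (negbTE c0)/= => cn.
  have -> : (fun m : nat => atan (2 * pi * c / m.+1%:R^-1)) =
      (fun m : nat => - atan (2 * pi * (- c) / m.+1%:R^-1)).
    by apply/funext => m; rewrite mulrN mulNr atanN opprK.
  by apply: cvgN; apply: cvg_atan_scale; rewrite !mulr_gt0// oppr_gt0.
have bx : b - x != 0 by rewrite subr_eq0 eq_sym.
have ax : a - x != 0 by rewrite subr_eq0 eq_sym.
have := cvgM (cvgB (lim _ bx) (lim _ ax)) (@cvg_cst _ (pi^-1 : R) _ \oo _).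
rewrite !subr_gt0 indicE mem_setE in_itv /=.
suff -> : ((if x < b then pi / 2 else - (pi / 2)) - (if x < a then pi / 2 else - (pi / 2))) / pi
   = (a <= x <= b)%R%:R :> R by apply.
have pn : (pi : R) != 0 by rewrite gt_eqF.
have [xa'|xa'|xa'] := ltgtP x a; last by rewrite xa' eqxx in xa.
  rewrite (lt_trans xa' ab) subrr mul0r //.
have [xb'|xb'|xb'] := ltgtP x b; last by rewrite xb' eqxx in xb.
  by rewrite opprK -splitr divff.
by rewrite opprK addNr mul0r.
Qed.

End poisson_indic.

(** * Square-integrable functions *)

Section L2_tools.
Context (R : realType) (d : nat).
Local Notation lam := (leb R d).
Implicit Types F G : Rvec R d -> R[i].

Lemma L2norm_sqr F : (L2norm F ^+ 2 = \int[lam]_x (cabs (F x) ^+ 2)%:E)%E.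
Proof.
have -> : (L2norm F ^+ 2 = (L2norm F) `^ 2)%E.
  have : (0 <= L2norm F)%E by exact: Lnorm_ge0.
  case: (L2norm F) => [r| |] // r0.
    by rewrite -EFin_expe poweR_EFin powR_mulrn.
  by rewrite poweRyr// expe2 mulyy.
rewrite /L2norm poweR_Lnorm//; apply: eq_integral => x _ /=.
by rewrite ger0_norm// powR_mulrn.
Qed.

Lemma L2norm_ge0 F : (0 <= L2norm F)%E.
Proof. exact: Lnorm_ge0. Qed.

Definition sqint F := cmeas F /\ lam.-integrable setT (EFin \o (fun x => cabs (F x) ^+ 2)).

Lemma Rintegral_sqr_cabs_le D F : measurable D -> sqint F ->
  \int[lam]_(x in D) cabs (F x) ^+ 2 <= \int[lam]_x cabs (F x) ^+ 2.
Proof.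
move=> mD sF; rewrite Rintegral_mkcond; apply: le_Rintegral => //.
- have := (integrable_mkcond _ mD).1 (integrableS measurableT mD (@subsetT _ _) sF.2).
  by rewrite restrict_EFin.
- exact: sF.2.
- by move=> x _; rewrite patchE; case: ifPn => // _; exact: sqr_ge0.
Qed.

Lemma L2norm_lty F : lam.-integrable setT (EFin \o (fun x => cabs (F x) ^+ 2)) ->
  (L2norm F < +oo)%E.
Proof.
move=> iF; have : (L2norm F ^+ 2 < +oo)%E.
  by rewrite L2norm_sqr; exact: (integrable_lty measurableT iF).
have := L2norm_ge0 F.
by case: (L2norm F) => [r| |] // _; rewrite ?ltry// expe2 mulyy.
Qed.

Lemma inL2_sqint F : inL2 F -> sqint F.
Proof.
move=> [F1 F2 Foo]; have mF : cmeas F by [].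
split => //; apply/integrableP; split.
  by apply/measurable_EFinP; apply: measurable_funX; exact: measurable_cabs.
under eq_integral => x _ do rewrite /= ger0_norm ?sqr_ge0//.
rewrite -L2norm_sqr; have := L2norm_ge0 F; move: Foo.
by case: (L2norm F) => [r| |] // _ _; rewrite -EFin_expe ltry.
Qed.

Lemma eq_L2norm_ae F G : cmeas F -> cmeas G -> {ae lam, forall x, F x = G x} ->
  L2norm F = L2norm G.
Proof.
move=> mF mG FG.
have : (L2norm F ^+ 2 = L2norm G ^+ 2)%E.
  rewrite !L2norm_sqr; apply: ae_eq_integral => //.
  - by apply/measurable_EFinP; apply: measurable_funX; exact: measurable_cabs.
  - by apply/measurable_EFinP; apply: measurable_funX; exact: measurable_cabs.
  by apply: filterS FG => x /= ->.
have := L2norm_ge0 F; have := L2norm_ge0 G.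
case: (L2norm F) => [r| |]; case: (L2norm G) => [s| |] //; rewrite ?expe2 ?mulyy//.
rewrite !lee_fin -!EFinM -!expr2 => s0 r0 [rs].
by congr EFin; apply/eqP; rewrite -(@eqrXn2 _ 2)// rs.
Qed.

Lemma hoelder_cabs F G : cmeas F -> cmeas G ->
  (\int[lam]_x (cabs (F x) * cabs (G x))%:E <= L2norm F * L2norm G)%E.
Proof.
move=> mF mG.
have := @hoelder _ _ R lam (@cabs R \o F) (@cabs R \o G) 2 2
  (measurable_cabs mF) (measurable_cabs mG) (ltr0n R 2) (ltr0n R 2).
rewrite Lnorm1; have -> : (2^-1 + 2^-1 = 1 :> R) by field.
move=> /(_ erefl); apply: le_trans; apply: ge0_le_integral => //.
- by move=> x _; rewrite lee_fin mulr_ge0.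
- apply/measurable_EFinP; apply: measurable_funM; exact: measurable_cabs.
- apply: measurableT_comp => //.
  apply/measurable_EFinP; apply: measurable_funM; exact: measurable_cabs.
- by move=> x _ /=; rewrite lee_fin ler_norm.
Qed.

Lemma sqint_mul F G : sqint F -> sqint G ->
  cintegrable lam setT (fun x => F x * G x).
Proof.
move=> [mF iF] [mG iG].
apply: (cintegrable_le measurableT _ (integrableD measurableT iF iG)).
  exact: cmeasM.
move=> x _ /=; rewrite cabsM.
have := cabs_ge0 (F x); have := cabs_ge0 (G x).
move: (cabs (F x)) (cabs (G x)) => u v u0 v0; nra.
Qed.

Lemma sqintD F G : sqint F -> sqint G -> sqint (fun x => F x + G x).
Proof.
move=> [mF iF] [mG iG]; split; first exact: cmeasD.
have i2 := integrableZl measurableT 2 (integrableD measurableT iF iG).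
apply: (le_integrable measurableT _ _ i2).
  by apply/measurable_EFinP; apply: measurable_funX; apply: measurable_cabs; exact: cmeasD.
move=> x _ /=; rewrite lee_fin ger0_norm ?sqr_ge0//.
rewrite (le_trans _ (ler_norm _))//.
have := cabsD (F x) (G x); have := cabs_ge0 (F x + G x).
have := cabs_ge0 (F x); have := cabs_ge0 (G x).
move: (cabs (F x)) (cabs (G x)) (cabs (F x + G x)) => u v w u0 v0 w0 h.
have : w ^+ 2 <= (u + v) ^+ 2 by rewrite lerXn2r ?nnegrE ?addr_ge0.
have := sqr_ge0 (u - v); nra.
Qed.

Lemma sqint_conj F : sqint F -> sqint (fun x => (F x)^*%C).
Proof.
move=> [mF iF]; split; first exact: cmeas_conj.
by apply: eq_integrable iF => // x _ /=; rewrite cabs_conj.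
Qed.

(** On a set of finite measure, by |u| <= 1 + |u|^2. *)
Lemma sqint_cintegrable D F : measurable D -> (lam D < +oo)%E -> sqint F ->
  cintegrable lam D F.
Proof.
move=> mD Doo [mF iF].
have i1 : lam.-integrable D (EFin \o cst (1 : R)).
  apply/integrableP; split; first by apply/measurable_EFinP; exact: measurable_cst.
  under eq_integral => x _ do rewrite /= normr1.
  by rewrite integral_cst// mul1e.
have i2 := integrableS measurableT mD (@subsetT _ D) iF.
apply: (cintegrable_le mD mF (integrableD mD i1 i2)) => x Dx /=.
by have := cabs_ge0 (F x); move: (cabs (F x)) => u u0; nra.
Qed.

Lemma cint_dct D (F_ : nat -> Rvec R d -> R[i]) F (g : Rvec R d -> R) :
  measurable D -> (forall m, cmeas (F_ m)) -> cmeas F ->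
  lam.-integrable D (EFin \o g) ->
  (forall m x, cabs (F_ m x) <= g x) -> (forall x, cabs (F x) <= g x) ->
  {ae lam, forall x, cabs (F_ m x - F x) @[m --> \oo] --> (0 : R)} ->
  cabs (cint lam D (F_ m) - cint lam D F) @[m --> \oo] --> (0 : R).
Proof.
move=> mD mF_ mF ig F_g Fg cv.
have iF_ m : cintegrable lam D (F_ m) by apply: (cintegrable_le mD _ ig).
have iF : cintegrable lam D F by apply: (cintegrable_le mD _ ig).
pose h m := EFin \o (fun x => cabs (F_ m x - F x)).
have mh m : measurable_fun D (h m).
  apply: measurable_funTS; apply/measurable_EFinP.
  by apply: measurable_cabs; exact: cmeasB.
have hcv : {ae lam, forall x, D x -> h ^~ x @ \oo --> (0 : \bar R)%E}.
  apply: filterS cv => x cx _; apply/fine_cvgP; split; last exact: cx.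
  exact: nearW.
have hg : {ae lam, forall x n, D x -> (`|h n x| <= ((2%:E : \bar R) * (EFin \o g) x))%E}.
  apply: nearW => x n Dx; rewrite /h /= lee_fin ger0_norm//.
  rewrite (le_trans (cabsB _ _))//.
  by have := F_g n x; have := Fg x; lra.
have [_ _] := @dominated_convergence _ _ R lam D mD h (cst 0%E) _ mh
  (measurable_cst _) hcv (integrableZl mD 2 ig) hg.
rewrite integral0 => /fine_cvgP [_ hc].
apply: (squeeze_cvgr (f := fun=> 0) (h := fun m => \int[lam]_(x in D) cabs (F_ m x - F x))) => //.
  apply: nearW => m; rewrite cabs_ge0 andTb -(cintB mD (iF_ m) iF).
  by apply: cabs_cint => //; exact: cintegrableB.
exact: cvg_cst.
Qed.

End L2_tools.

(** * Boxes, cubes and characters of R^d *)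

Section cube_facts.
Context (R : realType) (d : nat).
Local Notation lam := (leb R d).
Local Notation R1 := (measurableTypeR R).

Definition dbox (a b : 'I_d -> R) : set (Rvec R d) :=
  [set x | forall i, a i <= (tnth x i : R) <= b i].

Lemma cubeE L : cube L = dbox (fun=> - (L / 2)) (fun=> L / 2).
Proof. by []. Qed.

Lemma indic_dbox a b x : \1_(dbox a b) x = \prod_(i < d) \1_(`[a i, b i]%classic : set R1) (tnth x i) :> R.
Proof.
have [h|/existsNP[i hi]] := pselect (forall i, a i <= (tnth x i : R) <= b i).
  rewrite indicE mem_set// big1// => i _.
  by rewrite indicE mem_set//= in_itv /= h.
rewrite indicE memNset//.
rewrite (bigD1 i)//= indicE memNset ?mul0r//.
Qed.

Lemma measurable_dbox a b : measurable (dbox a b).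
Proof.
have -> : dbox a b = \bigcap_(i in [set: 'I_d]) ((fun x : Rvec R d => tnth x i : R1) @^-1` `[a i, b i]).
  apply/seteqP; split => x /= h i.
    by move=> _; rewrite /= in_itv /= h.
  by have := h i I; rewrite /= in_itv.
apply: fin_bigcap_measurable => // i _.
rewrite -[X in measurable X]setTI; apply: (@measurable_tnth _ _ d i) => //.
Qed.

Lemma measurable_cube L : measurable (cube L : set (Rvec R d)).
Proof. exact: measurable_dbox. Qed.

Lemma leb_dbox a b : (forall i, a i <= b i) ->
  lam (dbox a b) = (\prod_(i < d) (b i - a i))%:E.
Proof.
move=> ab; rewrite -(setIT (dbox a b)) -integral_indic//; last exact: measurable_dbox.
transitivity (\int[lam]_x (\prod_(i < d) \1_(`[a i, b i]%classic : set R1) (tnth x i))%:E)%E.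
  by apply: eq_integral => x _; rewrite -indic_dbox.
rewrite (ge0_integral_leb_prod (f := fun i t => \1_(`[a i, b i]%classic : set R1) t)); last 2 first.
- by move=> i; apply: measurable_indic; exact: measurable_itv.
- by move=> i t; rewrite indicE.
rewrite -prodEFin; apply: eq_bigr => i _.
rewrite integral_indic// setIT /= lebesgue_measure_itv/= lte_fin -EFinB.
have := ab i; rewrite le_eqVlt => /orP[/eqP ->|->//].
by rewrite ltxx subrr.
Qed.

Lemma leb_cube L : 0 <= L -> lam (cube L) = (L ^+ d)%:E.
Proof.
move=> L0; rewrite cubeE leb_dbox; last first.
  by move=> i; rewrite (@le_trans _ _ 0)// ?oppr_le0 divr_ge0.
by rewrite prodr_const card_ord opprK -splitr.
Qed.

Lemma leb_cube_lty L : 0 <= L -> (lam (cube L) < +oo)%E.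
Proof. by move=> L0; rewrite leb_cube// ltry. Qed.

(** The indicator is a product of functions of one coordinate, one of which has
    integral 0. *)
Lemma leb_hyperplane (i : 'I_d) (a : R) : lam [set x | (tnth x i : R) = a] = 0%E.
Proof.
have mA : measurable ([set x | (tnth x i : R) = a] : set (Rvec R d)).
  rewrite -[X in measurable X]setTI.
  exact: (@measurable_tnth _ _ d i measurableT [set (a : R1)] (measurable_set1 _)).
pose h (j : 'I_d) (t : R1) : R := if j == i then \1_([set (a : R1)]) t else 1.
have mh j : measurable_fun setT (h j).
  by rewrite /h; case: (j == i); [apply: measurable_indic|exact: measurable_cst].
set A := [set x | _]; have -> : lam A = (\int[lam]_x (\1_A x)%:E)%E by rewrite integral_indic// setIT.
transitivity (\int[lam]_x (\prod_(j < d) h j (tnth x j))%:E)%E.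
  apply: eq_integral => x _; congr EFin.
  rewrite (bigD1 i)//= big1 ?mulr1; last by move=> j ji; rewrite /h (negbTE ji).
  rewrite /h eqxx !indicE.
  by have [xa|xa] := pselect ((tnth x i : R) = a); [rewrite !mem_set|rewrite !memNset].
rewrite (ge0_integral_leb_prod (f := h))//; last first.
  by move=> j t; rewrite /h; case: ifP => //.
rewrite (bigD1 i)//= [X in (X * _)%E](_ : _ = 0%E) ?mul0e//.
under eq_integral => t _ do rewrite /h eqxx.
by rewrite integral_indic// setIT; exact: lebesgue_measure_set1.
Qed.

(** The smoothed indicators converge to the indicator of a box except on its
    faces. *)
Lemma ae_off_faces (a b : 'I_d -> R) :
  {ae lam, forall x, forall i, (tnth x i : R) != a i /\ (tnth x i : R) != b i}.
Proof.
apply: filter_forall => i.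
have h (c : R) : {ae lam, forall x, (tnth x i : R) != c}.
  exists [set x | (tnth x i : R) = c]; split.
  - rewrite -[X in measurable X]setTI.
    exact: (@measurable_tnth _ _ d i measurableT [set (c : R1)] (measurable_set1 _)).
  - exact: leb_hyperplane.
  - by move=> x /= /negP; rewrite negbK => /eqP.
by near=> x; split; near: x; exact: h.
Unshelve. all: by end_near. Qed.

Definition waved (x xi : Rvec R d) : R[i] := \prod_(i < d) wave (tnth x i) (tnth xi i).

Lemma wavedE x xi : waved x xi = cexpi (2 * pi * dotv x xi).
Proof. by rewrite /dotv big_distrr cexpi_sum. Qed.

Lemma waved_conjE x xi : cexpi (- (2 * pi * dotv x xi)) = (waved x xi)^*%C.
Proof. by rewrite wavedE conj_cexpi. Qed.

Lemma waved_conj_prod x xi :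
  (waved x xi)^*%C = \prod_(i < d) wave (- (tnth x i : R)) (tnth xi i).
Proof.
rewrite -waved_conjE /dotv big_distrr -sumrN cexpi_sum; apply: eq_bigr => i _.
by rewrite /wave mulNr mulrN.
Qed.

Lemma cabs_waved x xi : cabs (waved x xi) = 1.
Proof. by rewrite wavedE cabs_cexpi. Qed.

Lemma measurable_dotv : measurable_fun setT (fun z : Rvec R d * Rvec R d => dotv z.1 z.2).
Proof.
rewrite /dotv; apply: measurable_sum => i.
apply: measurable_funM.
  exact: (measurableT_comp (@measurable_tnth _ _ d i) measurable_fst).
exact: (measurableT_comp (@measurable_tnth _ _ d i) measurable_snd).
Qed.

Lemma cmeas_waved2 : cmeas (fun z : Rvec R d * Rvec R d => waved z.1 z.2).
Proof.
apply: (@cmeas_ext _ _ _ (fun z => cexpi (2 * pi * dotv z.1 z.2))).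
  by move=> z; rewrite wavedE.
apply: cmeas_cexpi; apply: measurable_funM; first exact: measurable_cst.
exact: measurable_dotv.
Qed.

Lemma cmeas_wavedr x : cmeas (fun xi : Rvec R d => waved x xi).
Proof. exact: (cmeas_comp cmeas_waved2 (pair1_measurable x)). Qed.

Lemma fourier_integralE D (f : Rvec R d -> R[i]) xi :
  fourier_integral D f xi = cint lam D (fun x => f x * (waved x xi)^*%C).
Proof. by apply: eq_cint => x _; rewrite waved_conjE. Qed.

End cube_facts.

(** * Fourier transforms tested against boxes *)

Section limits.
Context (R : realType).

Lemma cabs_realE (r : R) : cabs r%:C%C = `|r|.
Proof. by rewrite cabsE /= expr0n/= addr0 sqrtr_sqr. Qed.

Lemma cabs_realB (r s : R) : cabs (r%:C%C - s%:C%C) = `|r - s|.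
Proof. by rewrite -cabs_realE rmorphB. Qed.

Lemma cvg_prod_real (I : Type) (s : seq I) (f : I -> nat -> R) (l : I -> R) :
  (forall i, f i m @[m --> \oo] --> l i) ->
  (\prod_(i <- s) f i m) @[m --> \oo] --> \prod_(i <- s) l i.
Proof.
move=> h; elim: s => [|i s IH].
  under eq_fun do rewrite big_nil.
  by rewrite big_nil; exact: cvg_cst.
under eq_fun do rewrite big_cons.
by rewrite big_cons; apply: cvgM.
Qed.

(** Limits of complex sequences are expressed by the modulus of the difference
    tending to 0. *)
Lemma cabs_lim_unique (u : nat -> R[i]) (A B : R[i]) :
  cabs (u m - A) @[m --> \oo] --> (0 : R) -> cabs (u m - B) @[m --> \oo] --> (0 : R) -> A = B.
Proof.
move=> uA uB; apply/eqP; rewrite -subr_eq0; apply/eqP/cabs0_eq0.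
have h : (cabs (u m - A) + cabs (u m - B)) @[m --> \oo] --> (0 + 0 : R) by exact: cvgD.
rewrite addr0 in h.
have h2 : (fun _ : nat => cabs (A - B)) @ \oo --> (0 : R).
  apply: (squeeze_cvgr (f := fun=> 0) _ _ h); last exact: cvg_cst.
  apply: nearW => m; rewrite cabs_ge0 andTb.
  rewrite (_ : A - B = (u m - B) - (u m - A)); last by ring.
  by rewrite [leRHS]addrC cabsB.
have := @cvg_unique _ (@Rhausdorff R) _ _ _ _ h2 (@cvg_cst _ (cabs (A - B)) _ \oo _).
by move=> ->.
Qed.
End limits.

Section boxtest.
Context (R : realType) (d : nat).
Local Notation lam := (leb R d).
Local Notation mu := (@lebesgue_measure R).
Local Notation R1 := (measurableTypeR R).
Implicit Types f g F G : Rvec R d -> R[i].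

Definition boxft (a b : 'I_d -> R) (xi : Rvec R d) : R[i] :=
  \prod_(i < d) boxft1 (a i) (b i) (tnth xi i).

Definition dampd (e : R) (xi : Rvec R d) : R := \prod_(i < d) damp e (tnth xi i).

Lemma dampd_ge0 e xi : 0 <= dampd e xi.
Proof. by apply: prodr_ge0 => i _; exact: damp_ge0. Qed.

Lemma dampd_le1 e xi : 0 <= e -> dampd e xi <= 1.
Proof.
by move=> e0; apply: prodr_ile1 => i *; rewrite damp_ge0 damp_le1.
Qed.

Lemma rmorph_prodC (I : Type) (s : seq I) (F : I -> R) :
  (\prod_(i <- s) F i)%:C%C = \prod_(i <- s) (F i)%:C%C.
Proof. exact: rmorph_prod. Qed.

Lemma integrable_dampd e : 0 < e -> lam.-integrable setT (EFin \o dampd e).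
Proof.
move=> e0.
have h (i : 'I_d) : cintegrable mu setT (fun t : R1 => 1 * (damp e t)%:C%C).
  apply: (@cintegrable_damp _ _ _ 1) => //; first exact: cmeas_cst.
  by move=> x; rewrite cabs1.
have [_] := cintegrable_leb_prod h.
apply: eq_integrable => // xi _ /=.
rewrite cabs_prod; congr EFin; apply: eq_bigr => i _.
by rewrite mul1r cabs_real// damp_ge0.
Qed.

Lemma cmeas_dampd e : cmeas (fun xi => (dampd e xi)%:C%C).
Proof.
apply: cmeas_real; apply: measurable_prod => i _.
by apply: measurable_tnth_comp; exact: measurable_damp.
Qed.

Section ab.
Context (a b : 'I_d -> R).
Hypothesis ab : forall i, a i < b i.

Lemma cmeas_boxft : cmeas (boxft a b).
Proof. by apply: cmeas_prod => i; apply: cmeas_tnth; exact: cmeas_boxft1. Qed.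

Lemma cabs_boxft xi : cabs (boxft a b xi) <= \prod_(i < d) (b i - a i).
Proof.
by rewrite cabs_prod; apply: ler_prod => i _; rewrite cabs_ge0 cabs_boxft1_le.
Qed.

Lemma sqint_boxft : sqint (boxft a b).
Proof.
split; first exact: cmeas_boxft.
have h (i : 'I_d) : cintegrable mu setT (fun t : R1 => (cabs (boxft1 (a i) (b i) t) ^+ 2)%:C%C).
  split.
    apply: cmeas_real; apply: measurable_funX; apply: measurable_cabs; exact: cmeas_boxft1.
  apply: eq_integrable (cintegrable_boxft1_sqr (ab i)) => // x _; rewrite /comp.
  by rewrite cabs_real ?sqr_ge0.
have [_] := cintegrable_leb_prod h.
apply: eq_integrable => // xi _; rewrite /comp /boxft.
rewrite !cabs_prod -prodrXl; congr EFin; apply: eq_bigr => i _.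
by rewrite cabs_real ?sqr_ge0.
Qed.

(** The damping factor makes the double integral of f(x) exp(-2 pi i x.xi) times
    the transform of the box absolutely convergent. By Fubini the integral over xi
    comes first, and it is a product of smoothed indicators. *)
Lemma cint_fourier_damped K f e : measurable K -> cintegrable lam K f -> 0 < e ->
  cint lam setT (fun xi => fourier_integral K f xi * boxft a b xi * (dampd e xi)%:C%C) =
  cint lam K (fun x => f x * (\prod_(i < d) poisson_indic e (a i) (b i) (tnth x i))%:C%C).
Proof.
move=> mK if_ e0.
have [if1 _] := if_.
have if2 := (cintegrable_mkcond lam mK if1).1 if_.
have iB : cintegrable lam setT (fun xi => boxft a b xi * (dampd e xi)%:C%C).
  apply: (cintegrable_le measurableT _
    (integrableZl measurableT (\prod_(i < d) (b i - a i)) (integrable_dampd e0))).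
    by apply: cmeasM; [exact: cmeas_boxft|exact: cmeas_dampd].
  move=> xi _; rewrite cabsM (cabs_real (dampd_ge0 e xi)) ler_wpM2r ?dampd_ge0//.
  exact: cabs_boxft.
transitivity (cint lam setT (fun xi => boxft a b xi * (dampd e xi)%:C%C *
    cint lam setT (fun x => (\1_K x : R)%:C%C * f x * (waved x xi)^*%C))).
  apply: eq_cint => xi _; rewrite fourier_integralE cint_mkcond -mulrA mulrC.
  by congr (_ * _); apply: eq_cint => x _; rewrite mulrA.
rewrite (cint_exchange (k := fun z => (waved z.1 z.2)^*%C) iB if2); last 2 first.
- exact: (cmeas_conj (@cmeas_waved2 R d)).
- by move=> z; rewrite cabs_conj cabs_waved.
rewrite [RHS]cint_mkcond; apply: eq_cint => x _; rewrite -mulrA; congr (_ * (_ * _)).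
have iP (i : 'I_d) := cintegrable_boxft1_damp (tnth x i) e0 (ab i).
transitivity (cint lam setT (fun xi => \prod_(i < d)
   (wave (- (tnth x i : R)) (tnth xi i) * boxft1 (a i) (b i) (tnth xi i) * (damp e (tnth xi i))%:C%C))).
  apply: eq_cint => xi _.
  by rewrite waved_conj_prod /dampd rmorph_prodC /boxft mulrC mulrA -!big_split.
rewrite (cint_leb_prod iP).
by rewrite rmorph_prodC; apply: eq_bigr => i _; rewrite cint_boxft1_damp.
Qed.

Lemma cvg_dampd xi : dampd m.+1%:R^-1 xi @[m --> \oo] --> (1 : R).
Proof.
suff : dampd m.+1%:R^-1 xi @[m --> \oo] --> \prod_(i < d) (1 : R) by rewrite big1.
apply: cvg_prod_real => i; rewrite -[X in _ --> X]expR0.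
apply: (@cvg_comp _ _ _ (fun m : nat => - (m.+1%:R^-1 * `|tnth xi i : R|)) (@expR R) _ (nbhs 0)).
  rewrite -oppr0 -[X in - X](mul0r `|tnth xi i : R|).
  apply: cvgN; apply: cvgM; last exact: cvg_cst.
  exact: cvg_harmonic.
exact: continuous_expR.
Qed.

(** Both sides of the damped identity converge by domination as the damping
    disappears. *)
Lemma fourier_box K f : measurable K -> cintegrable lam K f ->
  cintegrable lam setT (fun xi => fourier_integral K f xi * boxft a b xi) ->
  cint lam setT (fun xi => fourier_integral K f xi * boxft a b xi) =
  cint lam K (fun x => f x * (\1_(dbox a b) x : R)%:C%C).
Proof.
move=> mK if_ iFb.
have e0 m : 0 < m.+1%:R^-1 :> R by rewrite invr_gt0.
apply: (@cabs_lim_unique _ (fun m => cint lam setT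
  (fun xi => fourier_integral K f xi * boxft a b xi * (dampd m.+1%:R^-1 xi)%:C%C))).
  apply: (cint_dct (g := fun xi => cabs (fourier_integral K f xi * boxft a b xi))) => //.
  - by move=> m; apply: cmeasM; [case: iFb|exact: cmeas_dampd].
  - by case: iFb.
  - by case: iFb.
  - move=> m x; rewrite cabsM (cabs_real (dampd_ge0 _ _)) ler_piMr// dampd_le1//.
  - apply: nearW => xi.
    set z := _ * boxft a b xi.
    have -> : (fun m : nat => cabs (z * (dampd m.+1%:R^-1 xi)%:C%C - z)) =
        (fun m => cabs z * `|dampd m.+1%:R^-1 xi - 1|).
      apply/funext => m; rewrite -[X in _ - X]mulr1 -mulrBr cabsM; congr (_ * _).
      exact: (cabs_realB _ 1).
    rewrite -[X in _ --> X](mulr0 (cabs z)); apply: cvgM; first exact: cvg_cst.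
    apply/norm_cvg0P; rewrite -(subrr 1); apply: cvgB; [exact: cvg_dampd|exact: cvg_cst].
have -> : (fun m => cabs (cint lam setT
  (fun xi => fourier_integral K f xi * boxft a b xi * (dampd m.+1%:R^-1 xi)%:C%C) -
   cint lam K (fun x => f x * (\1_(dbox a b) x : R)%:C%C))) =
  (fun m => cabs (cint lam K (fun x => f x * (\prod_(i < d) poisson_indic m.+1%:R^-1 (a i) (b i) (tnth x i))%:C%C) -
   cint lam K (fun x => f x * (\1_(dbox a b) x : R)%:C%C))).
  by apply/funext => m; rewrite cint_fourier_damped.
have mdk m : cmeas (fun x : Rvec R d =>
    (\prod_(i < d) poisson_indic m.+1%:R^-1 (a i) (b i) (tnth x i))%:C%C).
  apply: cmeas_real; apply: measurable_prod => i _; apply: measurable_tnth_comp.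
  apply: continuous_measurable_fun => x; rewrite /poisson_indic.
  have h c : atan (2 * pi * (c - z) / m.+1%:R^-1) @[z --> x] --> atan (2 * pi * (c - x) / m.+1%:R^-1 : R).
    apply: (@cvg_comp _ _ _ (fun z : R => 2 * pi * (c - z) / m.+1%:R^-1) (@atan R)
      _ (nbhs (2 * pi * (c - x) / m.+1%:R^-1))); last exact: continuous_atan.
    apply: cvgM; last exact: cvg_cst.
    apply: cvgM; first exact: cvg_cst.
    by apply: cvgB; [exact: cvg_cst|exact: cvg_id].
  apply: cvgM; last exact: cvg_cst.
  by apply: cvgB; exact: h.
apply: (cint_dct (g := fun x => cabs (f x))) => //.
- by move=> m; apply: cmeasM => //; case: if_.
- apply: cmeasM; first by case: if_.
  by apply: cmeas_indic; exact: measurable_dbox.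
- by case: if_.
- move=> m x; rewrite cabsM ler_piMr// rmorph_prodC cabs_prod.
  apply: prodr_ile1 => i *; rewrite cabs_ge0 cabs_realE.
  exact: poisson_indic_norm.
- by move=> x; rewrite cabsM ler_piMr// cabs_real// indicE; case: (_ \in _).
- have := ae_off_faces a b; apply: (@filterS _ _ (ae_filter_ringOfSetsType lam)) => x hx.
  have -> : (fun m : nat => cabs (f x * (\prod_(i < d) poisson_indic m.+1%:R^-1 (a i) (b i) (tnth x i))%:C%C -
       f x * (\1_(dbox a b) x : R)%:C%C)) =
     (fun m => cabs (f x) * `|\prod_(i < d) poisson_indic m.+1%:R^-1 (a i) (b i) (tnth x i) - \1_(dbox a b) x|).
    apply/funext => m; rewrite -mulrBr cabsM; congr (_ * _).
    exact: cabs_realB.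
  rewrite -[X in _ --> X](mulr0 (cabs (f x))); apply: cvgM; first exact: cvg_cst.
  apply/norm_cvg0P; rewrite -(subrr (\1_(dbox a b) x : R)); apply: cvgB; last exact: cvg_cst.
  rewrite indic_dbox; apply: cvg_prod_real => i.
  by case: (hx i) => h1 h2; exact: cvg_poisson_indic.
Qed.

End ab.
End boxtest.

(** * The inverse transform of an integrable spectrum *)

Arguments cabs {R} z : simpl never.
Arguments cint : simpl never.
Section mvt.
Context (R : realType).

(** The end points come in any order, for expansions on both sides of 0. *)
Lemma mvt_bound (F dF : R -> R) (M a b : R) :
  (forall x : R, is_derive x 1 F (dF x)) ->
  (forall x : R, Num.min a b <= x <= Num.max a b -> `|dF x| <= M) ->
  `|F b - F a| <= M * `|b - a|.
Proof.
move=> dFx; have cF := is_derive_continuous dFx.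
wlog ab : a b / a <= b => [h|].
  have [ab|ba] := orP (le_total a b); first exact: h.
  move=> FM; rewrite (distrC (F b)) (distrC b); apply: (h b a ba).
  by move=> x xx; apply: FM; rewrite minC maxC.
rewrite (min_idPl ab) (max_idPr ab) => FM.
move: ab; rewrite le_eqVlt => /orP[/eqP ->|ab]; first by rewrite !subrr normr0 mulr0.
have [|c cab ->] := @MVT R F dF a b ab (fun x _ => dFx x).
  exact: continuous_subspaceT.
rewrite normrM ler_wpM2r// FM//.
by move: cab; rewrite in_itv/= => /andP[/ltW -> /ltW ->].
Qed.

Lemma cexpi_lip (s t : R) : cabs (cexpi t - cexpi s) <= 2 * `|t - s|.
Proof.
rewrite (le_trans (cabs_le_ReIm _))// mulr_natl mulr2n lerD//.
  rewrite cReD cReN /= -[leRHS]mul1r.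
  apply: (@mvt_bound _ (fun x => - sin x)) => x _.
  by rewrite normrN sin_max.
rewrite cImD cImN /= -[leRHS]mul1r.
by apply: (@mvt_bound _ (@cos R)) => x _; rewrite cos_max.
Qed.
End mvt.

Section inverse_transform.
Context (R : realType) (d : nat).
Local Notation lam := (leb R d).
Implicit Types f g F G : Rvec R d -> R[i].

Definition inv_ft g (x : Rvec R d) : R[i] := cint lam setT (fun xi => g xi * waved x xi).

Section g.
Context (g : Rvec R d -> R[i]) (ig : cintegrable lam setT g).

Lemma cabs_gwave x xi : cabs (g xi * waved x xi) = cabs (g xi).
Proof. by rewrite cabsM cabs_waved mulr1. Qed.

Lemma cintegrable_gwave x : cintegrable lam setT (fun xi => g xi * waved x xi).
Proof.
apply: (cintegrable_le measurableT _ ig.2).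
  by apply: cmeasM; [case: ig|exact: cmeas_wavedr].
by move=> xi _; rewrite cabs_gwave.
Qed.

Lemma cmeas_inv_ft : cmeas (inv_ft g).
Proof.
apply: (@cmeas_param _ _ _ _ _ lam (fun z : Rvec R d * Rvec R d => g z.2 * waved z.1 z.2)
  (@cabs R \o g)).
- apply: cmeasM; last exact: cmeas_waved2.
  exact: (cmeas_comp ig.1 (@measurable_snd _ _ (Rvec R d) (Rvec R d))).
- exact: ig.2.
- by move=> x xi; rewrite cabs_gwave.
Qed.

Lemma cabs_inv_ft x : cabs (inv_ft g x) <= \int[lam]_xi cabs (g xi).
Proof.
apply: (le_trans (cabs_cint measurableT (cintegrable_gwave x))).
by under eq_Rintegral => xi _ do rewrite cabs_gwave.
Qed.

Lemma boxftE (a b : 'I_d -> R) xi :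
  boxft a b xi = cint lam setT (fun x => (\1_(dbox a b) x : R)%:C%C * waved x xi).
Proof.
have h (i : 'I_d) := cintegrable_indic_wave (a i) (b i) (tnth xi i).
rewrite /boxft /boxft1 -(cint_leb_prod h); apply: eq_cint => x _.
by rewrite indic_dbox rmorph_prodC /waved -big_split.
Qed.

Lemma cintegrable_indic_dbox (a b : 'I_d -> R) : (forall i, a i <= b i) ->
  cintegrable lam setT (fun x => (\1_(dbox a b) x : R)%:C%C).
Proof.
move=> ab; split; first by apply: cmeas_indic; exact: measurable_dbox.
apply: (@eq_integrable _ _ _ _ _ measurableT (EFin \o \1_(dbox a b))).
  by move=> x _ /=; rewrite cabs_real.
apply/integrableP; split.
  by apply/measurable_EFinP; apply: measurable_indic; exact: measurable_dbox.
under eq_integral => x _ do rewrite /= ger0_norm ?indicE ?ler0n// -indicE.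
rewrite integral_indic//; last exact: measurable_dbox.
rewrite setIT; have := ltry (\prod_(i < d) (b i - a i)).
by congr (_ < _)%E; apply/esym; exact: leb_dbox.
Qed.

(** Here the spectrum is integrable, and Fubini applies without damping. *)
Lemma cint_boxft (a b : 'I_d -> R) : (forall i, a i <= b i) ->
  cint lam setT (fun xi => g xi * boxft a b xi) =
  cint lam setT (fun x => (\1_(dbox a b) x : R)%:C%C * inv_ft g x).
Proof.
move=> ab.
have i1 := cintegrable_indic_dbox ab.
rewrite -(cint_exchange (k := fun z => waved z.1 z.2) ig i1); last 2 first.
- exact: cmeas_waved2.
- by move=> z; rewrite cabs_waved.
by apply: eq_cint => xi _; rewrite boxftE.
Qed.

Hypothesis g0 : forall xi, ~ cube 1 xi -> g xi = 0.

(** On the unit cube every frequency is at most 1 in absolute value, so the phases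
    are Lipschitz in x. *)
Lemma inv_ft_lip (h : R) x y : 0 <= h -> (forall i, `|(tnth x i : R) - tnth y i| <= h) ->
  cabs (inv_ft g x - inv_ft g y) <= (2 * (2 * pi * (d%:R * h))) * \int[lam]_xi cabs (g xi).
Proof.
move=> h0 xy; rewrite /inv_ft -cintB//; [|exact: cintegrable_gwave|exact: cintegrable_gwave].
apply: (le_trans (cabs_cint measurableT _)).
  by apply: cintegrableB => //; exact: cintegrable_gwave.
rewrite -RintegralZl//; last exact: ig.2.
apply: le_Rintegral => //.
- by case: (cintegrableB measurableT (cintegrable_gwave x) (cintegrable_gwave y)).
- exact: (integrableZl measurableT _ ig.2).
move=> xi _; have [hxi|/g0 ->] := pselect (cube 1 xi); last first.
  by rewrite !mul0r subrr cabs0 mulr0.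
rewrite -mulrBr cabsM mulrC ler_wpM2r// !wavedE.
rewrite (le_trans (cexpi_lip _ _))// ler_pM2l// -mulrBr normrM.
have pi0 : 0 < 2 * pi :> R by rewrite mulr_gt0// pi_gt0.
rewrite (gtr0_norm pi0) ler_pM2l// /dotv -sumrB.
rewrite (le_trans (ler_norm_sum _ _ _))//.
rewrite (le_trans (y := \sum_(i < d) h))//; last by rewrite sumr_const card_ord mulr_natl.
apply: ler_sum => i _; rewrite -mulrBl normrM -[leRHS]mulr1 ler_pM//.
have := hxi i; rewrite ler_norml => /andP[h1 h2].
by apply/andP; split; lra.
Qed.

End g.
End inverse_transform.

(** * Fourier inversion for bandlimited functions *)

Section inversion.
Context (R : realType) (d : nat).
Local Notation lam := (leb R d).
Implicit Types f g F G : Rvec R d -> R[i].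

Lemma continuous_Rvec_near f (x0 : Rvec R d) (e : R) : continuous_Rvec f -> 0 < e ->
  exists2 h : R, 0 < h &
    forall x, (forall i, `|(tnth x i : R) - tnth x0 i| <= h) -> cabs (f x - f x0) <= e.
Proof.
move=> [cR cI] e0.
pose F (v : 'rV[R]_d) := f [tuple v ord0 i | i < d].
pose row (x : Rvec R d) : 'rV[R]_d := \row_i (tnth x i).
have FE x : F (row x) = f x.
  by rewrite /F; congr f; apply: eq_from_tnth => i; rewrite tnth_mktuple mxE.
have e2 : 0 < e / 2 by rewrite divr_gt0.
have key (u : 'rV[R]_d -> R) : {for row x0, continuous u} ->
    exists2 h : R, 0 < h & forall x, (forall i, `|(tnth x i : R) - tnth x0 i| <= h) ->
      `|u (row x) - u (row x0)| <= e / 2.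
  move=> cu; have /cvgrPdist_le/(_ _ e2) : u v @[v --> row x0] --> u (row x0) by exact: cu.
  move=> /nbhs_ballP[r /= r0 hr]; exists (r / 2); first by rewrite divr_gt0.
  move=> x xx0; rewrite distrC; apply: hr; split => // i j.
  rewrite !mxE /ball /= distrC (le_lt_trans (xx0 j))//.
  by rewrite ltr_pdivrMr// ltr_pMr// ltr1n.
have [h1 h10 H1] := key _ (cR (row x0)).
have [h2 h20 H2] := key _ (cI (row x0)).
exists (Num.min h1 h2) => [|x xx0]; first by rewrite lt_min h10.
rewrite (le_trans (cabs_le_ReIm _))// [leRHS](splitr e) lerD//.
  rewrite cReD cReN -!FE; apply: H1 => i.
  by rewrite (le_trans (xx0 i))// ge_min lexx.
rewrite cImD cImN -!FE; apply: H2 => i.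
by rewrite (le_trans (xx0 i))// ge_min lexx orbT.
Qed.

Section data.
Context (f g : Rvec R d -> R[i]).
Hypothesis sf : sqint f.
Hypothesis sg : sqint g.
Hypothesis g0 : forall xi, ~ cube 1 xi -> g xi = 0.
Hypothesis fg : L2norm (fun xi => fourier_integral (cube n%:R) f xi - g xi) @[n --> \oo]
    --> 0%E.

Local Notation Fn n := (fourier_integral (cube n%:R) f).

Lemma cintegrable_cube (n : nat) : cintegrable lam (cube n%:R) f.
Proof.
apply: sqint_cintegrable => //; first exact: measurable_cube.
by apply: leb_cube_lty.
Qed.

Lemma cintegrable_spectrum : cintegrable lam setT g.
Proof.
have h : cintegrable lam (cube 1) g.
  apply: sqint_cintegrable => //; first exact: measurable_cube.
  by apply: leb_cube_lty.
have [mg ig] := (cintegrable_mkcond lam (@measurable_cube R d 1) sg.1).1 h.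
split; first exact: sg.1.
apply: eq_integrable ig => // xi _ /=.
congr EFin; congr cabs; rewrite indicE.
have [hxi|hxi] := pselect (cube 1 xi); first by rewrite mem_set// mul1r.
by rewrite g0// mulr0.
Qed.

Lemma cmeas_fourier (n : nat) : cmeas (Fn n).
Proof.
have i1 := cintegrable_cube n.
have i2 := (cintegrable_mkcond lam (@measurable_cube R d n%:R) sf.1).1 i1.
pose F (z : Rvec R d * Rvec R d) :=
  (\1_(cube n%:R) z.2 : R)%:C%C * f z.2 * (waved z.2 z.1)^*%C.
apply: (@cmeas_ext _ _ _ (fun xi => cint lam setT (fun x => F (xi, x)))).
  move=> xi; rewrite fourier_integralE [RHS]cint_mkcond.
  by apply: eq_cint => x _; rewrite /F mulrA.
apply: (cmeas_param (h := fun x => cabs ((\1_(cube n%:R) x : R)%:C%C * f x))).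
- apply: cmeasM.
    exact: (cmeas_comp i2.1 (@measurable_snd _ _ (Rvec R d) (Rvec R d))).
  apply: cmeas_conj.
  have mswap : measurable_fun setT (fun z : Rvec R d * Rvec R d => (z.2, z.1)).
    by apply/measurable_fun_pairP; split; [exact: measurable_snd|exact: measurable_fst].
  exact: (cmeas_comp (@cmeas_waved2 R d) mswap).
- exact: i2.2.
- by move=> xi x; rewrite /F /= cabsM cabs_conj cabs_waved mulr1.
Qed.

(** The transforms of the truncations are square integrable as soon as they are at
    finite distance from g. *)
Lemma near_sqint_fourier : \forall n \near \oo, sqint (Fn n).
Proof.
have : \forall n \near \oo, (L2norm (fun xi => Fn n xi - g xi)%R < +oo)%E.
  have /fine_cvgP[h _] := fg.
  by apply: filterS h => n; rewrite fin_numElt => /andP[].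
apply: filterS => n hn.
have mB : cmeas (fun xi => Fn n xi - g xi).
  by apply: cmeasB; [exact: cmeas_fourier|case: sg].
have sB : sqint (fun xi => Fn n xi - g xi) by apply: inL2_sqint; split; [case: mB|case: mB|].
have [m i] := sqintD sB sg.
split; first exact: cmeas_fourier.
apply: eq_integrable i => // xi _; rewrite /comp.
by rewrite subrK.
Qed.

(** Cauchy-Schwarz, applied to the distance between the truncated transform and
    g. *)
Lemma pairing_limit (B : Rvec R d -> R[i]) (e : R) : sqint B -> 0 < e ->
  \forall n \near \oo, sqint (Fn n) /\
    cabs (cint lam setT (fun xi => Fn n xi * B xi) -
          cint lam setT (fun xi => g xi * B xi)) <= e.
Proof.
move=> sB e0.
have Boo : (L2norm B < +oo)%E by apply: L2norm_lty; case: sB.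
have LB0 := L2norm_ge0 B.
pose b := fine (L2norm B).
have bE : L2norm B = b%:E by rewrite fineK// ge0_fin_numE.
have b0 : 0 <= b by rewrite -lee_fin -bE.
have /fine_cvgP[h1 /cvgrPdist_le/(_ (e / (b + 1)))] := fg.
move=> /(_ (divr_gt0 e0 (ltr_wpDl b0 ltr01))) h2.
near=> n.
have sFn : sqint (Fn n) by near: n; exact: near_sqint_fourier.
split => //.
have iF := sqint_mul sFn sB; have iG := sqint_mul sg sB.
have hn : L2norm (fun xi => Fn n xi - g xi) \is a fin_num by near: n; exact: h1.
have hn2 : fine (L2norm (fun xi => Fn n xi - g xi)) <= e / (b + 1).
  have : `|0 - fine (L2norm (fun xi => Fn n xi - g xi))| <= e / (b + 1).
    by near: n; exact: h2.
  by rewrite sub0r normrN; apply: le_trans; exact: ler_norm.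
rewrite -cintB//.
apply: (le_trans (cabs_cint measurableT (cintegrableB measurableT iF iG))).
have mFg : cmeas (fun xi => Fn n xi - g xi) by apply: cmeasB; [case: sFn|case: sg].
have := hoelder_cabs mFg sB.1.
have -> : (\int[lam]_x (cabs (Fn n x - g x)%R * cabs (B x))%:E =
   \int[lam]_x (cabs (Fn n x * B x - g x * B x)%R)%:E)%E.
  by apply: eq_integral => xi _; rewrite -cabsM mulrBl.
have ifin : (\int[lam]_x (cabs (Fn n x * B x - g x * B x)%R)%:E)%E \is a fin_num.
  exact: (integrable_fin_num measurableT (cintegrableB measurableT iF iG).2).
rewrite -(fineK ifin) bE -(fineK hn) -EFinM lee_fin => /le_trans; apply.
rewrite (le_trans (ler_wpM2r b0 hn2))// mulrAC ler_pdivrMr ?ltr_wpDl//.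
by rewrite ler_wpM2l// ?(ltW e0)// lerDl.
Unshelve. all: by end_near. Qed.

(** Truncating f to a cube that contains the box does not change its integral over
    the box. *)
Lemma box_pairing (a b : 'I_d -> R) : (forall i, a i < b i) ->
  cint lam setT (fun xi => g xi * boxft a b xi) =
  cint lam setT (fun x => (\1_(dbox a b) x : R)%:C%C * f x).
Proof.
move=> ab; apply/eqP; rewrite -subr_eq0; apply/eqP/cabs0_eq0/eqP.
rewrite -[X in X == 0]subr0 subr_eq0 eq_le cabs_ge0 andbT; apply/ler_addgt0Pl => e e0.
rewrite addr0.
pose S := 2 * \sum_(i < d) (`|a i| + `|b i|).
have [n [hn [sFn hFn]]] : exists n : nat, S <= n%:R /\ sqint (Fn n) /\
    cabs (cint lam setT (fun xi => Fn n xi * boxft a b xi) -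
          cint lam setT (fun xi => g xi * boxft a b xi)) <= e.
  near \oo => n; exists n; split.
    by near: n; exact: nbhs_infty_ger.
  by near: n; exact: (pairing_limit (sqint_boxft ab) e0).
rewrite cabs_distC; apply: le_trans hFn; rewrite le_eqVlt; apply/orP; left; apply/eqP.
congr (cabs (_ - _)).
rewrite fourier_box//; [|exact: measurable_cube|exact: cintegrable_cube|
  exact: (sqint_mul sFn (sqint_boxft ab))].
rewrite [RHS]cint_mkcond; apply: eq_cint => x _.
have [hx|hx] := pselect (dbox a b x); last first.
  have -> : (\1_(dbox a b) x : R)%:C%C = 0 by rewrite indicE memNset.
  by rewrite !mulr0 mul0r.
suff xn : cube n%:R x.
  have -> : (\1_(cube n%:R) x : R)%:C%C = 1 by rewrite indicE mem_set.
  by rewrite mul1r mulrC.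
move=> i; rewrite -ler_norml.
have h1 : `|tnth x i : R| <= `|a i| + `|b i|.
  have /andP[hx1 hx2] := hx i.
  rewrite ler_norml; apply/andP; split.
    by have := ler_norm (- a i); rewrite normrN; have := normr_ge0 (b i); lra.
  by have := ler_norm (b i); have := normr_ge0 (a i); lra.
rewrite (le_trans h1)// ler_pdivlMr// (le_trans _ hn)// /S mulrC ler_pM2l//.
rewrite (bigD1 i)//= lerDl sumr_ge0// => j _; rewrite addr_ge0.
Unshelve. all: by end_near. Qed.

Hypothesis cf : continuous_Rvec f.

(** Both sides are continuous and have the same integral over every box; the boxes
    shrink to x. *)
Lemma fourier_inversion x : f x = inv_ft g x.
Proof.
have ig := cintegrable_spectrum.
apply/eqP; rewrite -subr_eq0; apply/eqP/cabs0_eq0/eqP.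
rewrite -[X in X == 0]subr0 subr_eq0 eq_le cabs_ge0 andbT; apply/ler_addgt0Pl => e e0.
rewrite addr0.
have e2 : 0 < e / 2 by rewrite divr_gt0.
have [h1 h10 H1] := continuous_Rvec_near x cf e2.
pose M := \int[lam]_xi cabs (g xi).
have M0 : 0 <= M by apply: Rintegral_ge0.
pose K := 2 * (2 * pi * d%:R) * M.
have K0 : 0 <= K by rewrite !mulr_ge0// pi_ge0.
have [h2 h20 H2] : exists2 h : R, 0 < h &
    forall y, (forall i, `|(tnth y i : R) - tnth x i| <= h) -> cabs (inv_ft g y - inv_ft g x) <= e / 2.
  exists (e / 2 / (K + 1)); first by rewrite divr_gt0// ltr_wpDl.
  move=> y yx.
  have hh : 0 <= e / 2 / (K + 1) by rewrite divr_ge0 ?(ltW e2)// addr_ge0.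
  apply: (le_trans (inv_ft_lip ig g0 hh yx)).
  rewrite -/M (_ : _ * M = K * (e / 2 / (K + 1))); last by rewrite /K; ring.
  rewrite mulrCA ler_piMr ?(ltW e2)// ler_pdivrMr ?ltr_wpDl// mul1r.
  by rewrite lerDl.
pose h := Num.min h1 h2.
have h0 : 0 < h by rewrite lt_min h10.
pose a i := (tnth x i : R) - h.
pose b i := (tnth x i : R) + h.
have ab i : a i < b i by rewrite /a /b; lra.
have ab' i : a i <= b i by exact: ltW.
have i1 := @cintegrable_indic_dbox R d a b ab'.
have iG : cintegrable lam setT (fun y => (\1_(dbox a b) y : R)%:C%C * inv_ft g y).
  apply: (@cintegrableMb _ _ _ lam _ measurableT _ _ M) => //.
    exact: cmeas_inv_ft.
  by move=> y _; exact: cabs_inv_ft.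
have iF : cintegrable lam setT (fun y => (\1_(dbox a b) y : R)%:C%C * f y).
  apply/(cintegrable_mkcond lam (measurable_dbox a b) sf.1).
  apply: sqint_cintegrable => //; first exact: measurable_dbox.
  have := ltry (\prod_(i < d) (b i - a i)).
  by congr (_ < _)%E; apply/esym; exact: leb_dbox.
have E0 : cint lam setT (fun y => (\1_(dbox a b) y : R)%:C%C * (f y - inv_ft g y)) = 0.
  rewrite (@eq_cint _ _ _ _ _ _ (fun y => (\1_(dbox a b) y : R)%:C%C * f y - (\1_(dbox a b) y : R)%:C%C * inv_ft g y)); last first.
    by move=> y _; rewrite mulrBr.
  by rewrite cintB// -box_pairing// -cint_boxft// subrr.
pose V := \int[lam]_y (\1_(dbox a b) y).
have VE : V = \prod_(i < d) (b i - a i).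
  rewrite /V /Rintegral integral_indic//; last exact: measurable_dbox.
  rewrite setIT; transitivity (fine (\prod_(i < d) (b i - a i))%:E) => //; congr fine.
  exact: leb_dbox.
have V0 : 0 < V by rewrite VE; apply: prodr_gt0 => i _; rewrite subr_gt0.
pose z := f x - inv_ft g x.
(* The difference of f and its candidate has integral 0 over the box, so z times
   the volume is the integral of z minus this difference, small near x. *)
have zE : z * V%:C%C = cint lam setT
   (fun y => (\1_(dbox a b) y : R)%:C%C * (z - (f y - inv_ft g y))).
  rewrite (@eq_cint _ _ _ _ _ _ (fun y => z * (\1_(dbox a b) y : R)%:C%C -
     (\1_(dbox a b) y : R)%:C%C * (f y - inv_ft g y))); last first.
    by move=> y _; ring.
  rewrite cintB//; last 2 first.
  - exact: cintegrableZ.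
  - apply: (@eq_rect _ _ (cintegrable lam setT) (cintegrableB measurableT iF iG)).
    by apply/funext => y; rewrite mulrBr.
  rewrite E0 subr0 cintZ//; congr (_ * _).
  by rewrite /cint /=; congr Complex; rewrite Rintegral_cst// mul0r.
rewrite -/z -(ler_pM2r V0).
have -> : cabs z * V = cabs (z * V%:C%C) by rewrite cabsM cabs_real// ltW.
have iI : lam.-integrable setT (EFin \o (fun y => e * \1_(dbox a b) y)).
  have i3 : lam.-integrable setT (EFin \o \1_(dbox a b)).
    by apply: eq_integrable i1.2 => // y _; rewrite /comp cabs_real.
  exact: (integrableZl measurableT e i3).
have iz : cintegrable lam setT (fun y => (\1_(dbox a b) y : R)%:C%C * (z - (f y - inv_ft g y))).
  apply: (@eq_rect _ _ (cintegrable lam setT)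
    (cintegrableB measurableT (cintegrableZ measurableT z i1) (cintegrableB measurableT iF iG))).
  by apply/funext => y; ring.
rewrite zE (le_trans (cabs_cint measurableT iz))//.
have -> : e * V = \int[lam]_y (e * \1_(dbox a b) y).
  rewrite RintegralZl//.
  by apply: eq_integrable i1.2 => // y _; rewrite /comp cabs_real.
apply: le_Rintegral => //; first exact: iz.2.
move=> y _; rewrite cabsM cabs_real// mulrC.
have [hy|hy] := pselect (dbox a b y); last first.
  by rewrite indicE memNset// !mulr0.
rewrite ler_wpM2r//.
have yx i : `|(tnth y i : R) - tnth x i| <= h.
  by have /andP[y1 y2] := hy i; rewrite ler_norml; apply/andP; split;
    move: y1 y2; rewrite /a /b; lra.
rewrite (_ : z - _ = - (f y - f x) + (inv_ft g y - inv_ft g x)); last by rewrite /z; ring.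
rewrite (le_trans (cabsD _ _))// cabsN [leRHS](splitr e) lerD//.
  by apply: H1 => i; rewrite (le_trans (yx i))// ge_min lexx.
by apply: H2 => i; rewrite (le_trans (yx i))// ge_min lexx orbT.
Qed.

End data.
End inversion.

(** * Bessel inequality and the unit ball of bandlimited functions *)

Section bessel.
Context (R : realType) (d : nat).
Local Notation lam := (leb R d).
Implicit Types f g F G : Rvec R d -> R[i].

(** Both functions being integrable, this case of the Parseval identity is
    Fubini. *)
Lemma fourier_pairing (K : set (Rvec R d)) f B : measurable K -> cintegrable lam K f ->
  cintegrable lam setT B ->
  cint lam setT (fun xi => fourier_integral K f xi * (B xi)^*%C) =
  cint lam K (fun x => f x * (inv_ft B x)^*%C).
Proof.
move=> mK if_ iB.
have if2 := (cintegrable_mkcond lam mK if_.1).1 if_.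
have icB : cintegrable lam setT (fun xi => (B xi)^*%C).
  split; first by apply: cmeas_conj; case: iB.
  by apply: eq_integrable iB.2 => // xi _; rewrite /comp cabs_conj.
transitivity (cint lam setT (fun xi => (B xi)^*%C *
    cint lam setT (fun x => (\1_K x : R)%:C%C * f x * (waved x xi)^*%C))).
  apply: eq_cint => xi _; rewrite fourier_integralE cint_mkcond mulrC.
  by congr (_ * _); apply: eq_cint => x _; rewrite mulrA.
rewrite (cint_exchange (k := fun z => (waved z.1 z.2)^*%C) icB if2); last 2 first.
- exact: (cmeas_conj (@cmeas_waved2 R d)).
- by move=> z; rewrite cabs_conj cabs_waved.
rewrite [RHS]cint_mkcond; apply: eq_cint => x _.
rewrite mulrA /inv_ft -cint_conj//; last exact: cintegrable_gwave.
by congr (_ * _); apply: eq_cint => xi _; rewrite rmorphM.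
Qed.

Section data.
Context (f g : Rvec R d -> R[i]).
Hypothesis sf : sqint f.
Hypothesis sg : sqint g.
Hypothesis g0 : forall xi, ~ cube 1 xi -> g xi = 0.
Hypothesis fg : L2norm (fun xi => fourier_integral (cube n%:R) f xi - g xi) @[n --> \oo]
    --> 0%E.
Hypothesis cf : continuous_Rvec f.

(** By inversion, the pairing of the truncated transform with g is the energy of f
    in the truncation cube; it tends to the energy of g. *)
Lemma bessel : \int[lam]_xi cabs (g xi) ^+ 2 <= \int[lam]_x cabs (f x) ^+ 2.
Proof.
have ig := cintegrable_spectrum sg g0.
apply/ler_addgt0Pl => e e0.
have [n [sFn hFn]] : exists n : nat, sqint (fourier_integral (cube n%:R) f) /\
    cabs (cint lam setT (fun xi => fourier_integral (cube n%:R) f xi * (g xi)^*%C) -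
          cint lam setT (fun xi => g xi * (g xi)^*%C)) <= e.
  by near \oo => n; exists n; near: n; exact: (pairing_limit sf sg fg (sqint_conj sg) e0).
have mcube := @measurable_cube R d n%:R.
have ifn := cintegrable_cube sf n.
rewrite fourier_pairing// in hFn.
have AE : complex.Re (cint lam (cube n%:R) (fun x => f x * (inv_ft g x)^*%C)) =
    \int[lam]_(x in cube n%:R) cabs (f x) ^+ 2.
  rewrite -[LHS]/(\int[lam]_(x in cube n%:R) complex.Re (f x * (inv_ft g x)^*%C)).
  apply: eq_Rintegral => x _.
  by rewrite -(fourier_inversion sf sg g0 fg cf) mulc_conj.
have BE : complex.Re (cint lam setT (fun xi => g xi * (g xi)^*%C)) =
    \int[lam]_xi cabs (g xi) ^+ 2.
  rewrite -[LHS]/(\int[lam]_xi complex.Re (g xi * (g xi)^*%C)).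
  by apply: eq_Rintegral => x _; rewrite mulc_conj.
have h := le_trans (normr_Re_le _) hFn.
rewrite cReD cReN AE BE in h.
have le1 := Rintegral_sqr_cabs_le mcube sf.
rewrite distrC in h.
have := le_trans (ler_norm _) h; rewrite lerBlDl => /le_trans; apply.
by rewrite addrC lerD2l.
Unshelve. all: by end_near. Qed.
End data.
End bessel.

Section unit_band.
Context (R : realType) (d : nat).
Local Notation lam := (leb R d).
Implicit Types f g : Rvec R d -> R[i].

(** The bound on the L^1 norm of the spectrum is what controls both the values of
    f and the errors of its local expansions. *)
Definition spectral_rep f g := [/\ cintegrable lam setT g,
  (forall xi, ~ cube 1 xi -> g xi = 0), \int[lam]_xi cabs (g xi) <= 1 &
  forall x, f x = inv_ft g x].

(** What chaining uses of a bandlimited function of norm at most 1. *)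
Definition unit_band f := [/\ sqint f, \int[lam]_x cabs (f x) ^+ 2 <= 1 &
  exists g, spectral_rep f g].

(** The spectrum is changed on a null set, to vanish everywhere off the unit cube.
    As this cube has measure 1, the L^1 norm of the spectrum is at most half of 1
    plus its energy, and the energy is bounded by Bessel. The factor c serves both
    to normalize f and to take large multiples of a function of energy 0. *)
Lemma bandlimited_unit_band f (c : R) : bandlimited f -> 0 <= c ->
  c ^+ 2 * \int[lam]_x cabs (f x) ^+ 2 <= 1 -> unit_band (fun x => c%:C%C * f x).
Proof.
move=> [cf Lf [g [Lg fg] gae]] c0 f1.
have sf := inL2_sqint Lf; have sg := inL2_sqint Lg.
pose g' xi := (\1_(cube 1) xi : R)%:C%C * g xi.
have mcube := @measurable_cube R d 1.
have mg' : cmeas g' by apply: cmeasM; [exact: cmeas_indic|exact: sg.1].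
have gg' : {ae lam, forall xi, g xi = g' xi}.
  move: gae; apply: (@filterS _ _ (ae_filter_ringOfSetsType lam)) => xi h.
  rewrite /g'; have [hxi|hxi] := pselect (cube 1 xi).
    by rewrite indicE mem_set// mul1r.
  by rewrite h// mulr0.
have cg' xi : cabs (g' xi) <= cabs (g xi).
  by rewrite /g' cabsM cabs_real// ler_piMl// indicE; case: (_ \in _).
have sg' : sqint g'.
  split => //; apply: (le_integrable measurableT _ _ sg.2).
    by apply/measurable_EFinP; apply: measurable_funX; exact: measurable_cabs.
  move=> xi _ /=; rewrite lee_fin !ger0_norm ?sqr_ge0//.
  by rewrite lerXn2r ?nnegrE.
have g'0 xi : ~ cube 1 xi -> g' xi = 0.
  by move=> hxi; rewrite /g' indicE memNset// mul0r.
have fg' : L2norm (fun xi => fourier_integral (cube n%:R) f xi - g' xi) @[n --> \oo] --> 0%E.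
  have -> : (fun n : nat => L2norm (fun xi => fourier_integral (cube n%:R) f xi - g' xi)) =
     (fun n : nat => L2norm (fun xi => fourier_integral (cube n%:R) f xi - g xi)).
    apply/funext => n; apply: eq_L2norm_ae.
    - by apply: cmeasB => //; exact: cmeas_fourier.
    - by apply: cmeasB; [exact: cmeas_fourier|exact: sg.1].
    - move: gg'; apply: (@filterS _ _ (ae_filter_ringOfSetsType lam)) => xi.
      by move=> ->.
  exact: fg.
have ig' := cintegrable_spectrum sg' g'0.
have sqintZ F : sqint F -> sqint (fun x => c%:C%C * F x) /\
    \int[lam]_x cabs (c%:C%C * F x) ^+ 2 = c ^+ 2 * \int[lam]_x cabs (F x) ^+ 2.
  move=> [mF iF].
  have e x : cabs (c%:C%C * F x) ^+ 2 = c ^+ 2 * cabs (F x) ^+ 2.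
    by rewrite cabsM cabs_real// exprMn.
  split; last by rewrite -RintegralZl//; apply: eq_Rintegral => x _; rewrite e.
  split; first by apply: cmeasM => //; exact: cmeas_cst.
  apply: eq_integrable (integrableZl measurableT (c ^+ 2) iF) => // x _.
  by rewrite /comp e.
have [scf Ecf] := sqintZ f sf; have [scg Ecg] := sqintZ g' sg'.
have cg'0 xi : ~ cube 1 xi -> c%:C%C * g' xi = 0 by move=> /g'0 ->; rewrite mulr0.
split; [by []|by rewrite Ecf|].
exists (fun xi => c%:C%C * g' xi); split => //.
- exact: cintegrableZ.
- have b := bessel sf sg' g'0 fg' cf.
  have ic : lam.-integrable setT (EFin \o (\1_(cube 1) : Rvec R d -> R)).
    apply/integrableP; split; first by apply/measurable_EFinP; exact: measurable_indic.
    under eq_integral => x _ do rewrite /= ger0_norm ?indicE ?ler0n// -indicE.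
    by rewrite integral_indic// setIT; exact: leb_cube_lty.
  have Ic : \int[lam]_xi (\1_(cube 1) xi) = 1 :> R.
    rewrite /Rintegral integral_indic// setIT.
    transitivity (fine ((1 : R) ^+ d)%:E); last by rewrite /= expr1n.
    by congr fine; exact: leb_cube.
  have isum := integrableD measurableT ic scg.2.
  have : \int[lam]_xi cabs (c%:C%C * g' xi) <=
      \int[lam]_xi (2^-1 * (\1_(cube 1) xi + cabs (c%:C%C * g' xi) ^+ 2)).
    apply: le_Rintegral => //; first exact: (cintegrableZ measurableT c%:C%C ig').2.
      exact: (integrableZl measurableT 2^-1 isum).
    move=> xi _; have [hxi|hxi] := pselect (cube 1 xi); last first.
      by rewrite cg'0// cabs0 mulr_ge0 ?invr_ge0// addr_ge0 ?sqr_ge0.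
    rewrite indicE mem_set//=; set u := cabs _.
    by have := sqr_ge0 (u - 1); nra.
  rewrite RintegralZl// RintegralD// ?Ic ?Ecg; last exact: scg.2.
  move=> /le_trans; apply; rewrite ler_pdivrMl// mulr1.
  have : c ^+ 2 * \int[lam]_xi cabs (g' xi) ^+ 2 <= 1.
    by rewrite (le_trans _ f1)// ler_wpM2l// sqr_ge0.
  lra.
- move=> x; rewrite (fourier_inversion sf sg' g'0 fg' cf) /inv_ft -cintZ//; last first.
    exact: cintegrable_gwave.
  by apply: eq_cint => xi _; rewrite mulrA.
Qed.

Lemma cabs_unit_band f x : unit_band f -> cabs (f x) <= 1.
Proof.
by move=> [_ _ [g [ig _ g1 ->]]]; rewrite (le_trans (cabs_inv_ft ig x)).
Qed.

Lemma unit_band0 : unit_band (fun=> 0).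
Proof.
have i0 : lam.-integrable setT (EFin \o (fun _ : Rvec R d => (0 : R))).
  exact: integrable0.
have m0 : cmeas (fun _ : Rvec R d => (0 : R[i])) by exact: cmeas_cst.
split.
- split=> //; apply: eq_integrable i0 => // x _; rewrite /comp cabs0 expr0n//.
- rewrite (_ : \int[lam]_x _ = 0)//; under eq_Rintegral => x _ do rewrite cabs0 expr0n/=.
  by rewrite Rintegral_cst// mul0r.
- exists (fun=> 0); split => //.
  + split=> //; apply: eq_integrable i0 => // x _; rewrite /comp cabs0//.
  + under eq_Rintegral => x _ do rewrite cabs0.
    by rewrite Rintegral_cst// mul0r.
  + move=> x; rewrite /inv_ft (@eq_cint _ _ _ _ _ _ (fun=> 0)); last by move=> xi _; rewrite mul0r.
    by rewrite /cint Rintegral_cst// mul0r.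
Qed.

End unit_band.

(** * Taylor polynomials on the unit circle *)

Section taylor.
Context (R : realType).

Definition iunit : R[i] := Complex 0 1.
Definition tpoly (N : nat) (t : R) : R[i] :=
  \sum_(m < N) iunit ^+ m * (t ^+ m / m`!%:R)%:C%C.

Lemma is_derive_pow_fact (m : nat) (t : R) :
  is_derive t 1 (fun t : R => t ^+ m.+1 / m.+1`!%:R) (t ^+ m / m`!%:R).
Proof.
have h : is_derive t 1 (fun t : R => t ^+ m.+1) (m.+1%:R * t ^+ m).
  have h := is_deriveX m.+1 (is_derive_id t (1 : R)).
  rewrite (_ : (fun t => _) = (id : R -> R) ^+ m.+1); last first.
    by apply/funext => s; rewrite fctE.
  by apply: is_derive_eq; rewrite /GRing.scale /= mulr1.
have h2 := is_deriveM h (is_derive_cst ((m.+1)`!%:R^-1 : R) t 1).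
apply: is_derive_eq; rewrite /GRing.scale /= /cst ?fctE mulr0 add0r.
rewrite factS natrM.
have f0 : (m`!%:R : R) != 0 by rewrite pnatr_eq0 -lt0n fact_gt0.
have m0 : (m.+1%:R : R) != 0 by rewrite pnatr_eq0.
by move: (t ^+ m) (m`!%:R : R) (m.+1%:R : R) f0 m0 => a b c b0 c0; field; rewrite b0 c0.
Qed.

(** With the next lemma, the identity P_(N+1)' = i P_N for the Taylor polynomials P_N
    of exp(it). *)
Lemma is_derive_tpoly_Re (N : nat) (t : R) :
  is_derive t 1 (fun t => complex.Re (tpoly N.+1 t)) (- complex.Im (tpoly N t)).
Proof.
elim: N => [|N IH].
  rewrite /tpoly big_ord0 /= oppr0.
  rewrite (_ : (fun t => _) = cst 1); first exact: is_derive_cst.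
  by apply/funext => s; rewrite big_ord1 !expr0 mul1r fact0 divr1.
have h := is_deriveD IH (is_deriveM (is_derive_cst (complex.Re (iunit ^+ N.+1)) t 1)
  (is_derive_pow_fact N t)).
rewrite (_ : (fun t => _) = (fun t => complex.Re (tpoly N.+1 t)) +
   (cst (complex.Re (iunit ^+ N.+1)) * (fun t : R => t ^+ N.+1 / N.+1`!%:R))); last first.
  by apply/funext => s; rewrite /tpoly big_ord_recr cReD cReM /= mulr0 subr0.
apply: is_derive_eq; rewrite /GRing.scale /= /cst ?mulr0 ?addr0.
rewrite /tpoly [in RHS]big_ord_recr cImD opprD; congr (_ + _).
by rewrite exprS cReM cImM /=; ring.
Qed.

Lemma is_derive_tpoly_Im (N : nat) (t : R) :
  is_derive t 1 (fun t => complex.Im (tpoly N.+1 t)) (complex.Re (tpoly N t)).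
Proof.
elim: N => [|N IH].
  rewrite /tpoly big_ord0 /=.
  rewrite (_ : (fun t => _) = cst 0); first exact: is_derive_cst.
  by apply/funext => s; rewrite big_ord1 !expr0 mul1r fact0 divr1.
have h := is_deriveD IH (is_deriveM (is_derive_cst (complex.Im (iunit ^+ N.+1)) t 1)
  (is_derive_pow_fact N t)).
rewrite (_ : (fun t => _) = (fun t => complex.Im (tpoly N.+1 t)) +
   (cst (complex.Im (iunit ^+ N.+1)) * (fun t : R => t ^+ N.+1 / N.+1`!%:R))); last first.
  by apply/funext => s; rewrite /tpoly big_ord_recr cImD cImM /= mulr0 add0r.
apply: is_derive_eq; rewrite /GRing.scale /= /cst ?mulr0 ?addr0.
rewrite /tpoly [in RHS]big_ord_recr cReD; congr (_ + _).
by rewrite exprS cReM cImM /=; ring.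
Qed.

Lemma tpoly0 (N : nat) : tpoly N.+1 0 = 1.
Proof.
rewrite /tpoly big_ord_recl big1 ?addr0; last first.
  by move=> i _; rewrite expr0n/= mul0r mulr0.
by rewrite !expr0 mul1r fact0 divr1.
Qed.

(** By induction: the error of order N+1 vanishes at 0, and its derivative is i
    times the error of order N. *)
Lemma tpoly_err (N : nat) (t : R) :
  `|complex.Re (cexpi t - tpoly N t)| <= `|t| ^+ N /\
  `|complex.Im (cexpi t - tpoly N t)| <= `|t| ^+ N.
Proof.
elim: N t => [|N IH] t.
  rewrite /tpoly big_ord0 subr0 expr0 /=.
  by split; [exact: cos_max|exact: sin_max].
have seg (x : R) : Num.min 0 t <= x <= Num.max 0 t -> `|x| <= `|t|.
  have [t0|t0] := leP 0 t => /andP[x1 x2].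
    by rewrite (ger0_norm t0) ger0_norm.
  by rewrite (ltr0_norm t0) ler0_norm// lerN2.
split.
- have dF (x : R) : is_derive x 1 (fun t => complex.Re (cexpi t - tpoly N.+1 t))
      (- complex.Im (cexpi x - tpoly N x)).
    have h := is_deriveB (is_derive_cos x) (is_derive_tpoly_Re N x).
    rewrite (_ : (fun t => _) = @cos R - (fun t => complex.Re (tpoly N.+1 t))).
      by apply: is_derive_eq; rewrite cImD cImN /=; ring.
    by apply/funext => s; rewrite cReD cReN.
  have := @mvt_bound R _ _ (`|t| ^+ N) 0 t dF.
  rewrite tpoly0 cexpi0 subrr /= !subr0 exprSr; apply => x /seg xt.
  rewrite normrN; case: (IH x) => _ h; rewrite (le_trans h)//.
  by rewrite lerXn2r ?nnegrE.
- have dF (x : R) : is_derive x 1 (fun t => complex.Im (cexpi t - tpoly N.+1 t))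
      (complex.Re (cexpi x - tpoly N x)).
    have h := is_deriveB (is_derive_sin x) (is_derive_tpoly_Im N x).
    rewrite (_ : (fun t => _) = @sin R - (fun t => complex.Im (tpoly N.+1 t))).
      by apply: is_derive_eq; rewrite cReD cReN.
    by apply/funext => s; rewrite cImD cImN.
  have := @mvt_bound R _ _ (`|t| ^+ N) 0 t dF.
  rewrite tpoly0 cexpi0 subrr /= !subr0 exprSr; apply => x /seg xt.
  case: (IH x) => h _; rewrite (le_trans h)//.
  by rewrite lerXn2r ?nnegrE.
Qed.

Lemma cabs_tpoly_err (N : nat) (t : R) : cabs (cexpi t - tpoly N t) <= 2 * `|t| ^+ N.
Proof.
rewrite (le_trans (cabs_le_ReIm _))// mulr_natl mulr2n.
by case: (tpoly_err N t) => h1 h2; exact: lerD.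
Qed.

(** The factors are replaced one at a time; each step at most doubles the error
    and adds e. *)
Lemma cabs_prod_err (I : Type) (s : seq I) (z w : I -> R[i]) (e : R) :
  (forall i, cabs (z i) <= 1) -> (forall i, cabs (w i) <= 2) ->
  (forall i, cabs (z i - w i) <= e) -> 0 <= e ->
  cabs (\prod_(i <- s) z i - \prod_(i <- s) w i) <= 2 ^+ size s * e - e.
Proof.
move=> z1 w2 zw e0; elim: s => [|i s IH].
  by rewrite !big_nil subrr cabs0 expr0 mul1r subrr.
rewrite !big_cons.
set Z := \prod_(j <- s) z j; set W := \prod_(j <- s) w j.
rewrite (_ : _ - _ = (z i - w i) * Z + w i * (Z - W)); last by ring.
rewrite (le_trans (cabsD _ _))// !cabsM.
have Z1 : cabs Z <= 1.
  by rewrite cabs_prod prodr_ile1// => j *; rewrite cabs_ge0 z1.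
rewrite (_ : _ - e = e * 1 + 2 * (2 ^+ size s * e - e)); last by rewrite /= exprS; ring.
by rewrite lerD// ler_pM.
Qed.

End taylor.

Section cint_sum.
Context (R : realType) (dT : measure_display) (T : measurableType dT)
  (mu : {measure set T -> \bar R}).

Lemma cint_sum (I : Type) (s : seq I) (F : I -> T -> R[i]) :
  (forall i, cintegrable mu setT (F i)) ->
  cintegrable mu setT (fun x => \sum_(i <- s) F i x) /\
  cint mu setT (fun x => \sum_(i <- s) F i x) = \sum_(i <- s) cint mu setT (F i).
Proof.
move=> iF; elim: s => [|i s [IH1 IH2]].
  rewrite big_nil; have -> : (fun x => \sum_(i <- [::]) F i x) = (fun=> 0).
    by apply/funext => x; rewrite big_nil.
  split; last by rewrite /cint Rintegral_cst// mul0r.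
  split; first exact: cmeas_cst.
  apply: (@eq_integrable _ _ _ _ _ measurableT (cst 0%E)); last exact: integrable0.
  by move=> x _; rewrite /comp cabs0.
have e : (fun x => \sum_(j <- i :: s) F j x) = (fun x => F i x + \sum_(j <- s) F j x).
  by apply/funext => x; rewrite big_cons.
rewrite e; split; first exact: cintegrableD.
by rewrite cintD// big_cons IH2.
Qed.
End cint_sum.

(** * Local expansions of bandlimited functions *)

Section local_expansion.
Context (R : realType) (d : nat).
Local Notation lam := (leb R d).
Implicit Types (f g : Rvec R d -> R[i]) (u x c xi : Rvec R d).

Lemma pi_lt4 : (pi : R) < 4.
Proof. by have := pihalf_lt2 R; rewrite ltr_pdivrMr// => h; rewrite (lt_le_trans h)//; lra. Qed.

Definition monom (N : nat) (al : {ffun 'I_d -> 'I_N}) xi : R :=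
  \prod_(i < d) (tnth xi i : R) ^+ al i.

(** The coefficient of a monomial in xi in the product of the Taylor polynomials
    of the exp(2 pi i u_i xi_i). *)
Definition taylor_amp (N : nat) (al : {ffun 'I_d -> 'I_N}) u : R[i] :=
  \prod_(i < d) (iunit R ^+ al i * ((2 * pi * (tnth u i : R)) ^+ al i / (al i)`!%:R)%:C%C).

(** The data that determine f near c. *)
Definition moment g c (N : nat) (al : {ffun 'I_d -> 'I_N}) : R[i] :=
  cint lam setT (fun xi => g xi * waved c xi * (monom al xi)%:C%C).

Lemma prod_tpolyE N u xi :
  \prod_(i < d) tpoly N (2 * pi * ((tnth u i : R) * tnth xi i)) =
  \sum_(al : {ffun 'I_d -> 'I_N}) taylor_amp al u * (monom al xi)%:C%C.
Proof.
rewrite /tpoly bigA_distr_bigA; apply: eq_bigr => al _.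
rewrite /taylor_amp /monom rmorph_prodC -big_split; apply: eq_bigr => i _ /=.
set z := iunit R ^+ _; rewrite -[RHS]mulrA; congr (_ * _).
by rewrite mulrA exprMn mulrAC rmorphM.
Qed.

(** Since pi < 4, the phase is at most 2 * 4 * (1/32) * (1/2). *)
Lemma small_angle u xi i : `|tnth u i : R| <= 32^-1 -> cube 1 xi ->
  `|2 * pi * ((tnth u i : R) * tnth xi i)| <= 8^-1.
Proof.
move=> hu hxi; have p4 := pi_lt4; have p0 := pi_gt0 R.
have hx : `|tnth xi i : R| <= 2^-1.
  by have := hxi i; rewrite ler_norml => /andP[h1 h2]; apply/andP; split; lra.
rewrite !normrM (ger0_norm (ltW p0)) (ger0_norm (ler0n R 2)).
have hab : `|tnth u i : R| * `|tnth xi i : R| <= 32^-1 * 2^-1 by rewrite ler_pM.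
have hp : 2 * pi <= 2 * 4 :> R by rewrite ler_pM2l// ltW.
have hp0 : 0 <= 2 * pi :> R by rewrite mulr_ge0// ltW.
have := ler_pM hp0 (mulr_ge0 (normr_ge0 _) (normr_ge0 _)) hp hab.
by move=> /le_trans; apply; lra.
Qed.

Lemma waved_expansion N u xi : (0 < N)%N -> (forall i, `|tnth u i : R| <= 32^-1) ->
  cube 1 xi ->
  cabs (waved u xi - \sum_(al : {ffun 'I_d -> 'I_N}) taylor_amp al u * (monom al xi)%:C%C)
   <= 2 ^+ d * (2 * 8^-1 ^+ N).
Proof.
move=> N0 hu hxi; rewrite -prod_tpolyE /waved.
have herr i : cabs (wave (tnth u i) (tnth xi i) - tpoly N (2 * pi * ((tnth u i : R) * tnth xi i)))
    <= 2 * 8^-1 ^+ N.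
  rewrite (le_trans (cabs_tpoly_err _ _))// ler_pM2l//.
  by rewrite lerXn2r ?nnegrE//; exact: small_angle.
have h1 : (8^-1 : R) ^+ N <= 8^-1.
  by case: N N0 {herr} => // N _; rewrite exprS ler_piMr// exprn_ile1//; lra.
have e0 : 0 <= 2 * (8^-1 : R) ^+ N by rewrite mulr_ge0// exprn_ge0.
have := @cabs_prod_err R _ (index_enum 'I_d)
  (fun i => wave (tnth u i) (tnth xi i))
  (fun i => tpoly N (2 * pi * ((tnth u i : R) * tnth xi i))) (2 * 8^-1 ^+ N).
rewrite [size _](_ : _ = d); last by rewrite /index_enum -enumT size_enum_ord.
move=> h; apply: (le_trans (h _ _ herr e0)).
- by move=> i; rewrite cabs_wave.
- move=> i; have := herr i; set z := wave _ _; set w := tpoly _ _ => zw.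
  rewrite (_ : w = z - (z - w)); last by ring.
  rewrite (le_trans (cabsB _ _))// {1}/z cabs_wave; lra.
- by rewrite gerBl.
Qed.

Lemma cabs_taylor_amp N (al : {ffun 'I_d -> 'I_N}) u : (forall i, `|tnth u i : R| <= 32^-1) ->
  cabs (taylor_amp al u) <= 1.
Proof.
move=> hu; rewrite cabs_prod; apply: prodr_ile1 => i *.
rewrite cabs_ge0 cabsM cabs_realE normrM normrX normfV normr_nat.
have -> : cabs (iunit R ^+ al i) = 1.
  elim: (nat_of_ord (al i)) => [|n IH]; first by rewrite expr0 cabs1.
  by rewrite exprS cabsM IH mulr1 cabsE /= expr0n expr1n add0r sqrtr1.
have hx : `|2 * pi * (tnth u i : R)| <= 1.
  have p4 := pi_lt4; have p0 := pi_gt0 R.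
  rewrite !normrM (ger0_norm (ltW p0)) (ger0_norm (ler0n R 2)).
  have hp : 2 * pi <= 2 * 4 :> R by rewrite ler_pM2l// ltW.
  have hp0 : 0 <= 2 * pi :> R by rewrite mulr_ge0// ltW.
  have := ler_pM hp0 (normr_ge0 _) hp (hu i).
  by move=> /le_trans; apply; lra.
rewrite mul1r mulr_ile1// ?exprn_ge0// ?invr_ge0// ?exprn_ile1//.
by rewrite invf_le1 ?ltr0n ?fact_gt0// ler1n fact_gt0.
Qed.

Lemma monom_le1 N (al : {ffun 'I_d -> 'I_N}) xi : cube 1 xi -> `|monom al xi| <= 1.
Proof.
move=> hxi; rewrite /monom normr_prod; apply: prodr_ile1 => i *.
rewrite normr_ge0 normrX exprn_ile1//.
by have := hxi i; rewrite ler_norml => /andP[h1 h2]; apply/andP; split; lra.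
Qed.

Lemma measurable_monom N (al : {ffun 'I_d -> 'I_N}) : measurable_fun setT (monom al).
Proof.
apply: measurable_prod => i _; apply: measurable_funX; exact: measurable_tnth.
Qed.

Section rep.
Context f g (fg : spectral_rep f g).

Lemma moment_bound c N (al : {ffun 'I_d -> 'I_N}) xi :
  cabs (g xi * waved c xi * (monom al xi)%:C%C) <= cabs (g xi).
Proof.
case: fg => _ g0 _ _; rewrite cabsM cabs_gwave cabs_realE.
have [hxi|/g0 ->] := pselect (cube 1 xi); last by rewrite cabs0 mul0r.
by rewrite ler_piMr// monom_le1.
Qed.

Lemma cintegrable_moment c N (al : {ffun 'I_d -> 'I_N}) :
  cintegrable lam setT (fun xi => g xi * waved c xi * (monom al xi)%:C%C).
Proof.
case: (fg) => ig _ _ _.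
apply: (cintegrable_le measurableT _ ig.2).
  apply: cmeasM; last by apply: cmeas_real; exact: measurable_monom.
  by apply: cmeasM; [exact: ig.1|exact: cmeas_wavedr].
by move=> xi _; exact: moment_bound.
Qed.

Lemma cabs_moment c N (al : {ffun 'I_d -> 'I_N}) : cabs (moment g c al) <= 1.
Proof.
case: (fg) => ig _ g1 _.
apply: (le_trans (cabs_cint measurableT (cintegrable_moment c al))).
apply: le_trans g1; apply: le_Rintegral => //.
- exact: (cintegrable_moment c al).2.
- exact: ig.2.
- by move=> xi _; exact: moment_bound.
Qed.

(** The expansion of the characters is inserted in the inverse transform; its error
    is multiplied by the L^1 norm of g, which is at most 1. *)
Lemma local_approx N c u x : (0 < N)%N -> (forall i, `|tnth u i : R| <= 32^-1) ->
  (forall i, (tnth x i : R) = (tnth c i : R) + tnth u i) ->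
  cabs (f x - \sum_(al : {ffun 'I_d -> 'I_N}) taylor_amp al u * moment g c al)
   <= 2 ^+ d * (2 * 8^-1 ^+ N).
Proof.
move=> N0 hu xcu; case: (fg) => ig g0 g1 ->.
have ial (al : {ffun 'I_d -> 'I_N}) := cintegrableZ measurableT (taylor_amp al u) (cintegrable_moment c al).
have [iS sE] := cint_sum (index_enum {ffun 'I_d -> 'I_N}) ial.
have -> : \sum_(al : {ffun 'I_d -> 'I_N}) taylor_amp al u * moment g c al =
    \sum_(al : {ffun 'I_d -> 'I_N}) cint lam setT (fun xi => taylor_amp al u * (g xi * waved c xi * (monom al xi)%:C%C)).
  by apply: eq_bigr => al _; rewrite cintZ//; exact: cintegrable_moment.
rewrite -sE /inv_ft -cintB//; last exact: cintegrable_gwave.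
have iB := cintegrableB measurableT (cintegrable_gwave ig x) iS.
apply: (le_trans (cabs_cint measurableT iB)).
set e := 2 ^+ d * _.
have e0 : 0 <= e by rewrite !mulr_ge0 ?exprn_ge0.
apply: (@le_trans _ _ (\int[lam]_xi (e * cabs (g xi)))); last first.
  by rewrite RintegralZl//; [rewrite ler_piMr|exact: ig.2].
apply: le_Rintegral => //; first exact: iB.2.
  exact: (integrableZl measurableT e ig.2).
move=> xi _; have [hxi|/g0 ->] := pselect (cube 1 xi); last first.
  rewrite cabs0 mulr0 big1 ?mul0r ?subr0 ?cabs0// => al _.
  by rewrite !mul0r mulr0.
have -> : g xi * waved x xi -
    \sum_(al : {ffun 'I_d -> 'I_N}) taylor_amp al u * (g xi * waved c xi * (monom al xi)%:C%C) =
    g xi * waved c xi * (waved u xi - \sum_(al : {ffun 'I_d -> 'I_N}) taylor_amp al u * (monom al xi)%:C%C).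
  rewrite mulrBr big_distrr/=; congr (_ - _).
    rewrite -mulrA /waved -big_split; congr (_ * _); apply: eq_bigr => i _ /=.
    by rewrite xcu waveD.
  by apply: eq_bigr => al _; ring.
rewrite cabsM cabs_gwave mulrC ler_wpM2r//; exact: waved_expansion.
Qed.
End rep.

Lemma local_close f g f' g' N c u x (dl : R) : spectral_rep f g -> spectral_rep f' g' ->
  (0 < N)%N -> (forall i, `|tnth u i : R| <= 32^-1) ->
  (forall i, (tnth x i : R) = (tnth c i : R) + tnth u i) ->
  (forall al : {ffun 'I_d -> 'I_N}, cabs (moment g c al - moment g' c al) <= dl) ->
  cabs (f x - f' x) <= (N ^ d)%:R * dl + 2 * (2 ^+ d * (2 * 8^-1 ^+ N)).
Proof.
move=> fg fg' N0 hu xcu hdl.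
have h1 := local_approx fg N0 hu xcu; have h2 := local_approx fg' N0 hu xcu.
move: h1 h2; set S := \sum_(_ | _) _; set S' := \sum_(_ | _) _ => h1 h2.
rewrite (_ : f x - f' x = (S - S') + ((f x - S) - (f' x - S'))); last by ring.
rewrite (le_trans (cabsD _ _))// lerD//; last first.
  rewrite (le_trans (cabsB _ _))// [leRHS]mulr_natl mulr2n lerD//.
rewrite /S /S' -sumrB (le_trans (cabs_sum _ _ _))//.
apply: (@le_trans _ _ (\sum_(al : {ffun 'I_d -> 'I_N}) dl)); last first.
  by rewrite sumr_const card_ffun !card_ord mulr_natl.
apply: ler_sum => al _; rewrite -mulrBr cabsM.
by rewrite -[leRHS]mul1r ler_pM ?cabs_taylor_amp.
Qed.

End local_expansion.

(** * Metric entropy of the unit ball on a cube *)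

Section quantization.
Context (R : realType).

Definition quantize (M : nat) (t : R) : 'I_(2 * M).+1 := inord (Num.trunc ((t + 1) * M%:R)).

Lemma quantize_close (M : nat) (t s : R) : (0 < M)%N -> `|t| <= 1 -> `|s| <= 1 ->
  quantize M t = quantize M s -> `|t - s| <= M%:R^-1.
Proof.
move=> M0 t1 s1 /(congr1 (@nat_of_ord _)).
have Mp : 0 < M%:R :> R by rewrite ltr0n.
have bnd (z : R) : `|z| <= 1 -> 0 <= (z + 1) * M%:R /\ (Num.trunc ((z + 1) * M%:R) < (2 * M).+1)%N.
  rewrite ler_norml => /andP[z1 z2].
  have z0 : 0 <= (z + 1) * M%:R by rewrite mulr_ge0//; lra.
  split => //; rewrite truncn_lt_nat// -natr1 natrM (@le_lt_trans _ _ (2 * M%:R))//.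
    by rewrite ler_wpM2r//; lra.
  by rewrite ltrDl.
have [ht1 ht2] := bnd t t1; have [hs1 hs2] := bnd s s1.
rewrite !inordK// => e.
have /andP[a1 a2] := truncn_itv ht1; have /andP[b1 b2] := truncn_itv hs1.
rewrite e in a1 a2; move: a1 a2 b1 b2; set n := Num.trunc _; rewrite -!natr1 => a1 a2 b1 b2.
rewrite -(ler_pM2r Mp) mulVf ?gt_eqF// -(ger0_norm (ltW Mp)) -normrM ler_norml.
by apply/andP; split; lra.
Qed.

(** From x^p / p! <= exp x at x = (k+1) / 2, and exp (1/2) <= 2. *)
Lemma poly_le_exp2 (p : nat) : exists2 C : R, 0 < C & forall k : nat, k.+1%:R ^+ p <= C * 2 ^+ k.
Proof.
case: p => [|p].
  by exists 1 => // k; rewrite expr0 mul1r exprn_ege1//; lra.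
exists (2 ^+ p.+1 * p.+1`!%:R * 2); first by rewrite !mulr_gt0// ?exprn_gt0// ltr0n fact_gt0.
move=> k; have x0 : 0 <= (k.+1%:R / 2 : R) by rewrite divr_ge0.
have := expR_ge1Dxn p x0.
have e2 : expR (2^-1 : R) <= 2.
  have := expR_ge1Dx (- 2^-1 : R); rewrite expRN => h.
  have E0 := expR_gt0 (2^-1 : R).
  have := ler_wpM2l (ltW E0) h; rewrite mulfV ?gt_eqF//; lra.
have -> : expR (k.+1%:R / 2) = expR (2^-1 : R) ^+ k.+1 by rewrite -expRM_natl mulrC.
have h3 : expR (2^-1 : R) ^+ k.+1 <= 2 ^+ k.+1 by rewrite lerXn2r ?nnegrE ?expR_ge0.
have f0 : 0 < p.+1`!%:R :> R by rewrite ltr0n fact_gt0.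
move=> h; have h4 : (k.+1%:R / 2) ^+ p.+1 / p.+1`!%:R <= 2 ^+ k.+1 :> R.
  by rewrite (le_trans _ h3)// (le_trans _ h)// lerDr.
move: h4; rewrite ler_pdivrMr// expr_div_n ler_pdivrMr ?exprn_gt0// => /le_trans; apply.
by rewrite exprS le_eqVlt; apply/orP; left; apply/eqP; ring.
Qed.
End quantization.

Section entropy.
Context (R : realType) (d : nat).
Implicit Types (f g : Rvec R d -> R[i]) (x : Rvec R d).

Definition spectrum f : Rvec R d -> R[i] := xget (fun=> 0) (spectral_rep f).

Lemma spectrumP f : unit_band f -> spectral_rep f (spectrum f).
Proof. by move=> [_ _ [g hg]]; exact: (xgetPex (fun=> 0) (ex_intro _ g hg)). Qed.

Section code.
Context (L : R) (N M : nat).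
(** Cells of side 1/32 cover [-L/2, L/2]; the extra one contains the right end
    point. *)
Definition cells_per_side := (Num.trunc (32 * L)).+1.

Definition corner (j : {ffun 'I_d -> 'I_cells_per_side}) : Rvec R d :=
  [tuple (- (L / 2) + (j i)%:R / 32 : R) | i < d].

Definition cellof x : {ffun 'I_d -> 'I_cells_per_side} :=
  [ffun i => inord (Num.trunc (((tnth x i : R) + L / 2) * 32))].

Definition offset x : Rvec R d :=
  [tuple ((tnth x i : R) - tnth (corner (cellof x)) i : R) | i < d].

(** One rounded number for each cell, each multi-index and each of the real and
    imaginary parts of a moment. *)
Definition codeT : finType :=
  {ffun ({ffun 'I_d -> 'I_cells_per_side} * {ffun 'I_d -> 'I_N} * bool)%type -> 'I_(2 * M).+1}.

Definition quantcode f : codeT := [ffun p =>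
  let z := moment (spectrum f) (corner p.1.1) p.1.2 in
  quantize M (if p.2 then complex.Re z else complex.Im z)].

Lemma offsetE x i : (tnth x i : R) = (tnth (corner (cellof x)) i : R) + tnth (offset x) i.
Proof. by rewrite [X in _ + X]tnth_mktuple addrC subrK. Qed.

Lemma offset_small x i : cube L x -> `|tnth (offset x) i : R| <= 32^-1.
Proof.
move=> hx; rewrite /offset !tnth_mktuple ffunE.
have /andP[h1 h2] := hx i.
have y0 : 0 <= ((tnth x i : R) + L / 2) * 32 by rewrite mulr_ge0//; lra.
have yn : (Num.trunc (((tnth x i : R) + L / 2) * 32) < cells_per_side)%N.
  rewrite ltnS; apply: le_truncn; lra.
rewrite inordK//.
have /andP[] := truncn_itv y0; rewrite -natr1; set m := (Num.trunc _)%:R => m1 m2.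
by rewrite ler_norml; apply/andP; split; lra.
Qed.

Lemma code_close f f' x : (0 < N)%N -> (0 < M)%N -> unit_band f -> unit_band f' ->
  quantcode f = quantcode f' -> cube L x ->
  cabs (f x - f' x) <= (N ^ d)%:R * (2 * M%:R^-1) + 2 * (2 ^+ d * (2 * 8^-1 ^+ N)).
Proof.
move=> N0 M0 uf uf' cff' hx.
have rf := spectrumP uf; have rf' := spectrumP uf'.
apply: (local_close rf rf' N0 (fun i => offset_small i hx) (offsetE x)) => al.
set z := moment _ _ _; set z' := moment _ _ _.
have z1 : cabs z <= 1 by exact: cabs_moment rf _ _ _.
have z1' : cabs z' <= 1 by exact: cabs_moment rf' _ _ _.
rewrite (le_trans (cabs_le_ReIm _))// mulr_natl mulr2n cReD cReN cImD cImN lerD//.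
  apply: quantize_close => //; [exact: le_trans (normr_Re_le _) _|exact: le_trans (normr_Re_le _) _|].
  by have := congr1 (fun h : codeT => h (cellof x, al, true)) cff'; rewrite !ffunE.
apply: quantize_close => //; [exact: le_trans (normr_Im_le _) _|exact: le_trans (normr_Im_le _) _|].
by have := congr1 (fun h : codeT => h (cellof x, al, false)) cff'; rewrite !ffunE.
Qed.

Lemma card_codeT : #|codeT| = ((2 * M).+1 ^ (cells_per_side ^ d * N ^ d * 2))%N.
Proof. by rewrite card_ffun !card_prod !card_ffun !card_ord card_bool. Qed.

End code.

(** This order and the number of rounding steps below make each of the two errors in
    code_close at most 4^-k / 4. *)
Definition taylor_order (k : nat) := (k + d + 2)%N.
Definition quant_levels (k : nat) := (8 * 4 ^ k * taylor_order k ^ d)%N.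

Lemma code_close_level (L : R) (k : nat) f f' x : unit_band f -> unit_band f' ->
  quantcode L (taylor_order k) (quant_levels k) f = quantcode L (taylor_order k) (quant_levels k) f' -> cube L x ->
  cabs (f x - f' x) <= 4^-1 ^+ k / 2.
Proof.
move=> uf uf' cff' hx.
have N0 : (0 < taylor_order k)%N by rewrite /taylor_order addn2.
have M0 : (0 < quant_levels k)%N by rewrite /quant_levels !muln_gt0 !expn_gt0 N0.
apply: (le_trans (code_close N0 M0 uf uf' cff' hx)).
have Nd : ((taylor_order k ^ d)%:R : R) != 0 by rewrite pnatr_eq0 -lt0n expn_gt0 N0.
have -> : (taylor_order k ^ d)%:R * (2 * (quant_levels k)%:R^-1) = 4^-1 ^+ k / 4 :> R.
  rewrite /quant_levels !natrM (natrX _ 4 k) exprVn.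
  have : (4 ^+ k : R) != 0 by rewrite expf_neq0.
  by move: ((taylor_order k ^ d)%:R : R) Nd (4 ^+ k : R) => a a0 b b0; field; rewrite a0 b0.
have h : 2 * (2 ^+ d * (2 * 8^-1 ^+ taylor_order k)) <= 4^-1 ^+ k / 4 :> R.
  rewrite /taylor_order !exprD.
  have h1 : 0 <= (8^-1 : R) ^+ k <= 4^-1 ^+ k.
    by rewrite exprn_ge0//= lerXn2r ?nnegrE//; lra.
  have h2 : 0 <= (2 : R) ^+ d * 8^-1 ^+ d <= 1.
    by rewrite -exprMn exprn_ge0//= ?exprn_ile1//; lra.
  move: h1 h2 => /andP[a1 a2] /andP[b1 b2].
  rewrite (_ : _ * _ = (2 ^+ d * 8^-1 ^+ d) * (8^-1 ^+ k) * (4 * 8^-1 ^+ 2)); last by ring.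
  have : (2 ^+ d * 8^-1 ^+ d) * (8^-1 ^+ k) <= 1 * 4^-1 ^+ k :> R by rewrite ler_pM.
  rewrite expr2; lra.
by move: h; lra.
Qed.

(** A code has at most (32 (L+1))^d entries for each of polynomially many (in k)
    indices, and the logarithm of the number of values of an entry is also
    polynomial in k; the polynomial factors are absorbed in 2^k. *)
Lemma card_code_level : exists2 C : R, 0 < C & forall (L : R) (k : nat), 0 < L ->
  (#|codeT L (taylor_order k) (quant_levels k)|%:R : R) <= expR (C * (L + 1) ^+ d * 2 ^+ k).
Proof.
have [C0 C00 hC] := poly_le_exp2 R d.+1.
pose K : R := (2 * (5 + (d + 2) * d) * (d + 2) ^ d)%:R.
exists (32 ^+ d * K * C0).
  by rewrite !mulr_gt0// ?exprn_gt0// ltr0n !muln_gt0 expn_gt0 addn2 addn_gt0.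
move=> L k L0; rewrite card_codeT.
set n := cells_per_side L; set N := taylor_order k.
have N0 : (0 < N)%N by rewrite /N /taylor_order addn2.
have nL : n%:R <= 32 * (L + 1) :> R.
  have L32 : 0 <= 32 * L by rewrite mulr_ge0// ltW.
  by have /andP[h _] := truncn_itv L32; rewrite /n /cells_per_side -natr1; lra.
have MB : ((2 * quant_levels k).+1 <= 2 ^ (5 + 2 * k + N * d))%N.
  apply: (@leq_trans (32 * 4 ^ k * N ^ d)).
    rewrite /quant_levels -/N; have : (0 < 4 ^ k * N ^ d)%N by rewrite muln_gt0 !expn_gt0 N0.
    by rewrite -!mulnA; move: (4 ^ k * N ^ d)%N => z; rewrite mulnA; lia.
  rewrite (expnD 2 (5 + 2 * k)) (expnD 2 5) (expnM 2 2 k); apply: leq_mul => //.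
  by rewrite expnM; case: (d) => // d'; rewrite leq_exp2r// ltnW// ltn_expl.
have e1 : (2 : R) <= expR 1 by have := expR_ge1Dx (1 : R).
apply: (@le_trans _ _ ((2 : R) ^+ ((5 + 2 * k + N * d) * (n ^ d * N ^ d * 2)))).
  rewrite -natrX ler_nat [leqRHS]expnM leq_exp2r//.
  by rewrite !muln_gt0 !expn_gt0 N0.
apply: (@le_trans _ _ (expR (((5 + 2 * k + N * d) * (n ^ d * N ^ d * 2))%:R : R))).
  by rewrite -[X in expR X]mulr1 expRM_natl lerXn2r ?nnegrE ?expR_ge0.
rewrite ler_expR.
have step : ((5 + 2 * k + N * d) * (n ^ d * N ^ d * 2) <=
    n ^ d * ((2 * (5 + (d + 2) * d) * (d + 2) ^ d) * k.+1 ^ d.+1))%N.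
  have NB : (N <= (d + 2) * k.+1)%N by rewrite /N /taylor_order; nia.
  have h1 : (5 + 2 * k + N * d <= (5 + (d + 2) * d) * k.+1)%N by nia.
  have h2 : (N ^ d <= (d + 2) ^ d * k.+1 ^ d)%N by rewrite -expnMn; case: (d) NB => // d' NB; rewrite leq_exp2r.
  rewrite (_ : _ * _ = n ^ d * (2 * ((5 + 2 * k + N * d) * N ^ d)))%N; last by ring.
  rewrite leq_mul2l; apply/orP; right.
  rewrite -!mulnA leq_mul2l /= expnS.
  rewrite (_ : (5 + (d + 2) * d) * _ = ((5 + (d + 2) * d) * k.+1) * ((d + 2) ^ d * k.+1 ^ d))%N; last by ring.
  exact: leq_mul.
apply: (@le_trans _ _ ((n ^ d * ((2 * (5 + (d + 2) * d) * (d + 2) ^ d) * k.+1 ^ d.+1))%:R)).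
  by rewrite ler_nat.
rewrite natrM natrX [X in _ * X]natrM -/K natrX.
have K0 : 0 <= K by exact: ler0n.
have -> : 32 ^+ d * K * C0 * (L + 1) ^+ d * 2 ^+ k = (32 * (L + 1)) ^+ d * (K * (C0 * 2 ^+ k)).
  by rewrite exprMn; ring.
have h1 : n%:R ^+ d <= (32 * (L + 1)) ^+ d.
  by rewrite lerXn2r ?nnegrE// mulr_ge0//; lra.
have h2 : K * k.+1%:R ^+ d.+1 <= K * (C0 * 2 ^+ k) by rewrite ler_wpM2l.
by apply: ler_pM; rewrite ?mulr_ge0 ?exprn_ge0.
Qed.

End entropy.

(** * Expectations of products of independent variables *)

Section weighted_law.
Import HBNNSimple.
Context (R : realType) (dT : measure_display) (T : measurableType dT).

Section one.
Context (dO : measure_display) (O : measurableType dO).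
Variables (P : {measure set O -> \bar R}) (X : O -> T) (W : O -> R).
Hypotheses (mX : measurable_fun setT X) (mW : measurable_fun setT W)
  (W0 : forall w, 0 <= W w).

Lemma weighted_nnsfun (g : {nnsfun T >-> R}) :
  (\int[P]_w (W w * g (X w))%:E =
   \sum_(k \in range g) k%:E * \int[P]_w (W w * \1_(g @^-1` [set k]) (X w))%:E)%E.
Proof.
have m1 k : measurable_fun setT (fun w => W w * \1_(g @^-1` [set k]) (X w)).
  apply: measurable_funM => //.
  by apply: (measurableT_comp _ mX) => //; exact: measurable_indic.
have nn k x : (0 <= k * \1_(g @^-1` [set k]) x).
  by have := nnfun_muleindic_ge0 g k x; rewrite -EFinM lee_fin.
transitivity (\int[P]_w (\sum_(k \in range g) (k * (W w * \1_(g @^-1` [set k]) (X w)))%:E)%E)%E.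
  apply: eq_integral => w _; rewrite fsumEFin; last exact: fimfunP.
  rewrite (fimfunE g (X w)) fsbig_finite/=; last exact: fimfunP.
  rewrite fsbig_finite/=; last exact: fimfunP.
  by rewrite big_distrr /=; congr EFin; apply: eq_bigr => k _; rewrite mulrCA.
rewrite ge0_integral_fsum; last 4 first.
- exact: measurableT.
- by move=> k; apply/measurable_EFinP; apply: measurable_funM => //; exact: measurable_cst.
- by move=> k w _; rewrite lee_fin mulrCA mulr_ge0.
- exact: fimfunP.
apply: eq_fsbigr => k /set_mem [x _ <-].
under eq_integral => w _ do rewrite EFinM.
rewrite ge0_integralZl_EFin//.
- by move=> w _; rewrite lee_fin mulr_ge0// indicE ler0n.
- exact/measurable_EFinP.
Qed.

Lemma weighted_limit (h : T -> R) (mh : measurable_fun setT (EFin \o h)) :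
  (forall x, 0 <= h x) ->
  (\int[P]_w (W w * nnsfun_approx measurableT mh n (X w))%:E)%E @[n --> \oo] -->
  (\int[P]_w (W w * h (X w))%:E)%E.
Proof.
move=> h0.
have -> : (\int[P]_w (W w * h (X w))%:E =
    \int[P]_w limn (fun n => (W w * nnsfun_approx measurableT mh n (X w))%:E))%E.
  apply: eq_integral => w _; apply/esym/cvg_lim => //.
  under eq_fun do rewrite EFinM; rewrite EFinM.
  apply: cvgeZl => //.
  by apply: (cvg_nnsfun_approx measurableT mh) => // x _; rewrite lee_fin.
apply: cvg_monotone_convergence => //.
- move=> n; apply/measurable_EFinP; apply: measurable_funM => //.
  exact: (measurableT_comp (measurable_funP _) mX).
- by move=> n w _; rewrite lee_fin mulr_ge0.
- move=> w _ m n mn; rewrite lee_fin ler_wpM2l//.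
  exact/lefP/nd_nnsfun_approx.
Qed.
End one.

(** The identity passes from indicators to simple functions by linearity, and to
    nonnegative functions by monotone convergence. *)
Lemma weighted_law_ext (d1 d2 : measure_display) (O1 : measurableType d1) (O2 : measurableType d2)
    (P1 : {measure set O1 -> \bar R}) (P2 : {measure set O2 -> \bar R})
    (X1 : O1 -> T) (X2 : O2 -> T) (W1 : O1 -> R) (W2 : O2 -> R) :
  measurable_fun setT X1 -> measurable_fun setT X2 ->
  measurable_fun setT W1 -> measurable_fun setT W2 ->
  (forall w, 0 <= W1 w) -> (forall w, 0 <= W2 w) ->
  (forall A, measurable A -> \int[P1]_w (W1 w * \1_A (X1 w))%:E = \int[P2]_w (W2 w * \1_A (X2 w))%:E)%E ->
  forall h : T -> R, measurable_fun setT h -> (forall x, 0 <= h x) ->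
  (\int[P1]_w (W1 w * h (X1 w))%:E = \int[P2]_w (W2 w * h (X2 w))%:E)%E.
Proof.
move=> mX1 mX2 mW1 mW2 W10 W20 eqA h mh h0.
have mh' : measurable_fun setT (EFin \o h) by exact/measurable_EFinP.
have l1 := weighted_limit (P := P1) mX1 mW1 W10 mh' h0.
have l2 := weighted_limit (P := P2) mX2 mW2 W20 mh' h0.
apply: (@cvg_unique _ (@ereal_hausdorff R) _ _ _ _ l1).
rewrite (_ : (fun n => _) = (fun n => \int[P2]_w (W2 w * nnsfun_approx measurableT mh' n (X2 w))%:E)%E)//.
apply/funext => n; rewrite !weighted_nnsfun//.
by apply: eq_fsbigr => k _; rewrite eqA.
Qed.
End weighted_law.

Section independence.
Context (R : realType) (dO : measure_display) (Omega : measurableType dO)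
  (P : probability Omega R) (dT : measure_display) (T : measurableType dT)
  (X : nat -> {RV P >-> T}).

Lemma measurable_RV j : measurable_fun setT (X j).
Proof. exact: measurable_funP. Qed.

Lemma integral_prob_cst (k : R) : (\int[P]_w k%:E = k%:E)%E.
Proof.
rewrite (@integral_cst _ _ _ P setT)//; transitivity (k%:E * 1)%E; last by rewrite mule1.
by congr (_ * _)%E; exact: probability_setT.
Qed.

Hypothesis indX : mutually_independent X.

(** Independence speaks of events, which is the case n = 0 of indicators. The
    functions are made general one at a time: with the other factors fixed, both
    sides are integrals in the n-th variable against weighted laws that agree on
    indicators, so weighted_law_ext applies. *)
Lemma expectation_prod_indep (n m : nat) (h : nat -> T -> R) (K : nat -> R) :
  (forall j, measurable_fun setT (h j)) ->
  (forall j x, 0 <= h j x <= K j) ->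
  (forall j, (n <= j)%N -> exists2 A, measurable A & h j = \1_A) ->
  (\int[P]_w (\prod_(j < m) h j (X j w))%:E = \prod_(j < m) \int[P]_w (h j (X j w))%:E)%E.
Proof.
have iP B : measurable B -> (\int[P]_w (\1_B w)%:E = P B)%E.
  by move=> mB; rewrite integral_indic// setIT.
elim: n m h K => [|n IH] m h K mh hK hind.
  pose A j := if pselect (exists2 A, measurable A & h j = \1_A) is left e
     then s2val (cid2 e) else set0.
  have hA j : measurable (A j) /\ h j = \1_(A j).
    rewrite /A; case: pselect => [e|]; last by case; exact: hind.
    by case: (cid2 e).
  have EA j : (\int[P]_w (h j (X j w))%:E = P (X j @^-1` A j))%E.
    have [mA ->] := hA j.
    rewrite -iP//.
    by rewrite -[_ @^-1` _]setTI; exact: (measurable_RV j measurableT mA).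
  under [RHS]eq_bigr => j _ do rewrite EA.
  pose J := [fset j | j in iota 0 m]%fset.
  have JE (F : nat -> \bar R) : (\prod_(j <- J) F j = \prod_(j < m) F j)%E.
    rewrite -(big_mkord xpredT F) /index_iota subn0; apply: perm_big.
    apply: uniq_perm; [exact: fset_uniq|exact: iota_uniq|].
    by move=> j; rewrite !inE.
  rewrite -(JE (fun j => P (X j @^-1` A j))) -(indX J (fun j => (hA j).1)) -iP; last first.
    apply: fin_bigcap_measurable => // j _.
    by rewrite -[_ @^-1` _]setTI; exact: (measurable_RV j measurableT (hA j).1).
  apply: eq_integral => w _; congr EFin.
  under eq_bigr => j _ do rewrite (hA j).2.
  have [hw|hw] := pselect ((\bigcap_(j in [set` J]) (X j @^-1` A j)) w).
    rewrite indicE mem_set// big1// => j _; rewrite indicE mem_set//.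
    by apply: hw; rewrite /= !inE mem_iota /= add0n.
  rewrite indicE memNset//.
  have /existsNP[j /not_implyP[jJ hj]] := hw.
  have jm : (j < m)%N by move: jJ; rewrite /= !inE mem_iota /= add0n.
  by rewrite (bigD1 (Ordinal jm))//= indicE memNset// mul0r.
have [mn|nm] := leqP m n.
  pose h' j := if j == n then \1_(set0 : set T) else h j.
  have := IH m h' (fun j => if j == n then 1 else K j).
  have E (F : (T -> R) -> nat -> \bar R) : (\prod_(j < m) F (h' j) j = \prod_(j < m) F (h j) j)%E.
    by apply: eq_bigr => j _; rewrite /h' ltn_eqF// (leq_trans (ltn_ord j)).
  rewrite (E (fun u j => \int[P]_w (u (X j w))%:E)%E) => <-.
  - apply: eq_integral => w _; congr EFin; apply: eq_bigr => j _.
    by rewrite /h' ltn_eqF// (leq_trans (ltn_ord j)).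
  - by move=> j; rewrite /h'; case: (j == n) => //; exact: measurable_indic.
  - by move=> j x; rewrite /h'; case: (j == n) => //; rewrite indicE; case: (_ \in _); rewrite /= ?lexx ler01.
  - move=> j nj; rewrite /h'; case: eqVneq => [_|jn]; first by exists set0.
    by apply: hind; rewrite ltn_neqAle eq_sym jn.
pose n' := Ordinal nm.
pose W w := \prod_(j < m | j != n') h j (X j w).
pose hA A j := if j == n then \1_A else h j.
have mhA A j : measurable A -> measurable_fun setT (hA A j).
  by move=> mA; rewrite /hA; case: (j == n) => //; exact: measurable_indic.
have hX j : measurable_fun setT (fun w => h j (X j w)) by exact: (measurableT_comp (mh j) (measurable_RV j)).
have mW : measurable_fun setT W.
  rewrite /W; under eq_fun do rewrite -big_filter; by apply: measurable_prod => j _; exact: hX.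
have h0 j x : 0 <= h j x by have /andP[] := hK j x.
have W0 w : 0 <= W w by apply: prodr_ge0.
have WK w : W w <= \prod_(j < m | j != n') K j.
  by apply: ler_prod => j _; exact: hK.
have EW A : measurable A -> (\int[P]_w (W w * \1_A (X n w))%:E =
    (\prod_(j < m | j != n') \int[P]_w (h j (X j w))%:E) * \int[P]_w (\1_A (X n w))%:E)%E.
  move=> mA.
  have hAn : hA A n = \1_A by rewrite /hA eqxx.
  have hAj (j : 'I_m) : j != n' -> hA A j = h j by move=> jn; rewrite /hA ifN.
  have h1 : (\int[P]_w (\prod_(j < m) hA A j (X j w))%:E =
      \prod_(j < m) \int[P]_w (hA A j (X j w))%:E)%E.
    apply: (IH m (hA A) (fun j => if j == n then 1 else K j)).
    - by move=> j; exact: mhA.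
    - by move=> j x; rewrite /hA; case: (j == n) => //; rewrite indicE; case: (_ \in _); rewrite /= ?lexx ler01.
    - move=> j nj; rewrite /hA; case: eqVneq => [_|jn]; first by exists A.
      by apply: hind; rewrite ltn_neqAle eq_sym jn.
  transitivity (\int[P]_w (\prod_(j < m) hA A j (X j w))%:E)%E.
    apply: eq_integral => w _; rewrite (bigD1 n')//= hAn mulrC; congr (_ * _)%:E.
    by apply: eq_bigr => j jn; rewrite hAj.
  rewrite h1 (bigD1 n')//= hAn muleC; congr (_ * _)%E.
  by apply: eq_bigr => j jn; rewrite hAj.
set c := (\prod_(j < m | j != n') \int[P]_w (h j (X j w))%:E)%E in EW.
have cE : (\int[P]_w (W w)%:E = c)%E.
  have one : (\int[P]_w (\1_[set: T] (X n w))%:E = 1)%E.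
    by rewrite -[RHS]integral_prob_cst; apply: eq_integral => w _; rewrite indicT.
  have := EW setT measurableT; rewrite one mule1 => <-.
  by apply: eq_integral => w _; rewrite indicT mulr1.
have cfin : c \is a fin_num.
  rewrite -cE ge0_fin_numE; last by apply: integral_ge0 => w _; rewrite lee_fin.
  apply: (@le_lt_trans _ _ (\int[P]_w (\prod_(j < m | j != n') K j)%:E)%E).
    apply: ge0_le_integral => //.
    - by move=> w _; rewrite lee_fin.
    - exact/measurable_EFinP.
    - by move=> w _; rewrite lee_fin.
  by rewrite integral_prob_cst ltry.
have c0 : 0 <= fine c by rewrite fine_ge0// -cE; apply: integral_ge0 => w _; rewrite lee_fin.
rewrite [RHS](bigD1 n')//= -/c muleC -(fineK cfin) -ge0_integralZl_EFin//; last 2 first.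
- by move=> w _; rewrite lee_fin.
- exact/measurable_EFinP.
transitivity (\int[P]_w (W w * h n (X n w))%:E)%E.
  by apply: eq_integral => w _; rewrite (bigD1 n')//= mulrC.
transitivity (\int[P]_w (fine c * h n (X n w))%:E)%E; last first.
  by apply: eq_integral => w _; rewrite EFinM.
apply: (weighted_law_ext (P1 := P) (P2 := P) (X1 := X n) (X2 := X n) (W2 := fun=> fine c)) => //.
move=> A mA; rewrite EW// -(fineK cfin) -ge0_integralZl_EFin//.
by apply/measurable_EFinP; apply: (measurableT_comp _ (measurable_RV n)).
Qed.
End independence.

(** * An exponential tail bound for uniform samples *)

Lemma measurable_ge (R : realType) (dO : measure_display) (Omega : measurableType dO)
    (g : Omega -> R) (t : R) : measurable_fun setT g ->
  measurable [set o | (t <= g o)%R].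
Proof.
move=> mg; rewrite -[X in measurable X]setTI.
have -> : [set o | t <= g o] = g @^-1` `[t, +oo[%classic.
  by apply/seteqP; split => w /=; rewrite in_itv/= andbT.
exact: (mg measurableT _ (measurable_itv _)).
Qed.

Section chernoff.
Context (R : realType) (d : nat).
Local Notation lam := (leb R d).
Context (L : R) (L0 : 0 < L).
Local Notation K := (cube L : set (Rvec R d)).
Let Ld : R := L ^+ d.
Let Ld0 : 0 < Ld. Proof. exact: exprn_gt0. Qed.

Lemma leb_K : lam K = Ld%:E. Proof. exact/leb_cube/ltW. Qed.

Definition avg (u : Rvec R d -> R) : R := Ld^-1 * \int[lam]_(x in K) u x.

Lemma integrable_bounded (u : Rvec R d -> R) (b : R) : measurable_fun setT u ->
  (forall x, `|u x| <= b) -> lam.-integrable K (EFin \o u).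
Proof.
move=> mu ub.
apply: measurable_bounded_integrable => //.
- exact: measurable_cube.
- by have := ltry Ld; congr (_ < _)%E; apply/esym; exact: leb_K.
- exact: measurable_funTS.
- exists b; split; first exact: num_real.
  by move=> M bM x _ /=; rewrite (le_trans (ub x))// ltW.
Qed.

Lemma avg_cst (c : R) : avg (fun=> c) = c.
Proof.
rewrite /avg Rintegral_cst; last exact: measurable_cube.
have -> : fine (lam K) = Ld by transitivity (fine Ld%:E) => //; congr fine; exact: leb_K.
by rewrite mulrCA mulVf ?mulr1// gt_eqF.
Qed.

Lemma avgD (u v : Rvec R d -> R) : lam.-integrable K (EFin \o u) ->
  lam.-integrable K (EFin \o v) -> avg (fun x => u x + v x) = avg u + avg v.
Proof.
by move=> iu iv; rewrite /avg RintegralD ?mulrDr//; exact: measurable_cube.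
Qed.

Lemma avgZ (c : R) (u : Rvec R d -> R) : lam.-integrable K (EFin \o u) ->
  avg (fun x => c * u x) = c * avg u.
Proof.
by move=> iu; rewrite /avg RintegralZl ?(mulrCA c)//; exact: measurable_cube.
Qed.

Lemma avgB (u v : Rvec R d -> R) : lam.-integrable K (EFin \o u) ->
  lam.-integrable K (EFin \o v) -> avg (fun x => u x - v x) = avg u - avg v.
Proof.
by move=> iu iv; rewrite /avg RintegralB ?mulrBr//; exact: measurable_cube.
Qed.

Lemma le_avg (u v : Rvec R d -> R) : lam.-integrable K (EFin \o u) ->
  lam.-integrable K (EFin \o v) -> (forall x, K x -> u x <= v x) -> avg u <= avg v.
Proof.
move=> iu iv uv; rewrite /avg ler_pM2l ?invr_gt0//.
by apply: le_Rintegral => //; exact: measurable_cube.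
Qed.

Lemma normr_avg_le (u : Rvec R d -> R) (b : R) : measurable_fun setT u ->
  (forall x, `|u x| <= b) -> `|avg u| <= b.
Proof.
move=> mu ub; have mK := @measurable_cube R d L; have iu := integrable_bounded mu ub.
have ib : lam.-integrable K (EFin \o (fun=> b)).
  by apply: (@integrable_bounded _ `|b|) => //; exact: measurable_cst.
rewrite -[leRHS]avg_cst /avg normrM ger0_norm ?invr_ge0 ?(ltW Ld0)//.
rewrite ler_pM2l ?invr_gt0//; apply: (le_trans (le_normr_Rintegral mK iu)).
by apply: le_Rintegral => //; exact: integrable_norm.
Qed.

Section prob.
Context (dO : measure_display) (Omega : measurableType dO)
  (P : probability Omega R) (X : nat -> {RV P >-> Rvec R d}).
Hypothesis indX : mutually_independent X.
Hypothesis uniX : forall j, uniformly_distributed K (X j).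

Lemma prob_uniform j A : measurable A -> P (X j @^-1` A) = (Ld^-1%:E * lam (A `&` K))%E.
Proof.
move=> mA; rewrite (uniX j mA) muleC; congr (_ * _)%E.
transitivity (Ld%:E^-1)%E; last by rewrite inver gt_eqF.
by congr (_^-1)%E; exact: leb_K.
Qed.

(** The two laws agree on indicators by definition of the uniform law. *)
Lemma expectation_uniform j (h : Rvec R d -> R) : measurable_fun setT h ->
  (forall x, 0 <= h x) ->
  (\int[P]_w (h (X j w))%:E = \int[lam]_x (Ld^-1 * \1_K x * h x)%:E)%E.
Proof.
move=> mh h0.
have mK := @measurable_cube R d L.
transitivity (\int[P]_w (1 * h (X j w))%:E)%E.
  by apply: eq_integral => w _; rewrite mul1r.
apply: (weighted_law_ext (P1 := P) (P2 := lam) (X1 := X j) (X2 := id)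
  (W1 := fun=> 1) (W2 := fun x => Ld^-1 * \1_K x)) => //.
- by apply: measurable_funM; [exact: measurable_cst|exact: measurable_indic].
- by move=> x; rewrite mulr_ge0 ?invr_ge0 ?(ltW Ld0).
move=> A mA.
have mXA : measurable (X j @^-1` A).
  by rewrite -[_ @^-1` _]setTI; exact: (measurable_RV X j measurableT mA).
transitivity (\int[P]_w (\1_(X j @^-1` A) w)%:E)%E.
  by apply: eq_integral => w _; rewrite mul1r.
rewrite integral_indic// setIT; transitivity (Ld^-1%:E * lam (A `&` K))%E.
  exact: prob_uniform.
have mAK : measurable (A `&` K) by exact: measurableI.
transitivity (Ld^-1%:E * \int[lam]_x (\1_(A `&` K) x)%:E)%E.
  by rewrite integral_indic// setIT.
rewrite -ge0_integralZl_EFin//.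
- apply: eq_integral => x _; rewrite -EFinM; congr EFin.
  by rewrite indicI mulrAC mulrA.
- by apply/measurable_EFinP; exact: measurable_indic.
- by rewrite invr_ge0 ltW.
Qed.

(** Multiply by 1 - u: exp u (1 - u) <= 1, while
    (1 + u + 2 u^2)(1 - u) = 1 + u^2 (1 - 2u). *)
Lemma exp_quadratic (u : R) : `|u| <= 2^-1 -> expR u <= 1 + u + 2 * u ^+ 2.
Proof.
rewrite ler_norml => /andP[u1 u2].
have h := expR_ge1Dx (- u); have E0 := expR_gt0 u.
rewrite expRN in h.
have h2 := ler_wpM2l (ltW E0) h; rewrite mulfV ?gt_eqF// in h2.
have p : 0 < 1 + - u by lra.
rewrite -(ler_pM2r p) (le_trans h2)//.
have := mulr_ge0 (sqr_ge0 u) (_ : 0 <= 1 - 2 * u).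
move=> /(_ ltac:(lra)); rewrite expr2; nra.
Qed.

Section mgf.
Context (y : Rvec R d -> R) (b v l : R).
Hypotheses (my : measurable_fun setT y) (yb : forall x, `|y x| <= b)
  (y0 : avg y = 0) (yv : avg (fun x => y x ^+ 2) <= v)
  (l0 : 0 <= l) (lb : l * b <= 2^-1).

(** In the quadratic bound of the exponential the linear term has mean 0, and the
    second moment is at most v. *)
Lemma mgf_bound j : (\int[P]_w (expR (l * y (X j w)))%:E <= (expR (2 * l ^+ 2 * v))%:E)%E.
Proof.
have mK := @measurable_cube R d L.
have me : measurable_fun setT (fun x => expR (l * y x)).
  apply: (measurableT_comp (continuous_measurable_fun (@continuous_expR R))).
  by apply: measurable_funM => //; exact: measurable_cst.
have b0 : 0 <= b by apply: le_trans (yb [tuple 0 | i < d]).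
have i1 := integrable_bounded my yb.
have my2 : measurable_fun setT (fun x => y x ^+ 2) by exact: measurable_funX.
have i2 : lam.-integrable K (EFin \o (fun x => y x ^+ 2)).
  apply: (@integrable_bounded _ (b ^+ 2)) => // x.
  by rewrite normrX lerXn2r ?nnegrE.
have ie : lam.-integrable K (EFin \o (fun x => expR (l * y x))).
  apply: (@integrable_bounded _ (expR (l * b))) => // x.
  rewrite ger0_norm ?expR_ge0// ler_expR ler_wpM2l//.
  by rewrite (le_trans (ler_norm _)).
rewrite (@expectation_uniform j (fun x => expR (l * y x)))//.
have -> : (\int[lam]_x (Ld^-1 * \1_K x * expR (l * y x))%:E =
    (avg (fun x => expR (l * y x)))%:E)%E.
  rewrite /avg /Rintegral EFinM fineK; last exact: integrable_fin_num.
  rewrite integral_mkcond -ge0_integralZl_EFin//.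
  - apply: eq_integral => x _; rewrite patchE indicE.
    by case: ifPn => _; rewrite ?mulr1// mulr0 mul0r mule0.
  - by move=> x _; rewrite patchE; case: ifPn => // _; rewrite lee_fin expR_ge0.
  - rewrite restrict_EFin; apply/measurable_EFinP.
    apply/(measurable_restrictT (fun x => expR (l * y x)) mK); exact: measurable_funTS.
  - by rewrite invr_ge0 ltW.
rewrite lee_fin.
apply: (@le_trans _ _ (1 + 2 * l ^+ 2 * v)); last exact: expR_ge1Dx.
apply: (@le_trans _ _ (avg (fun x => 1 + l * y x + 2 * l ^+ 2 * y x ^+ 2))).
  apply: le_avg => //.
    apply: (@integrable_bounded _ (1 + l * b + 2 * l ^+ 2 * b ^+ 2)).
      apply: measurable_funD.
        by apply: measurable_funD; [exact: measurable_cst|apply: measurable_funM => //; exact: measurable_cst].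
      by apply: measurable_funM => //; exact: measurable_cst.
    move=> x; rewrite (le_trans (ler_normD _ _))// lerD//.
      rewrite (le_trans (ler_normD _ _))// normr1 lerD2l normrM (ger0_norm l0).
      by rewrite ler_wpM2l.
    have c0 : 0 <= 2 * l ^+ 2 by rewrite mulr_ge0 ?sqr_ge0.
    rewrite ger0_norm; last by rewrite mulr_ge0 ?sqr_ge0.
    apply: ler_wpM2l => //.
    by rewrite -(real_normK (num_real (y x))) lerXn2r ?nnegrE.
  move=> x _; have hu : `|l * y x| <= 2^-1.
    by rewrite normrM (ger0_norm l0) (le_trans _ lb)// ler_wpM2l.
  rewrite (le_trans (exp_quadratic hu))// exprMn mulrA //.
have Il : lam.-integrable K (EFin \o (fun x => l * y x)) by exact: (integrableZl mK l i1).
have I2 : lam.-integrable K (EFin \o (fun x => 2 * l ^+ 2 * y x ^+ 2)).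
  exact: (integrableZl mK (2 * l ^+ 2) i2).
have Ic : lam.-integrable K (EFin \o (fun _ : Rvec R d => 1 : R)).
  by apply: (@integrable_bounded _ 1) => // x; rewrite normr1.
rewrite (avgD (u := fun x => 1 + l * y x) (integrableD mK Ic Il) I2).
rewrite (avgD (u := fun=> 1) Ic Il) avg_cst (avgZ l i1) y0 mulr0 addr0 lerD2l.
by rewrite (avgZ (2 * l ^+ 2) i2) ler_wpM2l// mulr_ge0 ?sqr_ge0.
Qed.

(** The exponential Markov inequality; by independence the expectation of the
    exponential of the sum is a product. *)
Lemma chernoff_upper (r : nat) (t : R) :
  (P [set w | (t <= \sum_(j < r) y (X j w))%R] <=
   (expR (- (l * t) + r%:R * (2 * l ^+ 2 * v)))%:E)%E.
Proof.
have me : measurable_fun setT (fun x => expR (l * y x)).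
  apply: (measurableT_comp (continuous_measurable_fun (@continuous_expR R))).
  by apply: measurable_funM => //; exact: measurable_cst.
have mS : measurable_fun setT (fun w => \sum_(j < r) y (X j w)).
  by apply: measurable_sum => j; exact: (measurableT_comp my (measurable_RV X j)).
have mE : measurable [set w | (t <= \sum_(j < r) y (X j w))%R].
  exact: measurable_ge.
set S := [set w | _] in mE *.
have -> : P S = (\int[P]_w (\1_S w)%:E)%E by rewrite integral_indic// setIT.
apply: (@le_trans _ _ (\int[P]_w ((expR (- (l * t)))%:E *
    (\prod_(j < r) expR (l * y (X j w)))%:E))%E).
  have mp : measurable_fun setT (fun w => \prod_(j < r) expR (l * y (X j w))).
    by apply: measurable_prod => j _; exact: (measurableT_comp me (measurable_RV X j)).
  apply: ge0_le_integral => //.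
  - by apply/measurable_EFinP; exact: measurable_indic.
  - apply/measurable_EFinP; apply: measurable_funM => //; exact: measurable_cst.
  - move=> w _; rewrite -EFinM lee_fin indicE -expR_sum -expRD.
    have [hw|hw] := boolP (w \in _); last exact: expR_ge0.
    move: hw; rewrite inE /= => hw.
    rewrite -expR0 ler_expR -big_distrr /= addrC subr_ge0 ler_wpM2l//.
rewrite ge0_integralZl_EFin//; last 2 first.
- by move=> w _; rewrite lee_fin prodr_ge0// => j _; exact: expR_ge0.
- apply/measurable_EFinP; apply: measurable_prod => j _; exact: (measurableT_comp me (measurable_RV X j)).
rewrite expRD EFinM lee_wpmul2l ?lee_fin ?expR_ge0//.
(* Independence is that of a whole sequence; the indicator fills the places from r
   on, which do not enter the product. *)
pose h j : Rvec R d -> R := if (j < r)%N then (fun x => expR (l * y x)) else \1_set0.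
have hE (j : 'I_r) : h j = (fun x => expR (l * y x)) by rewrite /h ltn_ord.
have -> : (\int[P]_w (\prod_(j < r) expR (l * y (X j w)))%:E =
    \int[P]_w (\prod_(j < r) h j (X j w))%:E)%E.
  by apply: eq_integral => w _; congr EFin; apply: eq_bigr => j _; rewrite hE.
rewrite (@expectation_prod_indep _ _ _ P _ _ X indX r r h
  (fun j => if (j < r)%N then expR (l * b) else 1)); first last.
- by move=> j rj; exists set0 => //; rewrite /h ltnNge rj.
- move=> j x; rewrite /h; case: (j < r)%N; last by rewrite indicE in_set0 /= lexx ler01.
  by rewrite expR_ge0 ler_expR ler_wpM2l// (le_trans (ler_norm _)).
- by move=> j; rewrite /h; case: (j < r)%N => //; exact: measurable_indic.
have -> : expR (r%:R * (2 * l ^+ 2 * v)) = \prod_(j < r) expR (2 * l ^+ 2 * v).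
  by rewrite prodr_const card_ord expRM_natl.
have : (0 <= \prod_(j < r) \int[P]_w (h j (X j w))%:E <= (\prod_(j < r) expR (2 * l ^+ 2 * v))%:E)%E.
  apply: (big_rec2 (fun (x : \bar R) (z : R) => (0 <= x <= z%:E)%E)).
    by rewrite lexx lee_fin ler01.
  move=> j z x _ /andP[x0 xz]; have mj := mgf_bound j.
  have j0 : (0 <= \int[P]_w (h j (X j w))%:E)%E.
    by apply: integral_ge0 => w _; rewrite lee_fin hE expR_ge0.
  rewrite mule_ge0//= EFinM lee_pmul//.
  by rewrite hE.
by case/andP.
Qed.
End mgf.
End prob.
End chernoff.

(** * Deviations of a difference of two energies *)

Section deviation.
Context (R : realType) (d : nat).
Local Notation lam := (leb R d).
Context (L : R) (L0 : 0 < L).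
Local Notation K := (cube L : set (Rvec R d)).
Local Notation Ld := (L ^+ d).
Let Ld0 : 0 < Ld. Proof. exact: exprn_gt0. Qed.
Context (dO : measure_display) (Omega : measurableType dO)
  (P : probability Omega R) (X : nat -> {RV P >-> Rvec R d}).
Hypothesis indX : mutually_independent X.
Hypothesis uniX : forall j, uniformly_distributed K (X j).

Definition dev (w : Rvec R d -> R) (r : nat) (o : Omega) : R :=
  \sum_(j < r) w (X j o) - r%:R * avg L w.

Lemma measurable_dev w r : measurable_fun setT w -> measurable_fun setT (dev w r).
Proof.
move=> mw; apply: measurable_funB; last exact: measurable_cst.
by apply: measurable_sum => j; exact: (measurableT_comp mw (measurable_RV X j)).
Qed.

(** The one-sided bound is applied to the centred function and to its opposite.
    Centring at most doubles the supremum and does not increase the mean square. *)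
Lemma dev_tail (w : Rvec R d -> R) (b v l t : R) (r : nat) :
  measurable_fun setT w -> (forall x, `|w x| <= b) -> avg L (fun x => w x ^+ 2) <= v ->
  0 <= l -> l * (2 * b) <= 2^-1 ->
  (P [set o | (t <= `|dev w r o|)%R] <=
    (2 * expR (- (l * t) + r%:R * (2 * l ^+ 2 * v)))%:E)%E.
Proof.
move=> mw wb wv l0 lb.
have mK := @measurable_cube R d L.
pose m := avg L w.
have iw := integrable_bounded L0 mw wb.
have b0 : 0 <= b by apply: le_trans (wb [tuple 0 | i < d]).
have mw2 : measurable_fun setT (fun x => w x ^+ 2) by exact: measurable_funX.
have iw2 : lam.-integrable K (EFin \o (fun x => w x ^+ 2)).
  apply: (@integrable_bounded _ _ _ L0 _ (b ^+ 2)) => // x.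
  by rewrite normrX lerXn2r ?nnegrE.
have ic c : lam.-integrable K (EFin \o (fun _ : Rvec R d => c : R)).
  by apply: (@integrable_bounded _ _ _ L0 _ `|c|) => //; exact: measurable_cst.
have mb : `|m| <= b by exact: normr_avg_le.
pose y x := w x - m.
have my : measurable_fun setT y by apply: measurable_funB => //; exact: measurable_cst.
have yb x : `|y x| <= 2 * b.
  by rewrite (le_trans (ler_normB _ _))// mulr_natl mulr2n lerD.
have y0 : avg L y = 0.
  by rewrite (avgB iw (ic m)) avg_cst// subrr.
have yv : avg L (fun x => y x ^+ 2) <= v.
  apply: le_trans wv.
  have -> : avg L (fun x => y x ^+ 2) = avg L (fun x => w x ^+ 2) - m ^+ 2.
    have -> : (fun x => y x ^+ 2) = (fun x => w x ^+ 2 - (2 * m * w x - m ^+ 2)).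
      by apply/funext => x; rewrite /y; ring.
    have i1 : lam.-integrable K (EFin \o (fun x => 2 * m * w x)) by exact: (integrableZl mK _ iw).
    rewrite (avgB iw2 (integrableB mK i1 (ic _))) (avgB i1 (ic _)) avg_cst// avgZ// -/m; ring.
  by rewrite gerBl sqr_ge0.
have y0N : avg L (fun x => - y x) = 0.
  rewrite (_ : (fun x => - y x) = (fun x => -1 * y x)); last by apply/funext => x; rewrite mulN1r.
  by rewrite (avgZ _ (integrable_bounded L0 my yb)) y0 mulr0.
have yvN : avg L (fun x => (- y x) ^+ 2) <= v.
  by rewrite /avg; under eq_Rintegral => x _ do rewrite sqrrN.
have myN : measurable_fun setT (fun x => - y x) by exact: measurableT_comp.
have h1 := chernoff_upper L0 indX uniX my yb y0 yv l0 lb r t.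
have h2 := @chernoff_upper _ _ _ L0 _ _ _ _ indX uniX (fun x => - y x) _ _ _ myN
  (fun x => (_ : `|- y x| <= 2 * b)) y0N yvN l0 lb r t.
have {}h2 := h2 (fun x => ltac:(rewrite normrN; exact: yb)).
have devE o : dev w r o = \sum_(j < r) y (X j o).
  by rewrite /dev /y sumrB sumr_const card_ord mulr_natl.
have devNE o : - dev w r o = \sum_(j < r) - y (X j o).
  by rewrite devE sumrN.
have mA : measurable [set o | (t <= \sum_(j < r) y (X j o))%R].
  by apply: measurable_ge; apply: measurable_sum => j; exact: (measurableT_comp my (measurable_RV X j)).
have mB : measurable [set o | (t <= \sum_(j < r) - y (X j o))%R].
  by apply: measurable_ge; apply: measurable_sum => j; exact: (measurableT_comp myN (measurable_RV X j)).
rewrite mulr_natl mulr2n EFinD.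
apply: (le_trans _ (leeD h1 h2)).
apply: (le_trans _ (measureU2 P mA mB)).
apply: le_measure; rewrite ?inE.
- by apply: measurable_ge; apply: measurableT_comp => //; exact: measurable_dev.
- exact: measurableU.
move=> o /=; rewrite -devE -devNE.
by case: (ler0P (dev w r o)) => h ht; [right|left].
Qed.

(** Cut off to the cube, since two functions with the same code are close only
    there. *)
Definition energy_diff (f g : Rvec R d -> R[i]) x : R :=
  \1_K x * (cabs (f x) ^+ 2 - cabs (g x) ^+ 2).

Lemma energy_le1 f : unit_band f -> \int[lam]_(x in K) cabs (f x) ^+ 2 <= 1.
Proof.
move=> [sf f1 _]; apply: le_trans f1.
by apply: Rintegral_sqr_cabs_le => //; exact: measurable_cube.
Qed.

Lemma measurable_energy_diff f g : unit_band f -> unit_band g -> measurable_fun setT (energy_diff f g).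
Proof.
move=> [[mf _] _ _] [[mg _] _ _].
apply: measurable_funM; first by apply: measurable_indic; exact: measurable_cube.
by apply: measurable_funB; apply: measurable_funX; exact: measurable_cabs.
Qed.

Lemma avg_energy_diff f g : unit_band f -> unit_band g ->
  avg L (energy_diff f g) = avg L (fun x => cabs (f x) ^+ 2) - avg L (fun x => cabs (g x) ^+ 2).
Proof.
move=> uf ug; have mK := @measurable_cube R d L.
have [[_ sf] _ _] := uf; have [[_ sg] _ _] := ug.
rewrite -avgB; [|exact: (integrableS measurableT mK (@subsetT _ _) sf)|
  exact: (integrableS measurableT mK (@subsetT _ _) sg)].
rewrite /avg; congr (_ * _); apply: eq_Rintegral => x xK.
by rewrite /energy_diff indicE xK mul1r.
Qed.

(** Both bounds factor the difference of squares. The second one keeps the two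
    energies, whose integrals over the cube are at most 1: this is the origin of the
    factor 1 / L^d in the variance. *)
Lemma energy_diff_bound f g (e : R) x : unit_band f -> unit_band g ->
  (forall x, K x -> cabs (f x - g x) <= e) -> 0 <= e ->
  `|energy_diff f g x| <= 2 * e /\
  energy_diff f g x ^+ 2 <= 2 * e ^+ 2 * (\1_K x * (cabs (f x) ^+ 2 + cabs (g x) ^+ 2)).
Proof.
move=> uf ug fg e0.
have f1 := cabs_unit_band x uf; have g1 := cabs_unit_band x ug.
rewrite /energy_diff; have [hx|hx] := pselect (K x); last first.
  by rewrite indicE memNset// !mul0r normr0 expr0n/= mulr0; split => //; rewrite mulr_ge0.
rewrite indicE mem_set// !mul1r.
have hab := le_trans (ler_dist_cabs (f x) (g x)) (fg x hx).
move: f1 g1 hab (cabs_ge0 (f x)) (cabs_ge0 (g x)).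
move: (cabs (f x)) (cabs (g x)) => a b a1 b1 hab a0 b0.
rewrite subr_sqr; split.
  rewrite normrM mulrC (ger0_norm (addr_ge0 a0 b0)) ler_pM ?addr_ge0//; lra.
rewrite exprMn -(real_normK (num_real (a - b))).
have s1 : `|a - b| ^+ 2 <= e ^+ 2 by rewrite lerXn2r ?nnegrE.
have s2 : (a + b) ^+ 2 <= 2 * (a ^+ 2 + b ^+ 2) by have := sqr_ge0 (a - b); nra.
by rewrite [leRHS](_ : _ = e ^+ 2 * (2 * (a ^+ 2 + b ^+ 2))); [rewrite ler_pM ?sqr_ge0|ring].
Qed.

(** The tail bound with parameter kap * mu. By the factor 1 / L^d in the variance,
    both terms of the exponent are multiples of r mu^2 / L^d. *)
Lemma pair_dev f g (e kap tau mu : R) (r : nat) : unit_band f -> unit_band g ->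
  (forall x, K x -> cabs (f x - g x) <= e) -> 0 <= e -> 0 <= kap -> 8 * e * kap <= 1 ->
  0 < mu < 1 ->
  (P [set o | (tau * (mu * (r%:R / Ld)) <= `|dev (energy_diff f g) r o|)%R] <=
    (2 * expR (- (r%:R / Ld * mu ^+ 2 * (kap * tau - 8 * kap ^+ 2 * e ^+ 2))))%:E)%E.
Proof.
move=> uf ug fg e0 k0 ek /andP[mu0 mu1].
have mK := @measurable_cube R d L.
have mw := measurable_energy_diff uf ug.
have wb x : `|energy_diff f g x| <= 2 * e by case: (energy_diff_bound x uf ug fg e0).
have iw2 : lam.-integrable K (EFin \o (fun x => energy_diff f g x ^+ 2)).
  apply: (@integrable_bounded _ _ _ L0 _ ((2 * e) ^+ 2)) => [|x].
    exact: measurable_funX.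
  by rewrite normrX lerXn2r ?nnegrE ?mulr_ge0.
have [[_ sf] _ _] := uf; have [[_ sg] _ _] := ug.
have if_ := integrableS measurableT mK (@subsetT _ _) sf.
have ig := integrableS measurableT mK (@subsetT _ _) sg.
have wv : avg L (fun x => energy_diff f g x ^+ 2) <= 4 * e ^+ 2 / Ld.
  rewrite /avg mulrC ler_pM2r ?invr_gt0//.
  apply: (@le_trans _ _ (\int[lam]_(x in K) (2 * e ^+ 2 * (cabs (f x) ^+ 2 + cabs (g x) ^+ 2)))).
    apply: le_Rintegral => //.
      exact: (integrableZl mK _ (integrableD mK if_ ig)).
    move=> x hx; case: (energy_diff_bound x uf ug fg e0) => _.
    by rewrite indicE mem_set// mul1r.
  rewrite RintegralZl//; last exact: (integrableD mK if_ ig).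
  rewrite RintegralD//.
  have := energy_le1 uf; have := energy_le1 ug.
  set a := \int[lam]_(x in K) _; set b := \int[lam]_(x in K) _ => a1 b1.
  have e2 := sqr_ge0 e; nra.
have l0 : 0 <= kap * mu by rewrite mulr_ge0// ltW.
have lb : kap * mu * (2 * (2 * e)) <= 2^-1.
  have : kap * mu * (4 * e) <= kap * (4 * e).
    by rewrite ler_wpM2r ?mulr_ge0// ler_piMr// ltW.
  have -> : kap * (4 * e) = 2^-1 * (8 * e * kap) by field.
  lra.
have := @dev_tail (energy_diff f g) (2 * e) _ _ (tau * (mu * (r%:R / Ld))) r mw wb wv l0 lb.
congr (_ <= _)%E; congr (_ * expR _)%:E.
by field; rewrite gt_eqF.
Qed.

End deviation.

(** * Chaining over the unit ball *)

Lemma pow_quarter_small (R : realType) (c e : R) : 0 <= c -> 0 < e ->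
  exists n : nat, c * 4^-1 ^+ n.+1 <= e.
Proof.
move=> c0 e0; exists (Num.trunc (c / e)).
have x0 : 0 <= c / e by rewrite divr_ge0// ltW.
have /andP[_ h] := truncn_itv x0; move: h; set n := Num.trunc _ => h.
rewrite exprVn ler_pdivrMr ?exprn_gt0//.
have h4 : n.+1%:R <= (4 : R) ^+ n.+1 by rewrite -natrX ler_nat ltnW// ltn_expl.
apply: (@le_trans _ _ (e * n.+1%:R)); last by apply: ler_wpM2l => //; exact: ltW.
by rewrite [leRHS]mulrC -ler_pdivrMr//; exact: ltW.
Qed.

Section chaining.
Context (R : realType) (d : nat).
Local Notation lam := (leb R d).
Context (L : R) (L0 : 0 < L).
Local Notation K := (cube L : set (Rvec R d)).
Local Notation Ld := (L ^+ d).
Let Ld0 : 0 < Ld. Proof. exact: exprn_gt0. Qed.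

Definition netT (k : nat) : finType := @codeT R d L (taylor_order d k) (quant_levels d k).
Definition netcode k (f : Rvec R d -> R[i]) : netT k := quantcode L (taylor_order d k) (quant_levels d k) f.

(** The chain starts from the single function 0; above level 0 there is one function
    for each code that occurs. *)
Definition net k (t : netT k) : Rvec R d -> R[i] :=
  if k == 0%N then (fun=> 0) else
  xget (fun=> 0) [set f | unit_band f /\ netcode k f = t].

Lemma net_unit k (t : netT k) : unit_band (net t).
Proof.
rewrite /net; case: (k == 0%N); first exact: unit_band0.
case: xgetP => [f _ [uf _]|_]; [exact: uf|exact: unit_band0].
Qed.

Lemma net_close k f x : unit_band f -> K x ->
  cabs (f x - net (netcode k.+1 f) x) <= 4^-1 ^+ k.+1 / 2.
Proof.
move=> uf hx; rewrite /net /=.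
have [u1 u2] := xgetPex (fun=> 0) (ex_intro
  (fun h => [set f0 | unit_band f0 /\ netcode k.+1 f0 = netcode k.+1 f] h) f (conj uf erefl)).
exact: (code_close_level uf u1 (esym u2) hx).
Qed.

Lemma net_step k f x : unit_band f -> K x ->
  cabs (net (netcode k.+1 f) x - net (netcode k f) x) <= 4^-1 ^+ k.
Proof.
move=> uf hx; case: k => [|k].
  rewrite [net (netcode 0 f)]/net eqxx subr0 expr0.
  by apply: cabs_unit_band; exact: net_unit.
have h1 := net_close k.+1 uf hx; have h2 := net_close k uf hx.
set u := net _ x in h1 *; set v := net _ x in h2 *.
rewrite (_ : u - v = - (f x - u) + (f x - v)); last by ring.
rewrite (le_trans (cabsD _ _))// cabsN (le_trans (lerD h1 h2))//.
have : 0 <= (4^-1 : R) ^+ k.+1 by rewrite exprn_ge0.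
by rewrite [_ ^+ k.+2]exprS; lra.
Qed.

Context (dO : measure_display) (Omega : measurableType dO)
  (P : probability Omega R) (X : nat -> {RV P >-> Rvec R d}).
Hypothesis indX : mutually_independent X.
Hypothesis uniX : forall j, uniformly_distributed K (X j).

Lemma finite_union_bound (I : finType) (A : I -> set Omega) (c : R) :
  (forall i, measurable (A i)) -> (forall i, (P (A i) <= c%:E)%E) ->
  measurable (\big[setU/set0]_i A i) /\
  (P (\big[setU/set0]_i A i) <= (#|I|%:R * c)%:E)%E.
Proof.
move=> mA Ac.
suff gen s : measurable (\big[setU/set0]_(i <- s) A i) /\
    (P (\big[setU/set0]_(i <- s) A i) <= ((size s)%:R * c)%:E)%E.
  have := gen (index_enum I).
  by rewrite [size _](_ : _ = #|I|)// cardT enumT /index_enum.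
elim: s => [|i s [IH1 IH2]].
  by rewrite big_nil measure0 mul0r; split.
rewrite big_cons; split; first exact: measurableU.
apply: (le_trans (measureU2 P (mA i) IH1)).
by rewrite /= -natr1 mulrDl mul1r addrC EFinD leeD.
Qed.

Context (mu : R) (r : nat) (mu01 : 0 < mu < 1).
Let rate := r%:R / Ld * mu ^+ 2.
Let unit_t := mu * (r%:R / Ld).

(** Restricted to the pairs that can be consecutive approximations of the same
    function. *)
Definition bad_pair k (p : netT k * netT k.+1) : set Omega :=
  if pselect (forall x, K x -> cabs (net p.2 x - net p.1 x) <= 4^-1 ^+ k)
  then [set o | 2^-1 ^+ k.+1 * unit_t <= `|dev L X (energy_diff L (net p.2) (net p.1)) r o|]
  else set0.

Definition bad k : set Omega := \big[setU/set0]_(p : netT k * netT k.+1) bad_pair p.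

(** Here e = 4^-k, kap = 4^k / 32 and tau = 2^-(k+1), so the exponent is
    2^k / 64 - 1 / 128 times the rate. *)
Lemma bad_pairP k (p : netT k * netT k.+1) : measurable (bad_pair p) /\
  (P (bad_pair p) <= (2 * expR (- (rate * (2 ^+ k / 128))))%:E)%E.
Proof.
have /andP[mu0 mu1] := mu01.
rewrite /bad_pair; case: pselect => h; rewrite /=; last first.
  split => //; apply: (@le_trans _ _ 0%E); last by rewrite lee_fin mulr_ge0 ?expR_ge0.
  by rewrite (measure0 P).
have mw := measurable_energy_diff L (net_unit p.2) (net_unit p.1).
split.
  by apply: measurable_ge; apply: measurableT_comp => //; exact: measurable_dev.
have q0 : 0 <= (4^-1 : R) ^+ k by rewrite exprn_ge0.
have k0 : 0 <= (4 : R) ^+ k / 32 by rewrite divr_ge0// exprn_ge0.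
have qk : (4^-1 : R) ^+ k * 4 ^+ k = 1 by rewrite -exprMn mulVf// expr1n.
have ek : 8 * 4^-1 ^+ k * (4 ^+ k / 32) <= 1 :> R.
  by rewrite (_ : _ * _ = 8 / 32 * (4^-1 ^+ k * 4 ^+ k)); [rewrite qk; lra|ring].
apply: (le_trans (pair_dev L0 indX uniX (2^-1 ^+ k.+1) r (net_unit p.2) (net_unit p.1) h q0 k0 ek mu01)).
rewrite lee_fin ler_pM2l// ler_expR lerN2 -/rate ler_wpM2l//.
  by rewrite mulr_ge0 ?divr_ge0 ?sqr_ge0 ?(ltW Ld0).
have -> : 8 * (4 ^+ k / 32) ^+ 2 * 4^-1 ^+ k ^+ 2 = 128^-1 * (4^-1 ^+ k * 4 ^+ k) ^+ 2 :> R.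
  by field.
rewrite qk expr1n mulr1.
have -> : (4 : R) ^+ k / 32 * 2^-1 ^+ k.+1 = 2 ^+ k / 64.
  rewrite (_ : (4 : R) = 2 * 2); last by ring.
  rewrite exprMn exprS.
  have e : (2 : R) ^+ k * 2^-1 ^+ k = 1 by rewrite -exprMn mulfV// expr1n.
  move: e; move: (2 ^+ k) (2^-1 ^+ k) => a b e.
  by rewrite (_ : _ * _ = a / 64 * (a * b)); [rewrite e mulr1|field].
have : 1 <= (2 : R) ^+ k by rewrite exprn_ege1//; lra.
lra.
Qed.

Context (C : R) (C0 : 0 < C).
Hypothesis cardC : forall k, (#|netT k|%:R : R) <= expR (C * (L + 1) ^+ d * 2 ^+ k).
Hypothesis rateC : 900 * (3 * C * (L + 1) ^+ d + 1) <= rate.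

(** The number of pairs costs 3 C (L+1)^d 2^k in the exponent. What is left of
    rate 2^k / 128 pays for rate / 900 and for the factor 2^-(k+1) that makes the
    levels summable. *)
Lemma badP k : measurable (bad k) /\
  (P (bad k) <= (2 * expR (- (rate / 900)) / (2 ^ k.+1)%:R)%:E)%E.
Proof.
have [m1 m2] := finite_union_bound (fun p => (@bad_pairP k p).1) (fun p => (@bad_pairP k p).2).
split => //; apply: (le_trans m2); rewrite lee_fin card_prod natrM.
set H := C * (L + 1) ^+ d.
have H0 : 0 <= H by rewrite mulr_ge0 ?(ltW C0)// exprn_ge0// addr_ge0// ltW.
have rH : 900 * (3 * H + 1) <= rate by rewrite /H mulrA.
have h1 : #|netT k|%:R * #|netT k.+1|%:R <= expR (3 * H * 2 ^+ k).
  rewrite (_ : 3 * H * 2 ^+ k = H * 2 ^+ k + H * 2 ^+ k.+1); last by rewrite exprS; ring.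
  by rewrite expRD ler_pM.
have h2 : 0 <= 2 * expR (- (rate * (2 ^+ k / 128))) by rewrite mulr_ge0 ?expR_ge0.
apply: (le_trans (ler_wpM2r h2 h1)).
rewrite mulrCA -expRD -[leRHS]mulrA ler_pM2l//.
have k1 : k.+1%:R <= (2 : R) ^+ k.
  by rewrite -natrX ler_nat ltn_expl.
have e2 : (2 : R) <= expR 1 by have := expR_ge1Dx (1 : R).
have -> : expR (- (rate / 900)) / (2 ^ k.+1)%:R = expR (- (rate / 900)) * 2^-1 ^+ k.+1 :> R.
  by rewrite natrX exprVn.
apply: (@le_trans _ _ (expR (- (rate / 900)) * expR (- 1) ^+ k.+1)); last first.
  rewrite ler_pM2l ?expR_gt0// lerXn2r ?nnegrE ?expR_ge0//.
  by rewrite expRN lef_pV2 ?posrE ?expR_gt0.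
rewrite -expRM_natl -expRD ler_expR mulrN1 -natr1.
move: k1; rewrite -natr1; set q := (2 : R) ^+ k; move: (k%:R : R) (ler0n R k) => kk kk0 k1.
have q1 : 1 <= q by lra.
nra.
Qed.

(** Uniform samples are only almost surely in the cube, where functions with the
    same code are close. *)
Definition outside k : set Omega := X k @^-1` ~` K.

Lemma outsideP k : measurable (outside k) /\ P (outside k) = 0%E.
Proof.
have mK : measurable (~` K) by apply: measurableC; exact: measurable_cube.
split.
  by rewrite /outside -[_ @^-1` _]setTI; exact: (measurable_RV X k measurableT mK).
transitivity (Ld^-1%:E * lam (~` K `&` K))%E; first exact: prob_uniform.
by rewrite setICl measure0 mule0.
Qed.

Definition exceptional : set Omega := \bigcup_k (bad k `|` outside k).

Lemma exceptionalP : measurable exceptional /\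
  (P exceptional <= (2 * expR (- (rate / 900)))%:E)%E.
Proof.
have mF k : measurable (bad k `|` outside k).
  by apply: measurableU; [exact: (badP k).1|exact: (outsideP k).1].
have mE : measurable exceptional by exact: bigcup_measurable.
split => //.
have := measure_sigma_subadditive P mF mE (@subset_refl _ _).
move=> /le_trans; apply.
have c0 : 0 <= 2 * expR (- (rate / 900)) by rewrite mulr_ge0 ?expR_ge0.
apply: (le_trans _ (epsilon_trick0 xpredT c0)).
apply: lee_nneseries => // k _.
have [mb Pb] := badP k; have [mo Po] := outsideP k.
have h := measureU2 P mb mo.
apply: (le_trans h); rewrite -[leRHS]adde0; apply: leeD; first exact: Pb.
by rewrite -Po.
Qed.

(** The functional D of the opening comment. *)
Definition discrepancy (f : Rvec R d -> R[i]) (o : Omega) : R :=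
  \sum_(j < r) cabs (f (X j o)) ^+ 2 - r%:R * avg L (fun x => cabs (f x) ^+ 2).

Lemma dev_energy_diffE f g o : unit_band f -> unit_band g -> (forall j, K (X j o)) ->
  dev L X (energy_diff L f g) r o = discrepancy f o - discrepancy g o.
Proof.
move=> uf ug hK; rewrite /dev avg_energy_diff// /discrepancy.
have -> : \sum_(j < r) energy_diff L f g (X j o) =
    \sum_(j < r) cabs (f (X j o)) ^+ 2 - \sum_(j < r) cabs (g (X j o)) ^+ 2.
  by rewrite -sumrB; apply: eq_bigr => j _; rewrite /energy_diff indicE mem_set// mul1r.
by ring.
Qed.

(** The increments along the chain add up to at most the sum of the
    2^-(k+1) mu r / L^d, and the values of D at the approximations converge to D(f). *)
Lemma chaining f o : unit_band f -> ~ exceptional o -> `|discrepancy f o| <= unit_t.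
Proof.
move=> uf hE; have /andP[mu0 mu1] := mu01.
have t0 : 0 <= unit_t by rewrite mulr_ge0 ?(ltW mu0)// divr_ge0// ltW.
have hK j : K (X j o).
  by apply: contrapT => h; apply: hE; exists j => //; right.
have hB k : `|discrepancy (net (netcode k.+1 f)) o - discrepancy (net (netcode k f)) o| <= 2^-1 ^+ k.+1 * unit_t.
  rewrite -dev_energy_diffE//; [|exact: net_unit|exact: net_unit].
  rewrite leNgt; apply/negP => h; apply: hE; exists k => //; left.
  rewrite /bad (bigD1 (netcode k f, netcode k.+1 f))//=; left.
  rewrite /bad_pair; case: pselect => [h1|nc]; first exact: ltW.
  by exfalso; apply: nc => x hx /=; exact: net_step.
have Q0 : discrepancy (net (netcode 0 f)) o = 0.
  rewrite /discrepancy /net eqxx.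
  have -> : (fun x : Rvec R d => cabs (0 : R[i]) ^+ 2) = (fun=> 0).
    by apply/funext => x; rewrite cabs0 expr0n.
  rewrite avg_cst// mulr0 subr0 big1// => j _.
  by rewrite cabs0 expr0n.
have Qn n : `|discrepancy (net (netcode n f)) o| <= (1 - 2^-1 ^+ n) * unit_t.
  elim: n => [|n IH]; first by rewrite Q0 normr0 expr0 subrr mul0r.
  rewrite -[discrepancy _ _](subrK (discrepancy (net (netcode n f)) o)).
  rewrite (le_trans (ler_normD _ _))// (le_trans (lerD (hB n) IH))//.
  by rewrite exprS; lra.
have close n : `|discrepancy f o - discrepancy (net (netcode n.+1 f)) o| <= 2 * r%:R * 4^-1 ^+ n.+1.
  have ug := net_unit (netcode n.+1 f).
  rewrite -dev_energy_diffE// /dev.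
  have q0 : 0 <= (4^-1 : R) ^+ n.+1 / 2 by rewrite divr_ge0// exprn_ge0.
  have wb x : `|energy_diff L f (net (netcode n.+1 f)) x| <= 4^-1 ^+ n.+1.
    have [h _] := energy_diff_bound x uf ug (fun x hx => net_close n uf hx) q0.
    by rewrite (le_trans h)// mulrC divfK.
  have mw := measurable_energy_diff L uf ug.
  apply: (le_trans (ler_normB _ _)).
  have s1 : `|\sum_(j < r) energy_diff L f (net (netcode n.+1 f)) (X j o)| <= 4^-1 ^+ n.+1 * r%:R.
    rewrite (le_trans (ler_norm_sum _ _ _))//.
    apply: (@le_trans _ _ (\sum_(j < r) (4^-1 : R) ^+ n.+1)); first exact: ler_sum.
    by rewrite sumr_const card_ord mulr_natr.
  have s2 : `|r%:R * avg L (energy_diff L f (net (netcode n.+1 f)))| <= 4^-1 ^+ n.+1 * r%:R.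
    by rewrite normrM normr_nat mulrC ler_wpM2r//; exact: normr_avg_le.
  by rewrite (le_trans (lerD s1 s2))//; lra.
apply/ler_addgt0Pr => e e0.
have [n hn] := pow_quarter_small (mulr_ge0 (ler0n R 2) (ler0n R r)) e0.
have := lerD (close n) (Qn n.+1).
have q0 : 0 <= (2^-1 : R) ^+ n.+1 * unit_t by rewrite mulr_ge0// exprn_ge0.
have := ler_normD (discrepancy f o - discrepancy (net (netcode n.+1 f)) o) (discrepancy (net (netcode n.+1 f)) o).
rewrite subrK mulrBl mul1r; lra.
Qed.

End chaining.

(** * Normalized functions and measurability of the sampling event *)

Section normalization.
Context (R : realType) (d : nat).
Local Notation lam := (leb R d).
Implicit Types f : Rvec R d -> R[i].

Definition energy f : R := \int[lam]_x cabs (f x) ^+ 2.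

Lemma L2norm_energy f : inL2 f -> (L2norm f ^+ 2 = (energy f)%:E)%E.
Proof.
move=> /inL2_sqint[_ i2]; rewrite L2norm_sqr /energy /Rintegral fineK//.
exact: integrable_fin_num.
Qed.

Lemma energy_ge0 f : 0 <= energy f.
Proof. by apply: Rintegral_ge0 => x _; exact: sqr_ge0. Qed.

Lemma cube_energyE (L : R) f : inL2 f ->
  cube_energy L f = (\int[lam]_(x in cube L) cabs (f x) ^+ 2)%:E.
Proof.
move=> /inL2_sqint[_ i2]; rewrite /cube_energy /Rintegral fineK//.
have mK := @measurable_cube R d L.
exact: (integrable_fin_num mK (integrableS measurableT mK (@subsetT _ _) i2)).
Qed.

Definition normalize f : Rvec R d -> R[i] :=
  fun x => ((Num.sqrt (energy f))^-1)%:C%C * f x.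

Lemma sqr_cabs_normalize f x : cabs (normalize f x) ^+ 2 = (energy f)^-1 * cabs (f x) ^+ 2.
Proof.
by rewrite cabsM exprMn cabs_realE real_normK ?num_real// exprVn sqr_sqrtr// energy_ge0.
Qed.

Lemma normalize_unit_band f : bandlimited f -> 0 < energy f -> unit_band (normalize f).
Proof.
move=> bf f0; apply: bandlimited_unit_band => //.
by rewrite -/(energy f) exprVn sqr_sqrtr ?energy_ge0// mulVf// gt_eqF.
Qed.

(** All multiples of f are in the unit ball, hence bounded by 1. *)
Lemma bandlimited_energy0 f x : bandlimited f -> energy f = 0 -> f x = 0.
Proof.
move=> bf f0; apply: contrapT => /eqP fx0.
have c0 : 0 < cabs (f x).
  by rewrite lt_neqAle cabs_ge0 andbT eq_sym; apply: contra fx0 => /eqP /cabs0_eq0 ->.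
have k0 : 0 <= 2 / cabs (f x) by rewrite divr_ge0.
have u : unit_band (fun x0 => (2 / cabs (f x))%:C%C * f x0).
  by apply: bandlimited_unit_band => //; rewrite -/(energy f) f0 mulr0.
have := cabs_unit_band x u.
by rewrite cabsM cabs_realE ger0_norm// divfK ?gt_eqF//; lra.
Qed.

End normalization.

Section sampling.
Context (R : realType) (d : nat) (L delta mu : R) (r : nat).
Local Notation lam := (leb R d).
Local Notation Ld := (L ^+ d).
Let lo := r%:R / Ld * (1 - delta - mu).
Let hi := r%:R / Ld * (1 + mu).

Definition unit_members : set (Rvec R d -> R[i]) :=
  [set u | exists f, [/\ Btilde L delta f, 0 < energy f & u = normalize f]].

Definition sample_energy (u : Rvec R d -> R[i]) (x : nat -> Rvec R d) : R :=
  \sum_(j < r) cabs (u (x j)) ^+ 2.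

Lemma sampling_inequality_normalize (f : Rvec R d -> R[i]) x : Btilde L delta f -> 0 < energy f ->
  sampling_inequality L delta mu r x f <->
  lo <= sample_energy (normalize f) x <= hi.
Proof.
move=> [[_ iLf _] _] f0; rewrite /sampling_inequality L2norm_energy// -!EFinM !lee_fin.
have -> : sample_energy (normalize f) x =
    (\sum_(j < r) cabs (f (x j)) ^+ 2) / energy f.
  rewrite mulrC mulr_sumr; apply: eq_bigr => j _; exact: sqr_cabs_normalize.
by rewrite ler_pdivlMr// ler_pdivrMr.
Qed.

Lemma sampling_inequality0 (f : Rvec R d -> R[i]) x : bandlimited f -> energy f = 0 ->
  sampling_inequality L delta mu r x f.
Proof.
move=> bf f0; have [_ iLf _] := bf.
rewrite /sampling_inequality L2norm_energy// f0 !mule0.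
rewrite big1 ?lexx// => j _.
by rewrite (bandlimited_energy0 _ bf f0) cabs0 expr0n.
Qed.

Lemma unit_member_unit_band u : unit_members u -> unit_band u.
Proof. by move=> [f [[bf _] f0 ->]]; exact: normalize_unit_band. Qed.

(** The condition of Btilde is homogeneous. *)
Lemma unit_member_concentrated u : unit_members u ->
  1 - delta <= \int[lam]_(x in cube L) cabs (u x) ^+ 2.
Proof.
move=> [f [[bf fd] f0 ->]]; have [_ iLf _] := bf.
move: fd; rewrite cube_energyE// L2norm_energy// -EFinM lee_fin.
under [X in _ -> is_true (_ <= X)]eq_Rintegral => x _ do rewrite sqr_cabs_normalize.
have [_ i2] := inL2_sqint iLf.
have mK := @measurable_cube R d L.
rewrite RintegralZl//; last exact: integrableS i2.
by rewrite mulrC ler_pdivlMl// mulrC.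
Qed.

Context (dO : measure_display) (Omega : measurableType dO)
  (P : probability Omega R) (X : nat -> {RV P >-> Rvec R d}).

Lemma sampling_eventE : sampling_event L delta mu r X =
  [set o | forall u, unit_members u -> lo <= sample_energy u (fun j => X j o) <= hi].
Proof.
apply/seteqP; split => o /= h.
  move=> u [f [fB f0 ->]].
  exact: (sampling_inequality_normalize _ fB f0).1 (h f fB).
move=> f fB; have := energy_ge0 f; rewrite le_eqVlt => /predU1P[f0|f0].
  by apply: sampling_inequality0 => //; exact: fB.1.
apply/(sampling_inequality_normalize _ fB f0); apply: h.
by exists f.
Qed.

(** The value is 0 for a code that does not occur; sampling_event_countable discards
    such codes. *)
Definition representative (M k : nat) (t : codeT d M.+1%:R (taylor_order d k) (quant_levels d k)) :=
  xget (fun=> 0) [set u | unit_members u /\ quantcode M.+1%:R (taylor_order d k) (quant_levels d k) u = t].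

Lemma measurable_sample_energy u : unit_band u ->
  measurable_fun setT (fun o => sample_energy u (fun j => X j o)).
Proof.
move=> [[cu _] _ _]; apply: measurable_sum => j.
apply: measurable_funX.
apply: (measurableT_comp (measurable_cabs cu)); exact: measurable_RV.
Qed.

Lemma representative_close M k u x : unit_members u -> cube M.+1%:R x ->
  cabs (u x - representative (quantcode M.+1%:R (taylor_order d k) (quant_levels d k) u) x) <= 4^-1 ^+ k.
Proof.
move=> um hx.
have [u1 u2] := xgetPex (fun=> 0) (ex_intro (fun h => [set v | unit_members v /\
  quantcode M.+1%:R (taylor_order d k) (quant_levels d k) v =
  quantcode M.+1%:R (taylor_order d k) (quant_levels d k) u] h) u (conj um erefl)).
have := code_close_level (unit_member_unit_band um) (unit_member_unit_band u1) (esym u2) hx.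
move=> /le_trans; apply.
have : 0 <= (4^-1 : R) ^+ k by rewrite exprn_ge0.
lra.
Qed.

Lemma representativeP M k u : unit_members u ->
  unit_members (representative (quantcode M.+1%:R (taylor_order d k) (quant_levels d k) u)).
Proof.
move=> um.
by have [] := xgetPex (fun=> 0) (ex_intro (fun h => [set v | unit_members v /\
  quantcode M.+1%:R (taylor_order d k) (quant_levels d k) v =
  quantcode M.+1%:R (taylor_order d k) (quant_levels d k) u] h) u (conj um erefl)).
Qed.

Lemma sample_energy_close u v (x : nat -> Rvec R d) e : unit_band u -> unit_band v ->
  (forall j, (j < r)%N -> cabs (u (x j) - v (x j)) <= e) ->
  `|sample_energy u x - sample_energy v x| <= 2 * r%:R * e.
Proof.
move=> uu uv uve; rewrite /sample_energy -sumrB.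
apply: (le_trans (ler_norm_sum _ _ _)).
have -> : 2 * r%:R * e = \sum_(j < r) (2 * e).
  by rewrite sumr_const card_ord -mulr_natr; ring.
apply: ler_sum => j _.
have := le_trans (ler_dist_cabs _ _) (uve j (ltn_ord j)).
have := cabs_unit_band (x j) uu; have := cabs_unit_band (x j) uv.
have := cabs_ge0 (u (x j)); have := cabs_ge0 (v (x j)).
move: (cabs (u (x j))) (cabs (v (x j))) => a b b0 a0 b1 a1 h.
rewrite subr_sqr normrM mulrC ler_pM// ger0_norm; lra.
Qed.

(** The samples may lie outside the cube of side L on a null set of outcomes, and
    the measurability of the event concerns these outcomes too. *)
Lemma samples_in_cube (x : nat -> Rvec R d) :
  exists M : nat, forall j, (j < r)%N -> cube M.+1%:R (x j).
Proof.
pose s : R := \sum_(j < r) \sum_(i < d) 2 * `|tnth (x j) i : R|.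
have s0 : 0 <= s by apply: sumr_ge0 => j _; apply: sumr_ge0 => i _; rewrite mulr_ge0.
exists (Num.trunc s) => j jr i; have /andP[_ /ltW h] := truncn_itv s0.
have h1 : 2 * `|tnth (x j) i : R| <= s.
  rewrite /s (bigD1 (Ordinal jr))//= (bigD1 i)//= -addrA lerDl addr_ge0//.
    by apply: sumr_ge0 => k _; rewrite mulr_ge0.
  by apply: sumr_ge0 => k _; apply: sumr_ge0 => l _; rewrite mulr_ge0.
by rewrite -ler_norml ler_pdivlMr// mulrC (le_trans h1).
Qed.

(** Finitely many samples lie in some cube of side M + 1, and there the
    representatives of high level approximate every normalized member. *)
Lemma sampling_event_countable : sampling_event L delta mu r X =
  \bigcap_M \bigcap_k \bigcap_(t in @setT (codeT d M.+1%:R (taylor_order d k) (quant_levels d k)))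
    [set o | unit_members (representative t) ->
       lo <= sample_energy (representative t) (fun j => X j o) <= hi].
Proof.
rewrite sampling_eventE; apply/seteqP; split => o /= h.
  by move=> M _ k _ t _; exact: h.
move=> u um; pose x j : Rvec R d := X j o.
have [M hM] := samples_in_cube x.
have close e : 0 < e -> lo - e <= sample_energy u x <= hi + e.
  move=> e0.
  have [n hn] := pow_quarter_small (mulr_ge0 (ler0n R 2) (ler0n R r)) e0.
  have mv := @representativeP M n.+1 u um.
  have := @sample_energy_close _ _ x _ (unit_member_unit_band um) (unit_member_unit_band mv)
    (fun j jr => representative_close n.+1 um (hM j jr)).
  have := h M I n.+1 I _ I mv.
  rewrite -/x; move: (sample_energy _ x) (sample_energy _ x) => a b.
  by rewrite ler_norml; lra.
apply/andP; split; apply/ler_addgt0Pr => e /close/andP[]; lra.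
Qed.

Lemma measurable_sampling_event : measurable (sampling_event L delta mu r X).
Proof.
rewrite sampling_event_countable.
apply: bigcapT_measurable => M; apply: bigcapT_measurable => k.
apply: fin_bigcap_measurable => // t _.
have [ut|nt] := pselect (unit_members (representative t)); last first.
  rewrite (_ : [set o | _] = setT)//; apply/seteqP; split => o //= _.
have mS := measurable_sample_energy (unit_member_unit_band ut).
rewrite (_ : [set o | _] =
  (fun o => sample_energy (representative t) (fun j => X j o)) @^-1` `[lo, hi]).
  by rewrite -[X in measurable X]setTI; apply: mS => //; exact: measurable_itv.
by apply/seteqP; split => o /=; rewrite in_itv/=; [apply|move=> h _].
Qed.

End sampling.

(** * The sampling inequality *)

Section sampling_probability.
Context (R : realType) (d : nat).

Lemma sampling_off_exceptional (L delta mu : R) (L0 : 0 < L) (mu01 : 0 < mu < 1) (r : nat)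
  (dO : measure_display) (Omega : measurableType dO)
  (P : probability Omega R) (X : nat -> {RV P >-> Rvec R d}) o :
  ~ exceptional L X mu r o -> sampling_event L delta mu r X o.
Proof.
move=> hE; rewrite sampling_eventE => u um.
have uu := unit_member_unit_band um.
have h := chaining L0 mu01 uu hE.
have h1 := unit_member_concentrated um; have h2 := energy_le1 L uu.
have t0 : 0 <= r%:R / L ^+ d by rewrite divr_ge0// exprn_ge0// ltW.
move: h; rewrite /discrepancy /avg mulrA ler_norml /sample_energy.
move: (\sum_(j < r) _) (r%:R / L ^+ d) (\int[_]_(x in _) _) h1 h2 t0 => S t E h1 h2 t0.
have a1 : t * (1 - delta) <= t * E by rewrite ler_wpM2l.
have a2 : t * E <= t by rewrite ler_piMr.
by move=> /andP[? ?]; apply/andP; split; lra.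
Qed.

(** Either the claimed lower bound is negative, or s is large enough for the
    exceptional event to be controlled. *)
Lemma sampling_holds (C L delta mu : R) (r : nat) : 0 < C ->
  (forall k, (#|codeT d L (taylor_order d k) (quant_levels d k)|%:R : R) <= expR (C * (L + 1) ^+ d * 2 ^+ k)) ->
  0 < L -> 0 < mu < 1 ->
  sampling_holds_with_constants d L delta mu r
    (expR (3 * C * (L + 1) ^+ d + 1)) (Num.sqrt 2 / 36).
Proof.
move=> C0 cardC L0 mu01 dO Omega P X indX uniX.
have /andP[mu0 mu1] := mu01.
have mS := measurable_sampling_event L delta mu r X.
split; first exact: mS.
set H := 3 * C * (L + 1) ^+ d + 1.
have Ld0 : 0 < L ^+ d by rewrite exprn_gt0.
have H1 : 1 <= H.
  by rewrite /H lerDr !mulr_ge0// ?(ltW C0)// exprn_ge0// addr_ge0// ltW.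
set rate := r%:R / L ^+ d * mu ^+ 2.
have rate0 : 0 <= rate by rewrite mulr_ge0 ?sqr_ge0// divr_ge0// ltW.
set c : R := Num.sqrt 2 / 36 / (41 + mu).
have sqrt2 : Num.sqrt 2 <= 8 / 5 :> R.
  by rewrite -(@ler_pXn2r _ 2)// ?nnegrE ?sqrtr_ge0// ?sqr_sqrtr//; lra.
have c0 : 0 <= c by rewrite !divr_ge0// ?sqrtr_ge0//; lra.
have c900 : c <= 900^-1.
  rewrite /c ler_pdivrMr; last lra.
  rewrite ler_pdivrMr//; lra.
have -> : Num.sqrt 2 / 36 * (r%:R / L ^+ d) * (mu ^+ 2 / (41 + mu)) = c * rate.
  by rewrite /c /rate; field; rewrite gt_eqF//=; lra.
have [small|large] := leP (c * rate) H.
  (* The claimed bound is at most 1 - 2. *)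
  apply: (@le_trans _ _ 0%E); last exact: measure_ge0.
  rewrite lee_fin subr_le0 -mulrA -expRD.
  have : 1 <= expR (H - c * rate) by rewrite -expR0 ler_expR subr_ge0.
  lra.
have rateC : 900 * H <= rate.
  have : c * rate <= 900^-1 * rate by rewrite ler_wpM2r.
  lra.
have [mE PE] := exceptionalP L0 indX uniX mu01 C0 cardC rateC.
have sub : ~` exceptional L X mu r `<=` sampling_event L delta mu r X.
  by move=> o; exact: sampling_off_exceptional.
have mC := measurableC mE.
apply: (@le_trans _ _ (P (~` exceptional L X mu r))); last by apply: le_measure; rewrite ?inE.
rewrite -/rate in PE.
rewrite probability_setC// EFinB; apply: leeB => //.
apply: (le_trans PE); rewrite lee_fin -[leRHS]mulrA -expRD ler_pM2l// ler_expR.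
have h := ler_wpM2r rate0 c900; move: h H1; clearbody c rate H.
lra.
Qed.

End sampling_probability.

Theorem theorem3p1 (R : realType) (d : nat) (d_gt0 : (0 < d)%N) :
  (forall L delta : R, 0 < L -> 0 < delta < 1 ->
     (exists f, @Bunit R d L delta f) ->
     (exists A B : R,
        [/\ 0 < A, 0 < B
          & forall (mu : R) (r : nat), 0 < mu < 1 - delta ->
              sampling_holds_with_constants d L delta mu r A B]) /\
     (exists A : R,
        0 < A /\
        forall (mu : R) (r : nat), 0 < mu < 1 - delta ->
          sampling_holds_with_constants d L delta mu r A (Num.sqrt 2 / 36)))
  /\
  (exists C : R, 0 < C /\
   exists L0 : R, 0 < L0 /\
   forall L : R, L0 <= L ->
   exists r0 : nat,
   forall (delta mu : R) (r : nat), 0 < delta < 1 ->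
     (exists f, @Bunit R d L delta f) ->
     0 < mu < 1 - delta -> (r0 <= r)%N ->
     sampling_holds_with_constants d L delta mu r
       (expR (C * L ^+ d)) (Num.sqrt 2 / 36)).
Proof.
have [C C0 cardC] := @card_code_level R d.
have holds L delta mu r : 0 < L -> 0 < delta < 1 -> 0 < mu < 1 - delta ->
    sampling_holds_with_constants d L delta mu r
      (expR (3 * C * (L + 1) ^+ d + 1)) (Num.sqrt 2 / 36).
  move=> L0 /andP[delta0 _] /andP[mu0 mu1]; apply: sampling_holds => //.
    by move=> k; exact: cardC.
  by apply/andP; split => //; lra.
split=> [L delta L0 delta01 _|].
  split; exists (expR (3 * C * (L + 1) ^+ d + 1)).
    exists (Num.sqrt 2 / 36); split; [exact: expR_gt0| |].
      by rewrite divr_gt0// sqrtr_gt0.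
    by move=> mu r mu01; exact: holds.
  split; first exact: expR_gt0.
  by move=> mu r mu01; exact: holds.
exists (3 * C * 2 ^+ d + 1); split; first by rewrite addr_gt0// !mulr_gt0// exprn_gt0.
exists 1; split=> // L L1; exists 0%N => delta mu r delta01 _ mu01 _.
move=> dO Omega P X indX uniX.
have L0 : 0 < L by lra.
have [mS lower] := holds L delta mu r L0 delta01 mu01 dO Omega P X indX uniX.
split=> //; apply: le_trans lower; rewrite lee_fin lerD2l lerN2.
apply: ler_wpM2r; first exact: expR_ge0.
rewrite ler_pM2l// ler_expR [leRHS]mulrDl mul1r; apply: lerD; last exact: exprn_ege1.
by rewrite -!mulrA ler_pM2l// ler_pM2l// -exprMn lerXn2r ?nnegrE//; lra.
Qed.
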